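(* Let $R>0$, $A>0$, $d\in\left(0,\frac{B_1^2}{B_1^2+5\pi^2/4}\right)$, and let $(p,q)$ be a data pair (as defined in the context) with $$\|p(\cdot,\cdot,B_2,\cdot)\|_{C^1(\overline\Gamma_u\times[0,\pi])}\le A,\qquad\|q\|_{C^1(\overline G\times[0,\pi])}\le A.$$ For $\lambda>0$, $\alpha\in(0,1)$ let $$J_{\lambda,\alpha}(Q)=e^{-2\lambda B_1}\int_{B_1}^{B_2}\left|Q(z)-\mathcal F_{p,q}(Q)(z)-\widehat v_0-\widehat q(z)\right|^2e^{2\lambda z}\,dz+\alpha\|Q\|^2_{H^1(B_1,B_2)}.$$ Then: (i) $J_{\lambda,\alpha}$ has a Fréchet derivative $J_{\lambda,\alpha}'(Q)$ at every point $Q\in B(2R,q,d)$, and this derivative is Lipschitz continuous: there is a constant $M>0$, independent of $Q_1,Q_2$, such that $$\|J'_{\lambda,\alpha}(Q_2)-J'_{\lambda,\alpha}(Q_1)\|_{H^1(B_1,B_2)}\le M\|Q_2-Q_1\|_{H^1(B_1,B_2)}\quad\forall Q_1,Q_2\in B(2R,q,d).$$ (ii) There exists a sufficiently large number $\overline\lambda=\overline\lambda(G,N,K,A,R,d)>1$, depending only on the listed parameters, such that for every $\lambda\ge\overline\lambda$ the functional $J_{\lambda,\alpha}$ is strictly convex on $\overline{B(R,q,d)}$, in the sense that $$J_{\lambda,\alpha}(Q_2)-J_{\lambda,\alpha}(Q_1)-J'_{\lambda,\alpha}(Q_1)(Q_2-Q_1)\ge\frac18\|Q_2-Q_1\|^2_{L_2(B_1,B_2)}+\alpha\|Q_2-Q_1\|^2_{H^1(B_1,B_2)}$$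 for all $\lambda\ge\overline\lambda$ and all $Q_1,Q_2\in\overline{B(R,q,d)}$.
   Context: Fix throughout $0<B_1<B_2$, integers $N,K\ge1$ and $\beta>0$. Points of $\mathbb R^3$ are $\mathbf u=(x,y,z)$; $G=(0,\pi)^2\times(B_1,B_2)$, $\Gamma_l=\{0<x,y<\pi,\ z=B_1\}$, $\Gamma_u=\{0<x,y<\pi,\ z=B_2\}$, $\partial_1G=\partial G\setminus(\Gamma_l\cup\Gamma_u)$. Basis: $\varphi_0,\dots,\varphi_{N-1}$ are obtained by Gram-Schmidt orthonormalization in $L_2(0,\pi)$ of the functions $(a+\beta)^ne^a$, $n=0,\dots,N-1$. It is a known fact that the $N\times N$ matrix of numbers $\int_0^\pi\varphi_n'\varphi_l\,da$ is invertible. Put $v_0(x,y,a)=\dfrac{B_1^2}{(x-a)^2+(y-\pi/2)^2+B_1^2}$. Data pair $(p,q)$: $p=p(\mathbf u,a)$ is a function on $(\partial G\setminus\Gamma_l)\times[0,\pi]$ (travel time data for the source $(a,\pi/2,0)$), with $p(\cdot,\cdot,B_2,\cdot)\in C^1(\overline\Gamma_u\times[0,\pi])$ and differentiable in $z$ on $\partial_1G\times(0,\pi)$; and $q\in C^1(\overline G\times[0,\pi])$ satisfies $q=\overline p$ on $\partial_1G\times(0,\pi)$, where $\overline p=(\partial_zp)^2-v_0$, and $q(x,y,B_1,a)=0$ for $(x,y,a)\in(0,\pi)^3$. For an $NK^2$-dimensional vector function $Q(z)=(w_{n,km}(z))$, $0\le n\le N-1$, $1\le k,m\le K$, continuous on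 $[B_1,B_2]$, put $$V_Q(\mathbf u,a)=\sum_{n=0}^{N-1}\sum_{k,m=1}^Kw_{n,km}(z)\varphi_n(a)\sin(kx)\sin(my),\qquad v_{Q,q}(\mathbf u,a)=v_0(x,y,a)+q(\mathbf u,a)+V_Q(\mathbf u,a).$$ When $v=v_{Q,q}>0$ on $\overline G\times[0,\pi]$, put $$E^x_{p,q,Q}(x,y,z,a)=-\int_z^{B_2}\frac{v_x}{2\sqrt v}(x,y,s,a)\,ds+p_x(x,y,B_2,a),$$ $$E^y_{p,q,Q}(x,y,z,a)=-\int_z^{B_2}\frac{v_y}{2\sqrt v}(x,y,s,a)\,ds+p_y(x,y,B_2,a).$$ For a function $h(x,y,a)$ on $[0,\pi]^3$ let $\Lambda h=((\Lambda h)_{n,km})\in\mathbb R^{NK^2}$ be the unique solution of $$\frac{\pi^2}{4}\sum_{n=0}^{N-1}\Big(\int_0^\pi\varphi_n'\varphi_l\,da\Big)(\Lambda h)_{n,km}=-\int_0^\pi\!\int_0^\pi\!\int_0^\pi\partial_ah(x,y,a)\sin(kx)\sin(my)\varphi_l(a)\,da\,dx\,dy,$$ for $0\le l\le N-1$, $1\le k,m\le K$; if $h$ is merely continuous, the inner integral $\int_0^\pi\partial_ah\,\varphi_l\,da$ is understood as $[h\varphi_l]_{a=0}^{a=\pi}-\int_0^\pi h\varphi_l'\,da$. Define $$\mathcal F_{p,q}(Q)(z)=\Lambda\big((E^x_{p,q,Q})^2+(E^y_{p,q,Q})^2\big)(z),\qquad\widehat v_0=\Lambda v_0,\qquad\widehat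 q(z)=\Lambda q(\cdot,\cdot,z,\cdot),$$ where $\Lambda$ is applied in the variables $(x,y,a)$ for fixed $z$. Norms of vector functions are square roots of sums of squared norms of components. $H_0^1(B_1,B_2)=\{Q\in H^1(B_1,B_2):Q(B_1)=0\}$ ($NK^2$-dimensional vector functions), with the $H^1$ scalar product, and $$B(R,q,d)=\{Q\in H_0^1(B_1,B_2):\ \|Q\|_{H^1(B_1,B_2)}<R,\ q+V_Q>-d\text{ on }\overline G\times[0,\pi]\}.$$ The closure $\overline{B(R,q,d)}$ is taken in $H^1_0(B_1,B_2)$. Since $v_0\ge B_1^2/(B_1^2+5\pi^2/4)$ on $[0,\pi]^3$, $v_{Q,q}$ is bounded below by a positive constant on these sets. The functional $J_{\lambda,\alpha}$ is defined by its formula on the open set of all $Q\in H_0^1(B_1,B_2)$ with $v_{Q,q}>0$ on $\overline G\times[0,\pi]$, which contains $B(2R,q,d)$ and $\overline{B(R,q,d)}$; derivatives are Fréchet derivatives in $H_0^1(B_1,B_2)$, identified with elements of $H_0^1(B_1,B_2)$ by the Riesz theorem. *)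

(* Defs.v *)
From HB Require Import structures.
From mathcomp Require Import all_boot all_order all_algebra.
From mathcomp Require Import all_classical all_reals all_analysis.
Set Implicit Arguments.
Unset Strict Implicit.
Unset Printing Implicit Defensive.
Import Order.TTheory GRing.Theory Num.Theory.
Import numFieldNormedType.Exports.
Local Open Scope classical_set_scope.
Local Open Scope ring_scope.

Notation leb := lebesgue_measure.

(** ** C^1 functions on closed boxes

    Functions on a closed box are represented by total functions, whose values
    outside the box are irrelevant; derivatives are therefore taken relative
    to an interval, i.e. they are one-sided at its endpoints. *)
Section C1.
Context {R : realType}.
Implicit Types (D : set R) (f : R -> R) (x : R).

Definition quot f x : R -> R := fun t => (f t - f x) / (t - x).

Definition derivable_in D f x : Prop :=
  cvg (quot f x t @[t --> within (D `\ x) (nbhs x)]).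

Definition deriv_in D f x : R :=
  lim (quot f x t @[t --> within (D `\ x) (nbhs x)]).

Definition C1_1 D f : Prop :=
  (forall x, D x -> derivable_in D f x) /\
  {within D, continuous (deriv_in D f)}.

Definition box3 (D1 D2 D3 : set R) : set (R * R * R) := D1 `*` D2 `*` D3.
Definition box4 (D1 D2 D3 D4 : set R) : set (R * R * R * R) :=
  D1 `*` D2 `*` D3 `*` D4.
Definition unc3 (g : R -> R -> R -> R) : R * R * R -> R :=
  fun u => g u.1.1 u.1.2 u.2.
Definition unc4 (g : R -> R -> R -> R -> R) : R * R * R * R -> R :=
  fun u => g u.1.1.1 u.1.1.2 u.1.2 u.2.

Definition d1of3 D (g : R -> R -> R -> R) x y a := deriv_in D (fun t => g t y a) x.
Definition d2of3 D (g : R -> R -> R -> R) x y a := deriv_in D (fun t => g x t a) y.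
Definition d3of3 D (g : R -> R -> R -> R) x y a := deriv_in D (fun t => g x y t) a.

Definition d1of4 D (g : R -> R -> R -> R -> R) x y z a :=
  deriv_in D (fun t => g t y z a) x.
Definition d2of4 D (g : R -> R -> R -> R -> R) x y z a :=
  deriv_in D (fun t => g x t z a) y.
Definition d3of4 D (g : R -> R -> R -> R -> R) x y z a :=
  deriv_in D (fun t => g x y t a) z.
Definition d4of4 D (g : R -> R -> R -> R -> R) x y z a :=
  deriv_in D (fun t => g x y z t) a.

Definition C1_3 (D1 D2 D3 : set R) (g : R -> R -> R -> R) : Prop :=
  (forall x y a, D1 x -> D2 y -> D3 a ->
     [/\ derivable_in D1 (fun t => g t y a) x,
         derivable_in D2 (fun t => g x t a) y &
         derivable_in D3 (fun t => g x y t) a]) /\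
  [/\ {within box3 D1 D2 D3, continuous (unc3 g)},
      {within box3 D1 D2 D3, continuous (unc3 (d1of3 D1 g))},
      {within box3 D1 D2 D3, continuous (unc3 (d2of3 D2 g))} &
      {within box3 D1 D2 D3, continuous (unc3 (d3of3 D3 g))}].

Definition C1_4 (D1 D2 D3 D4 : set R) (g : R -> R -> R -> R -> R) : Prop :=
  (forall x y z a, D1 x -> D2 y -> D3 z -> D4 a ->
     [/\ derivable_in D1 (fun t => g t y z a) x,
         derivable_in D2 (fun t => g x t z a) y,
         derivable_in D3 (fun t => g x y t a) z &
         derivable_in D4 (fun t => g x y z t) a]) /\
  [/\ {within box4 D1 D2 D3 D4, continuous (unc4 g)},
      {within box4 D1 D2 D3 D4, continuous (unc4 (d1of4 D1 g))},
      {within box4 D1 D2 D3 D4, continuous (unc4 (d2of4 D2 g))},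
      {within box4 D1 D2 D3 D4, continuous (unc4 (d3of4 D3 g))} &
      {within box4 D1 D2 D3 D4, continuous (unc4 (d4of4 D4 g))}].

Definition supnorm (T : Type) (D : set T) (f : T -> R) : R :=
  sup [set `|f u| | u in D].

Definition normC1_3 (D1 D2 D3 : set R) (g : R -> R -> R -> R) : R :=
  let S h := supnorm (box3 D1 D2 D3) (unc3 h) in
  S g + S (d1of3 D1 g) + S (d2of3 D2 g) + S (d3of3 D3 g).

Definition normC1_4 (D1 D2 D3 D4 : set R) (g : R -> R -> R -> R -> R) : R :=
  let S h := supnorm (box4 D1 D2 D3 D4) (unc4 h) in
  S g + S (d1of4 D1 g) + S (d2of4 D2 g) + S (d3of4 D3 g) + S (d4of4 D4 g).

End C1.

(** ** The orthonormal basis phi_n of L_2(0, pi) *)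
Section basis.
Context {R : realType}.
Variable beta : R.

Definition Ipi : set R := `[0, pi]%classic.

Definition dotL2pi (f g : R -> R) : R := \int[leb]_(a in Ipi) (f a * g a).

Definition psi (n : nat) : R -> R := fun a => (a + beta) ^+ n * expR a.

(* One Gram-Schmidt step: [f] is orthogonalized against [s], then normalized. *)
Definition GS_step (s : seq (R -> R)) (f : R -> R) : R -> R :=
  let g := fun a => f a - \sum_(e <- s) dotL2pi f e * e a in
  fun a => g a / Num.sqrt (dotL2pi g g).

Fixpoint GS (n : nat) : seq (R -> R) :=
  if n is n'.+1 then rcons (GS n') (GS_step (GS n') (psi n')) else [::].

Definition phi (n : nat) : R -> R := GS_step (GS n) (psi n).

End basis.

(** ** The Sobolev space H^1_0(B1, B2) of vector functions

    As in the one-dimensional theory, an element of H^1(B1, B2) is identified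
    with its continuous representative on [B1, B2], and weak derivatives are
    tested against compactly supported C^1 functions.  A vector function is a
    family of functions on R; only its values on [B1, B2] matter. *)
Section H1.
Context {R : realType}.
Variables (B1 B2 : R) (I : finType).
Implicit Types (f g : R -> R) (P Q : I -> R -> R).

Definition Oz : set R := `]B1, B2[%classic.

Definition is_L2 f : Prop :=
  measurable_fun Oz f /\ leb.-integrable Oz (fun z => (f z ^+ 2)%:E).

Definition test_fun (t : R -> R) : Prop :=
  (forall z, derivable t z 1) /\ continuous (derive1 t) /\
  exists b1 b2, [/\ B1 < b1, b2 < B2 & forall z, ~ b1 <= z <= b2 -> t z = 0].

Definition weak_deriv f g : Prop :=
  forall t, test_fun t ->
    \int[leb]_(z in Oz) (f z * derive1 t z) = - (\int[leb]_(z in Oz) (g z * t z)).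

(* The weak derivative, determined almost everywhere on (B1, B2). *)
Definition wderiv f : R -> R :=
  xget (fun=> 0) [set g | is_L2 g /\ weak_deriv f g].

Definition is_H1 f : Prop := is_L2 f /\ exists g, is_L2 g /\ weak_deriv f g.

Definition H10 : set (I -> R -> R) :=
  [set Q | forall i, [/\ {within `[B1, B2], continuous (Q i)},
                         is_H1 (Q i) & Q i B1 = 0]].

Definition dotL2 P Q : R := \sum_i \int[leb]_(z in Oz) (P i z * Q i z).

Definition dotH1 P Q : R :=
  dotL2 P Q + dotL2 (fun i => wderiv (P i)) (fun i => wderiv (Q i)).

Definition normL2 Q : R := Num.sqrt (dotL2 Q Q).
Definition normH1 Q : R := Num.sqrt (dotH1 Q Q).

Definition closureH10 (S : set (I -> R -> R)) : set (I -> R -> R) :=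
  [set Q | H10 Q /\ forall eps, 0 < eps -> exists2 P, S P & normH1 (P - Q) < eps].

(* [J] is Frechet differentiable at [Q] in H^1_0, and [g] is the Riesz
   representative of its derivative. *)
Definition frechet_grad (J : (I -> R -> R) -> R) Q (g : I -> R -> R) : Prop :=
  H10 g /\ forall eps, 0 < eps -> exists2 delta, 0 < delta &
    forall h, H10 h -> normH1 h < delta ->
      `|J (Q + h) - J Q - dotH1 g h| <= eps * normH1 h.

End H1.

(** ** The functional J *)
Section functional.
Context {R : realType}.
Variables (B1 B2 : R) (N K : nat) (beta : R).

(* (n, k, m) stands for the component w_{n,k+1 m+1}: 'I_K starts at 0. *)
Definition idx : finType := ('I_N * 'I_K * 'I_K)%type.

Definition sinK (k : 'I_K) (x : R) : R := sin (k.+1%:R * x).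

Definition v0 (x y a : R) : R :=
  B1 ^+ 2 / ((x - a) ^+ 2 + (y - pi / 2) ^+ 2 + B1 ^+ 2).

Definition Iz : set R := `[B1, B2]%classic.

Definition Gdom : set (R * R * R) := box3 `]0, pi[ `]0, pi[ `]B1, B2[.
Definition Gamma_l : set (R * R * R) := box3 `]0, pi[ `]0, pi[ [set B1].
Definition Gamma_u : set (R * R * R) := box3 `]0, pi[ `]0, pi[ [set B2].
Definition bdG : set (R * R * R) := closure Gdom `\` Gdom°.
Definition d1G : set (R * R * R) := bdG `\` (Gamma_l `|` Gamma_u).

Definition p_bar (p : R -> R -> R -> R -> R) (x y z a : R) : R :=
  d3of4 Iz p x y z a ^+ 2 - v0 x y a.

Definition data_pair (p q : R -> R -> R -> R -> R) : Prop :=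
  [/\ C1_3 Ipi Ipi Ipi (fun x y a => p x y B2 a),
      forall x y z a, d1G (x, y, z) -> 0 < a < pi ->
        derivable_in Iz (fun t => p x y t a) z,
      C1_4 Ipi Ipi Iz Ipi q,
      forall x y z a, d1G (x, y, z) -> 0 < a < pi -> q x y z a = p_bar p x y z a &
      forall x y a, 0 < x < pi -> 0 < y < pi -> 0 < a < pi -> q x y B1 a = 0].

Definition VQ (Q : idx -> R -> R) (x y z a : R) : R :=
  \sum_(i : idx) Q i z * phi beta i.1.1 a * sinK i.1.2 x * sinK i.2 y.

Definition vQq (q : R -> R -> R -> R -> R) (Q : idx -> R -> R) (x y z a : R) : R :=
  v0 x y a + q x y z a + VQ Q x y z a.

Definition Ex (p q : R -> R -> R -> R -> R) (Q : idx -> R -> R) (x y z a : R) : R :=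
  - (\int[leb]_(s in `[z, B2])
      (d1of4 Ipi (vQq q Q) x y s a / (2 * Num.sqrt (vQq q Q x y s a))))
  + d1of4 Ipi p x y B2 a.

Definition Ey (p q : R -> R -> R -> R -> R) (Q : idx -> R -> R) (x y z a : R) : R :=
  - (\int[leb]_(s in `[z, B2])
      (d2of4 Ipi (vQq q Q) x y s a / (2 * Num.sqrt (vQq q Q x y s a))))
  + d2of4 Ipi p x y B2 a.

(* int_0^pi h'(a) phi_l(a) da, in the integrated-by-parts sense when h is not
   C^1 on [0, pi]. *)
Definition da_moment (h : R -> R) (l : nat) : R :=
  if `[< C1_1 Ipi h >]
  then \int[leb]_(a in Ipi) (deriv_in Ipi h a * phi beta l a)
  else h pi * phi beta l pi - h 0 * phi beta l 0
       - (\int[leb]_(a in Ipi) (h a * derive1 (phi beta l) a)).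

Definition Lambda_system (h : R -> R -> R -> R) (w : idx -> R) : Prop :=
  forall (l : 'I_N) (k m : 'I_K),
    pi ^+ 2 / 4 *
      \sum_(n < N) (\int[leb]_(a in Ipi) (derive1 (phi beta n) a * phi beta l a))
                   * w (n, k, m)
    = - (\int[leb]_(y in Ipi) \int[leb]_(x in Ipi)
          (da_moment (h x y) l * sinK k x * sinK m y)).

Definition Lambda (h : R -> R -> R -> R) : idx -> R :=
  xget (fun=> 0) [set w | Lambda_system h w].

Definition calF (p q : R -> R -> R -> R -> R) (Q : idx -> R -> R) : idx -> R -> R :=
  fun i z => Lambda (fun x y a => Ex p q Q x y z a ^+ 2 + Ey p q Q x y z a ^+ 2) i.

Definition v0_hat : idx -> R := Lambda v0.

Definition q_hat (q : R -> R -> R -> R -> R) : idx -> R -> R :=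
  fun i z => Lambda (fun x y a => q x y z a) i.

(* Meaningful on the open set of the Q in H^1_0 with vQq q Q > 0 on the closed
   box; elsewhere it takes irrelevant values. *)
Definition J (p q : R -> R -> R -> R -> R) (lambda alpha : R)
    (Q : idx -> R -> R) : R :=
  expR (- (2 * lambda * B1)) *
    (\int[leb]_(z in `[B1, B2])
      ((\sum_(i : idx) (Q i z - calF p q Q i z - v0_hat i - q_hat q i z) ^+ 2)
       * expR (2 * lambda * z)))
  + alpha * normH1 B1 B2 Q ^+ 2.

Definition ball_Rqd (r : R) (q : R -> R -> R -> R -> R) (d : R) :
    set (idx -> R -> R) :=
  [set Q | [/\ @H10 R B1 B2 idx Q, normH1 B1 B2 Q < r &
    forall x y z a, Ipi x -> Ipi y -> Iz z -> Ipi a ->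
      - d < q x y z a + VQ Q x y z a]].

End functional.

(* Main.v *)
Require Import Defs.
From HB Require Import structures.
From mathcomp Require Import all_boot all_order all_algebra.
From mathcomp Require Import all_classical all_reals all_analysis.
From mathcomp Require Import measurable_realfun.
From mathcomp Require Import ring lra.
Set Implicit Arguments.
Unset Strict Implicit.
Unset Printing Implicit Defensive.
Import Order.TTheory GRing.Theory Num.Theory.
Import numFieldNormedType.Exports.
Local Open Scope classical_set_scope.
Local Open Scope ring_scope.

(** The unknown Q enters the nonlinear operator F only through integrals over
    [z, B2]: the slopes E^x, E^y of the travel time are recovered by integrating
    v_x / (2 sqrt v) and v_y / (2 sqrt v) downwards from the top face.  Hence, with
    h = Q2 - Q1 and eta the sum of the |h_i|, F obeys Volterra-type estimates
<<
      |F(Q2)(z) - F(Q1)(z)|              <= C * (integral of eta over [z, B2]),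
      |F(Q2)(z) - F(Q1)(z) - F'(Q1)h(z)| <= C * (integral of eta^2 over [z, B2]),
>>
    where F'(Q1) is a Volterra operator with a bounded continuous kernel which is
    Lipschitz in Q1 (forward_estimates).  They follow from the regularity of
    d / (2 sqrt v) in (v, d) for v bounded away from 0 (dsqrt_estimates) and from
    Lambda being given by sup-norm bounded linear functionals which commute with
    integration in z (coef_bound, coef_prim, Lambda_eq).  The constant C depends on
    the bounds of the data alone: it is uniform in beta because the functions
    (a + beta)^n e^a, n < N, span the same flag for all beta, so that the
    Gram-Schmidt basis is the same (phi_indep).

    Let T(Q) = Q - F(Q) - v0^ - q^.  The part of J that is not the Tikhonov term has
    at Q1 the exact second-order remainder (weighted_residual_expand)
<<
      integral of e^{2 lambda (z - B1)} *
        sum_i ((T_i(Q2) - T_i(Q1))^2 - 2 T_i(Q1) (F_i(Q2) - F_i(Q1) - F_i'(Q1)h)).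
>>
    For part (i), this is of order sup |h|^2, and the sup norm is controlled by the
    H^1 norm (H10_sup), which gives Frechet differentiability.  Exchanging the order
    of integration over the triangle z <= s writes the derivative as the integral of
    rho . h for a continuous rho (residual_derivative_density), whose representer in
    H^1_0 is explicit (riesz_scalar).  The derivative is Lipschitz because T, the
    kernel of F' and hence the density are (is_grad_lipschitz).

    For part (ii), the estimates bound the i-th summand of the remainder from below
    by |h_i|^2 / 2 - C * (integral of |h|^2 over [z, B2])
    (residual_remainder_lower).  The Carleman inequality carleman_volterra says that
    against the weight e^{2 lambda z} such a tail integral costs only 1 / (2 lambda)
    times the weighted norm of h.  For lambda large, depending on C only, at least
    1/8 of the weighted norm remains (weighted_residual_convex), whereas the Tikhonov
    term, being quadratic, contributes alpha times the squared H^1 norm of h exactly.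

    Two devices run through the text.  Elements of H^1_0 are handled as primitives
    of square-integrable functions (H1_primitive), so weak derivatives are met only
    in the comparison with the definition.  Functions given on closed boxes are
    composed with the retraction onto the box (clamp), so that continuity is always
    continuity on the whole space. *)

(** * Integrals of continuous functions and a Carleman inequality *)

Section IntegralsOfContinuousFunctions.
Context {R : realType}.
Implicit Types (f g : R -> R) (a b c z : R).

Lemma cont_integrable a b f : continuous f ->
  leb.-integrable `[a, b] (EFin \o f).
Proof.
move=> cf; apply: continuous_compact_integrable; first exact: segment_compact.
exact: continuous_subspaceT.
Qed.

Lemma mulfun_cont (T : topologicalType) (f g : T -> R) :
  continuous f -> continuous g -> continuous (fun x => f x * g x).
Proof. by move=> cf cg x; apply: cvgM; [exact: cf|exact: cg]. Qed.

Lemma addfun_cont (T : topologicalType) (f g : T -> R) :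
  continuous f -> continuous g -> continuous (fun x => f x + g x).
Proof. by move=> cf cg x; apply: cvgD; [exact: cf|exact: cg]. Qed.

Lemma oppfun_cont (T : topologicalType) (f : T -> R) :
  continuous f -> continuous (fun x => - f x).
Proof. by move=> cf x; apply: cvgN; exact: cf. Qed.

Lemma subfun_cont (T : topologicalType) (f g : T -> R) :
  continuous f -> continuous g -> continuous (fun x => f x - g x).
Proof. by move=> cf cg x; apply: cvgB; [exact: cf|exact: cg]. Qed.

Lemma expfun_cont (T : topologicalType) n (f : T -> R) :
  continuous f -> continuous (fun x => f x ^+ n).
Proof.
move=> cf; elim: n => [|n IH] x; first exact: cvg_cst.
rewrite (_ : (fun _ => _) = (fun x => f x * f x ^+ n)).
  exact: mulfun_cont.
by apply/funext => y; rewrite exprS.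
Qed.

Lemma normfun_cont (T : topologicalType) (f : T -> R) :
  continuous f -> continuous (fun x => `|f x|).
Proof. by move=> cf x; apply: cvg_norm; exact: cf. Qed.

Lemma cstfun_cont (T : topologicalType) (k : R) :
  continuous (fun _ : T => k).
Proof. by move=> x; exact: cvg_cst. Qed.

Lemma invfun_cont (T : topologicalType) (f : T -> R) : (forall x, f x != 0) ->
  continuous f -> continuous (fun x => (f x)^-1).
Proof. by move=> f0 cf x; apply: cvgV => //; exact: cf. Qed.

Lemma sumseq_cont (T : topologicalType) (I : Type) (s : seq I) (f : I -> T -> R) :
  (forall i, continuous (f i)) -> continuous (fun x => \sum_(i <- s) f i x).
Proof.
move=> cf; elim: s => [|i s IH].
  under eq_fun do rewrite big_nil; exact: cstfun_cont.
by under eq_fun do rewrite big_cons; exact: addfun_cont.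
Qed.

Lemma sumfun_cont (T : topologicalType) (I : finType) (f : I -> T -> R) :
  (forall i, continuous (f i)) -> continuous (fun x => \sum_i f i x).
Proof. by move=> cf; apply: sumseq_cont. Qed.

Lemma compfun_cont (T U V : topologicalType) (f : U -> V) (g : T -> U) :
  continuous f -> continuous g -> continuous (fun x => f (g x)).
Proof. by move=> cf cg x; apply: continuous_comp; [exact: cg|exact: cf]. Qed.

Lemma pairfun_cont (T U V : topologicalType) (f : T -> U) (g : T -> V) :
  continuous f -> continuous g -> continuous (fun x => (f x, g x)).
Proof. by move=> cf cg x; apply: cvg_pair; [exact: cf|exact: cg]. Qed.

Lemma fstfun_cont (T U V : topologicalType) (f : T -> U * V) :
  continuous f -> continuous (fun x => (f x).1).
Proof. move=> cf; apply: (compfun_cont _ cf) => x; exact: cvg_fst. Qed.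

Lemma sndfun_cont (T U V : topologicalType) (f : T -> U * V) :
  continuous f -> continuous (fun x => (f x).2).
Proof. move=> cf; apply: (compfun_cont _ cf) => x; exact: cvg_snd. Qed.

Lemma idfun_cont (T : topologicalType) : continuous (fun x : T => x).
Proof. by move=> x; exact: cvg_id. Qed.

Lemma curry_right_cont (T U : topologicalType) (F : T * U -> R) t : continuous F ->
  continuous (fun u => F (t, u)).
Proof.
by move=> cF; apply: (compfun_cont cF); apply: pairfun_cont; [exact: cst_continuous|exact: idfun_cont].
Qed.

Lemma curry_left_cont (T U : topologicalType) (F : T * U -> R) u : continuous F ->
  continuous (fun t => F (t, u)).
Proof.
by move=> cF; apply: (compfun_cont cF); apply: pairfun_cont; [exact: idfun_cont|exact: cst_continuous].
Qed.

Lemma diag_cont (T : topologicalType) (F : T * T -> R) : continuous F -> continuous (fun t => F (t, t)).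
Proof. by move=> cF; apply: (compfun_cont cF); apply: pairfun_cont; exact: idfun_cont. Qed.

Lemma swap_cont (T U : topologicalType) (F : T * U -> R) : continuous F ->
  continuous (fun p : U * T => F (p.2, p.1)).
Proof.
move=> cF; apply: (compfun_cont cF); apply: pairfun_cont.
  exact: sndfun_cont (@idfun_cont _).
exact: fstfun_cont (@idfun_cont _).
Qed.

Lemma ig_ge0 a b f : (forall x, a <= x <= b -> 0 <= f x) ->
  0 <= \int[leb]_(x in `[a, b]) f x.
Proof. by move=> f0; apply: Rintegral_ge0 => x /=; rewrite in_itv; exact: f0. Qed.

Lemma igD a b f g : continuous f -> continuous g ->
  \int[leb]_(x in `[a, b]) (f x + g x) =
  \int[leb]_(x in `[a, b]) f x + \int[leb]_(x in `[a, b]) g x.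
Proof. by move=> cf cg; rewrite RintegralD//; exact: cont_integrable. Qed.

Lemma igB a b f g : continuous f -> continuous g ->
  \int[leb]_(x in `[a, b]) (f x - g x) =
  \int[leb]_(x in `[a, b]) f x - \int[leb]_(x in `[a, b]) g x.
Proof. by move=> cf cg; rewrite RintegralB//; exact: cont_integrable. Qed.

Lemma igZ a b f k : continuous f ->
  \int[leb]_(x in `[a, b]) (k * f x) = k * \int[leb]_(x in `[a, b]) f x.
Proof. by move=> cf; rewrite RintegralZl//; exact: cont_integrable. Qed.

Lemma igN a b f : continuous f ->
  \int[leb]_(x in `[a, b]) (- f x) = - \int[leb]_(x in `[a, b]) f x.
Proof.
by move=> cf; under eq_Rintegral do rewrite -mulN1r; rewrite igZ// mulN1r.
Qed.

Lemma eq_ig a b f g : (forall x, a <= x <= b -> f x = g x) ->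
  \int[leb]_(x in `[a, b]) f x = \int[leb]_(x in `[a, b]) g x.
Proof.
by move=> fg; apply: eq_Rintegral => x; rewrite inE/= in_itv/=; exact: fg.
Qed.

Lemma ig0 a b : \int[leb]_(x in `[a, b]) (0 : R) = 0.
Proof. by rewrite Rintegral_cst// mul0r. Qed.

Lemma ig_sum (I : finType) a b (f : I -> R -> R) : (forall i, continuous (f i)) ->
  \int[leb]_(x in `[a, b]) (\sum_i f i x) =
  \sum_i \int[leb]_(x in `[a, b]) f i x.
Proof.
move=> cf.
have cs (s : seq I) : continuous (fun x => \sum_(i <- s) f i x).
  exact: sumseq_cont.
elim: (index_enum I) => [|i s IH].
  by under eq_Rintegral do rewrite big_nil; rewrite big_nil ig0.
under eq_Rintegral do rewrite big_cons.
by rewrite big_cons igD ?IH.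
Qed.

Lemma ig_le a b f g : continuous f -> continuous g ->
  (forall x, a <= x <= b -> f x <= g x) ->
  \int[leb]_(x in `[a, b]) f x <= \int[leb]_(x in `[a, b]) g x.
Proof.
move=> cf cg fg; apply: le_Rintegral; [by []|exact: cont_integrable..|].
by move=> x /=; rewrite in_itv; exact: fg.
Qed.

Lemma ig_norm a b f : continuous f ->
  `|\int[leb]_(x in `[a, b]) f x| <= \int[leb]_(x in `[a, b]) `|f x|.
Proof. by move=> cf; apply: le_normr_Rintegral => //; exact: cont_integrable. Qed.

Lemma ig_cst a b k : a <= b -> \int[leb]_(x in `[a, b]) k = k * (b - a).
Proof.
move=> ab; rewrite Rintegral_cst// [X in fine X](lebesgue_measure_itv `[a, b])/= lte_fin.
by move: ab; rewrite le_eqVlt => /predU1P[->|->//]; rewrite ltxx subrr.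
Qed.

Lemma ig_bound a b f M : a <= b -> continuous f ->
  (forall x, a <= x <= b -> `|f x| <= M) ->
  `|\int[leb]_(x in `[a, b]) f x| <= M * (b - a).
Proof.
move=> ab cf fM; apply: (le_trans (ig_norm _ _ cf)).
by rewrite -ig_cst//; apply: ig_le => //; [exact: normfun_cont|exact: cstfun_cont].
Qed.

Lemma ig_split a b c f : a <= b -> b <= c -> continuous f ->
  \int[leb]_(x in `[a, c]) f x =
  \int[leb]_(x in `[a, b]) f x + \int[leb]_(x in `[b, c]) f x.
Proof.
move=> ab bc cf; have ci := cont_integrable a c cf.
have /= := @Rintegral_itvB R f (BLeft a) (BRight c) b ci.
rewrite !bnd_simp => /(_ ab bc) /eqP; rewrite subr_eq => /eqP ->.
rewrite addrC Rintegral_itv_obnd_cbnd//.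
apply: integrableS (cont_integrable b c cf) => //.
exact: subset_itv_oc_cc.
Qed.

Lemma ig_point a f : \int[leb]_(x in `[a, a]) f x = 0.
Proof. by rewrite set_itv1 Rintegral_set1. Qed.

(** The usual convention for exchanged bounds: a primitive based at the right
    endpoint is then differentiable on the whole line. *)
Definition prim a f z : R :=
  if a <= z then \int[leb]_(x in `[a, z]) f x
  else - \int[leb]_(x in `[z, a]) f x.

Lemma primE a f z : a <= z -> prim a f z = \int[leb]_(x in `[a, z]) f x.
Proof. by rewrite /prim => ->. Qed.

Lemma primNE a f z : z <= a -> prim a f z = - \int[leb]_(x in `[z, a]) f x.
Proof.
rewrite /prim le_eqVlt => /predU1P[->|]; first by rewrite lexx ig_point oppr0.
by rewrite ltNge => /negbTE ->.
Qed.

Lemma prim_base a f u z : continuous f -> u <= a -> u <= z ->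
  prim a f z = \int[leb]_(x in `[u, z]) f x - \int[leb]_(x in `[u, a]) f x.
Proof.
move=> cf ua uz; have [az|/ltW za] := leP a z.
  by rewrite primE// (ig_split ua az cf) addrC addKr.
by rewrite primNE// (ig_split uz za cf) opprD addrA subrr add0r.
Qed.

Lemma prim_is_derive a f z : continuous f -> is_derive z 1 (prim a f) (f z).
Proof.
move=> cf; pose u := Num.min a z - 1.
have ua : u < a by rewrite /u ltrBlDr; case: (leP a z) => ?; lra.
have uz : u < z by rewrite /u ltrBlDr; case: (leP a z) => ?; lra.
have zz1 : z < z + 1 by rewrite ltrDl.
have := @continuous_FTC1_closed R f u z (z + 1) zz1 (cont_integrable u _ cf) uz (cf z).
set F := (fun y => _) => -[dF F'].
have e : {near z, F \- cst (\int[leb]_(x in `[u, a]) f x) =1 prim a f}.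
  near=> y; rewrite /F /=; apply/esym/prim_base => //; first exact: ltW.
  by near: y; apply: cvgr_ge (@idfun_cont R z) _ uz.
have e' : nbhs z (fun y => (F \- cst (\int[leb]_(x in `[u, a]) f x)) y = prim a f y).
  exact: e.
have h : is_derive z 1 F (f z) by apply: (DeriveDef dF); rewrite -F' derive1E.
apply: (near_eq_is_derive e'); rewrite -[f z]subr0.
exact: (is_deriveB h (is_derive_cst _ _ _)).
Unshelve. all: by end_near. Qed.

Lemma derive_cont f (g : R -> R) : (forall z, is_derive z 1 f (g z)) -> continuous f.
Proof.
by move=> d z; apply: differentiable_continuous; apply/derivable1_diffP; exact: ex_derive.
Qed.

Lemma prim_cont a f : continuous f -> continuous (prim a f).
Proof. by move=> cf; apply: (@derive_cont _ f) => z; exact: prim_is_derive. Qed.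

Lemma prim_aa a f : prim a f a = 0.
Proof. by rewrite primE// ig_point. Qed.

Lemma ftc2 (G f : R -> R) a b : a <= b -> continuous f ->
  (forall z, is_derive z 1 G (f z)) ->
  \int[leb]_(x in `[a, b]) f x = G b - G a.
Proof.
move=> ab cf dG; rewrite -primE//.
have d z : is_derive z 1 (G \- prim a f) 0.
  rewrite -(subrr (f z)).
  by apply: is_deriveB; exact: prim_is_derive.
have := @is_derive_0_is_cst R (G \- prim a f) b a d.
by rewrite /= prim_aa subr0 => <-; rewrite opprB addrC subrK.
Qed.

Lemma ig_lin a b f g k : continuous f -> continuous g ->
  \int[leb]_(x in `[a, b]) (f x + k * g x) =
  \int[leb]_(x in `[a, b]) f x + k * \int[leb]_(x in `[a, b]) g x.
Proof.
by move=> cf cg; rewrite igD// ?igZ//; apply: mulfun_cont => //; exact: cstfun_cont.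
Qed.

(** A positive value persists on an interval by continuity, and that interval
    alone makes the integral positive. *)
Lemma ig_eq0 a b f : continuous f -> (forall x, a <= x <= b -> 0 <= f x) ->
  \int[leb]_(x in `[a, b]) f x = 0 -> forall x, a < x < b -> f x = 0.
Proof.
move=> cf f0 i0 x /andP[ax xb].
apply/eqP; rewrite eq_le f0 ?(ltW ax) ?(ltW xb)// andbT leNgt; apply/negP => fx.
have [e /= e0 he] : exists2 e : R, 0 < e & forall y, `|x - y| < e -> f x / 2 < f y.
  have : \forall y \near x, f x / 2 < f y.
    by apply: cvgr_gt (cf x) _ _; lra.
  by move=> [e /= e0 he]; exists e => // y /he.
pose l := Num.max a (x - e / 2).
have al : a <= l by rewrite le_max lexx.
have lx : l < x by rewrite gt_max ax/=; lra.
have xl : x - e / 2 <= l by rewrite le_max lexx orbT.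
have := ig_split al (le_trans (ltW lx) (ltW xb)) cf.
rewrite (ig_split (ltW lx) (ltW xb) cf) i0.
have p1 : 0 <= \int[leb]_(x in `[a, l]) f x.
  apply: ig_ge0 => y /andP[ay yl]; apply: f0; rewrite ay/=; lra.
have p2 : 0 <= \int[leb]_(x in `[x, b]) f x.
  by apply: ig_ge0 => y /andP[ay yl]; apply: f0; rewrite yl andbT; lra.
have : f x / 2 * (x - l) <= \int[leb]_(x in `[l, x]) f x.
  rewrite -ig_cst; last exact: ltW.
  apply: ig_le => //; first exact: cstfun_cont.
  move=> y /andP[ly yx]; apply/ltW/he.
  by rewrite ger0_norm; lra.
have : 0 < f x / 2 * (x - l) by apply: mulr_gt0; lra.
lra.
Qed.

(** Integrate (f - m)^2 >= 0, where m is the mean of f. *)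
Lemma cauchy_schwarz_ig a b f : a <= b -> continuous f ->
  (\int[leb]_(x in `[a, b]) f x) ^+ 2 <=
  (b - a) * \int[leb]_(x in `[a, b]) (f x ^+ 2).
Proof.
rewrite le_eqVlt => /predU1P[<-|ab] cf; first by rewrite !ig_point expr0n mulr0.
have d0 : 0 < b - a by lra.
set S := (X in X ^+ 2 <= _).
pose m := S / (b - a).
have : 0 <= \int[leb]_(x in `[a, b]) ((f x ^+ 2 + (- 2 * m) * f x) + m ^+ 2 ).
  apply: ig_ge0 => x _.
  by have := sqr_ge0 (f x - m); lra.
have c2 : continuous (fun x => f x ^+ 2) by exact: expfun_cont.
rewrite igD; [|by apply: addfun_cont => //; apply: mulfun_cont => //; exact: cstfun_cont|exact: cstfun_cont].
rewrite ig_lin// (ig_cst _ (ltW ab)) -/S.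
have -> : S = m * (b - a) by rewrite /m divfK// gt_eqF.
set P := \int[leb]_(x in _) _.
by move=> h; have := mulr_ge0 (ltW d0) h; rewrite !expr2; nra.
Qed.

Lemma is_derive_affine a k z : is_derive z 1 (fun z => k * (z - a)) k.
Proof.
have : is_derive z 1 (k \*: (id - cst a)) (k *: (1 - 0)) by exact: is_deriveZ.
by rewrite subr0 [X in is_derive _ _ _ X]mulr1.
Qed.

(** Integrate the derivative of weight * primitive: the weight reproduces itself
    with the factor 2 lambda, and the boundary term at a has a favourable sign
    because f >= 0.  A tail integral is thus smaller than f by the factor
    1 / (2 lambda) in the weighted norm, uniformly in f. *)
Lemma carleman_volterra a b (lambda : R) f : a <= b -> 0 < lambda -> continuous f ->
  (forall x, a <= x <= b -> 0 <= f x) ->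
  \int[leb]_(z in `[a, b]) (expR (2 * lambda * (z - a)) * (- prim b f z)) <=
  (2 * lambda)^-1 * \int[leb]_(z in `[a, b]) (expR (2 * lambda * (z - a)) * f z).
Proof.
move=> ab l0 cf f0; have l2 : 0 < 2 * lambda by lra.
have dE z : is_derive z 1 (fun z => expR (2 * lambda * (z - a)))
    (2 * lambda * expR (2 * lambda * (z - a))).
  have h := is_derive_affine a (2 * lambda) z.
  by have := @is_derive1_comp R expR _ z _ _ (is_derive_expR (2 * lambda * (z - a))) h; rewrite [X in is_derive _ _ _ X]mulrC.
set E := fun z => expR (2 * lambda * (z - a)) in dE *.
have cE : continuous E by exact: (derive_cont dE).
have cp := prim_cont (a := b) cf.
rewrite -ler_pdivrMl ?invr_gt0// invrK -igZ; last exact/mulfun_cont/oppfun_cont.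
rewrite -subr_ge0 -igB; last 2 first.
- by apply: mulfun_cont.
- by apply: mulfun_cont; [exact: cstfun_cont|exact/mulfun_cont/oppfun_cont].
have -> : \int[leb]_(x in `[a, b]) (E x * f x - 2 * lambda * (E x * - prim b f x)) =
   E b * prim b f b - E a * prim b f a.
  apply: (@ftc2 (fun z => E z * prim b f z) _ a b ab).
    apply: subfun_cont; first exact: mulfun_cont.
    by apply: mulfun_cont; [exact: cstfun_cont|exact/mulfun_cont/oppfun_cont].
  move=> z.
  have := @is_deriveM _ _ E (prim b f) z 1 _ _ (dE z) (prim_is_derive b z cf).
  rewrite /= -/(E z); rewrite /GRing.scale/=.
  by move/is_derive_eq; apply; rewrite -/(E z); ring.
rewrite prim_aa mulr0 add0r primNE// mulrN opprK; apply: mulr_ge0.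
  exact: expR_ge0.
exact: ig_ge0.
Qed.

End IntegralsOfContinuousFunctions.

(** * Clamping, and Fubini on squares and triangles *)

Section Clamping.
Context {R : realType}.

(** Composition with a retraction onto D turns continuity relative to D into
    continuity on the whole space. *)
Lemma within_comp_cont (T U V : topologicalType) (D : set U) (f : U -> V)
  (r : T -> U) : continuous r -> (forall x, D (r x)) ->
  {within D, continuous f} -> continuous (fun x => f (r x)).
Proof.
move=> cr Dr cf x.
have h := cf (r x).
rewrite /continuous_at in h.
have h2 : f @ within D (nbhs (r x)) --> f (r x).
  by move: h; rewrite /nbhs/= -(nbhs_subspace_in (Dr x)).
apply: cvg_comp h2 => P /= wP.
have := cr x _ wP; rewrite /= /nbhs/=.
by apply: filterS => y; apply; exact: Dr.
Qed.

Definition clamp (a b z : R) : R := Num.max a (Num.min z b).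

Lemma clamp_in a b z : a <= b -> a <= clamp a b z <= b.
Proof.
move=> ab; rewrite /clamp le_max lexx/= ge_max ab/=.
by rewrite ge_min lexx orbT.
Qed.

Lemma clamp_id a b z : a <= z <= b -> clamp a b z = z.
Proof. by move=> /andP[az zb]; rewrite /clamp min_l// max_r. Qed.

Lemma clamp_cont a b : continuous (clamp a b).
Proof.
move=> z; apply: (@continuous_max R R (cst a) (fun z => Num.min z b) z); first exact: cvg_cst.
by apply: (@continuous_min R R id (cst b) z); [exact: cvg_id|exact: cvg_cst].
Qed.

Lemma compact_bound (T : topologicalType) (A : set T) (f : T -> R) :
  compact A -> {within A, continuous f} ->
  exists2 C : R, 0 < C & forall x, A x -> `|f x| <= C.
Proof.
move=> cA cf; have /compact_bounded[M [Mr HM]] := continuous_compact cf cA.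
exists (`|M| + 1); first by rewrite ltr_wpDl.
move=> x Ax; apply: HM; last by exists x.
by rewrite (le_lt_trans (ler_norm M))// ltrDl.
Qed.

Lemma cont_bound a b (f : R -> R) : continuous f ->
  exists2 C : R, 0 < C & forall x, a <= x <= b -> `|f x| <= C.
Proof.
move=> cf; have [C C0 HC] := compact_bound (@segment_compact R a b) (continuous_subspaceT cf).
by exists C => // x xab; apply: HC; rewrite /= in_itv.
Qed.

End Clamping.

Section FubiniOnSquares.
Context {R : realType}.

(** An open subset of the plane is a countable union of squares with rational
    centres and radii. *)
Lemma measurable_continuous2 (f : R * R -> R) :
  continuous f -> measurable_fun setT f.
Proof.
move=> cf.
apply: (measurability _ (RGenOpens.measurableE R)).
move=> _ [_ [a [b ->] <-]]; rewrite setTI.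
have oU : open (f @^-1` `]a, b[) by apply: open_comp => // x _; exact: cf.
set U := f @^-1` _ in oU *.
pose B (i : rat * rat * rat) : set (R * R) :=
  ball (ratr i.1.1 : R) (ratr i.2 : R) `*` ball (ratr i.1.2 : R) (ratr i.2).
pose F (i : rat * rat * rat) : set (R * R) := if `[< B i `<=` U >] then B i else set0.
have -> : U = \bigcup_i F i.
  apply/seteqP; split => [u Uu|u [i _]]; last first.
    by rewrite /F; case: asboolP => // BU; exact: BU.
  have /nbhs_ballP[e /= e0 eU] := open_nbhs_nbhs (conj oU Uu).
  have [r] := @rat_in_itvoo R 0 (e / 2) (divr_gt0 e0 (ltr0n _ 2)).
  rewrite in_itv/= => /andP[r0 re].
  have d1 : u.1 < u.1 + ratr r by rewrite ltrDl.
  have d2 : u.2 < u.2 + ratr r by rewrite ltrDl.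
  have [q1] := rat_in_itvoo d1; rewrite in_itv/= => /andP[q11 q12].
  have [q2] := rat_in_itvoo d2; rewrite in_itv/= => /andP[q21 q22].
  exists (q1, q2, r) => //; rewrite /F asboolT; last first.
    move=> v [/= v1 v2]; apply: eU; split; rewrite /ball/= in v1 v2 *.
      rewrite (_ : u.1 - v.1 = (u.1 - ratr q1) + (ratr q1 - v.1)); last by ring.
      apply: (le_lt_trans (ler_normD _ _)).
      have : `|u.1 - ratr q1| < ratr r by rewrite ltr_norml; lra.
      by move: v1; lra.
    rewrite (_ : u.2 - v.2 = (u.2 - ratr q2) + (ratr q2 - v.2)); last by ring.
    apply: (le_lt_trans (ler_normD _ _)).
    have : `|u.2 - ratr q2| < ratr r by rewrite ltr_norml; lra.
    by move: v2; lra.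
  by split; rewrite /ball/= ltr_norml; lra.
apply: countable_bigcupT_measurable => // i; rewrite /F; case: ifP => // _.
by apply: measurableX; exact: measurable_ball.
Qed.

Lemma integrable_extend0 (I : set R) (f : R -> R) : measurable I ->
  leb.-integrable I (EFin \o f) -> leb.-integrable setT (EFin \o (f \_ I)).
Proof.
move=> mI intf; rewrite -restrict_EFin; apply/integrable_restrict => //=.
by rewrite setTI.
Qed.

Lemma integrable_dom (D : set R) (f g : R -> R) : measurable D ->
  measurable_fun D f -> leb.-integrable D (EFin \o g) ->
  (forall x, D x -> `|f x| <= `|g x|) -> leb.-integrable D (EFin \o f).
Proof.
move=> mD mf ig fg; apply: le_integrable ig => //; first exact/measurable_EFinP.
Qed.

Lemma integrable_scaler (D : set R) (f : R -> R) k : measurable D ->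
  leb.-integrable D (EFin \o f) -> leb.-integrable D (EFin \o (fun x => f x * k)).
Proof.
move=> mD intf; have := @integrableZr _ _ _ leb D mD k _ intf.
by apply: eq_integrable => // x _ /=.
Qed.

(** Transfers the Fubini theorem of extended-valued integrals on the plane to
    finite-valued integrals on I x I, through the extension G of F by zero. *)
Lemma fubini_extend0 (I : set R) (F G : R * R -> R) :
  (forall z s, I z -> I s -> G (z, s) = F (z, s)) ->
  (forall z s, ~ (I z /\ I s) -> G (z, s) = 0) ->
  (forall z, leb.-integrable setT (EFin \o (fun s => G (z, s)))) ->
  (forall s, leb.-integrable setT (EFin \o (fun z => G (z, s)))) ->
  (leb \x leb)%E.-integrable setT (EFin \o G) ->
  \int[leb]_(z in I) (\int[leb]_(s in I) F (z, s)) =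
  \int[leb]_(s in I) (\int[leb]_(z in I) F (z, s)).
Proof.
move=> Gin Gout i1 i2 iG.
have F1 z : I z -> \int[leb]_(s in I) F (z, s) = \int[leb]_s G (z, s).
  move=> zI; rewrite Rintegral_mkcond; apply: eq_Rintegral => s _ /=.
  rewrite patchE; case: ifPn => sI; first by rewrite (Gin z s zI (set_mem sI)).
  by rewrite (Gout z s)// => -[_ sI']; move: sI; rewrite mem_set.
have F2 s : I s -> \int[leb]_(z in I) F (z, s) = \int[leb]_z G (z, s).
  move=> sI; rewrite Rintegral_mkcond; apply: eq_Rintegral => z _ /=.
  rewrite patchE; case: ifPn => zI; first by rewrite (Gin z s (set_mem zI) sI).
  by rewrite (Gout z s)// => -[zI' _]; move: zI; rewrite mem_set.
have c1 : \int[leb]_(z in I) (\int[leb]_(s in I) F (z, s)) =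
          \int[leb]_z (\int[leb]_s G (z, s)).
  rewrite Rintegral_mkcond; apply: eq_Rintegral => z _.
  rewrite patchE; case: ifPn => zI; first exact: F1 (set_mem zI).
  symmetry; transitivity (\int[leb]_(s in [set: R]) (0 : R)).
    apply: eq_Rintegral => s _; apply: Gout => -[zI' _].
    by move: zI; rewrite mem_set.
  by rewrite Rintegral_cst// mul0r.
have c2 : \int[leb]_(s in I) (\int[leb]_(z in I) F (z, s)) =
          \int[leb]_s (\int[leb]_z G (z, s)).
  rewrite Rintegral_mkcond; apply: eq_Rintegral => s _.
  rewrite patchE; case: ifPn => sI; first exact: F2 (set_mem sI).
  symmetry; transitivity (\int[leb]_(s in [set: R]) (0 : R)).
    apply: eq_Rintegral => z _; apply: Gout => -[_ sI'].
    by move: sI; rewrite mem_set.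
  by rewrite Rintegral_cst// mul0r.
have e1 : (fun z => (\int[leb]_s G (z, s))%:E) = (fun z => \int[leb]_s (EFin \o G) (z, s))%E.
  apply/funext => z; rewrite /Rintegral fineK; first by [].
  exact: (@integrable_fin_num _ _ _ leb setT measurableT _ (i1 z)).
have e2 : (fun s => (\int[leb]_z G (z, s))%:E) = (fun s => \int[leb]_z (EFin \o G) (z, s))%E.
  apply/funext => s; rewrite /Rintegral fineK; first by [].
  exact: (@integrable_fin_num _ _ _ leb setT measurableT _ (i2 s)).
have fub := Fubini iG.
rewrite c1 c2; congr fine.
transitivity (\int[leb]_z \int[leb]_s (EFin \o G) (z, s))%E; first by rewrite e1.
by rewrite fub e2.
Qed.

(** Domination by a function of s alone suffices for integrability, since the
    square has finite measure. *)
Lemma fubini_square a b (F : R * R -> R) (eta : R -> R) :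
  measurable_fun setT F -> leb.-integrable `[a, b] (EFin \o eta) ->
  (forall z s, a <= z <= b -> a <= s <= b -> `|F (z, s)| <= `|eta s|) ->
  \int[leb]_(z in `[a, b]) (\int[leb]_(s in `[a, b]) F (z, s)) =
  \int[leb]_(s in `[a, b]) (\int[leb]_(z in `[a, b]) F (z, s)).
Proof.
move=> mF ieta Feta.
pose I := `[a, b]%classic : set R.
have mI : measurable I by exact: measurable_itv.
pose G (u : R * R) : R := F u * (\1_I u.1 * \1_I u.2).
have mG : measurable_fun setT G.
  apply: measurable_funM => //; apply: measurable_funM.
    by apply: measurableT_comp => //; exact: measurable_fst.
  by apply: measurableT_comp => //; exact: measurable_snd.
have Gout (z s : R) : ~ (I z /\ I s) -> G (z, s) = 0.
  move=> nI; rewrite /G /= !indicE.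
  have [zI|zI] := boolP (z \in I); last by rewrite mul0r mulr0.
  have [sI|sI] := boolP (s \in I); last by rewrite !mulr0.
  by exfalso; apply: nI; split; exact/set_mem.
have Gin (z s : R) : I z -> I s -> G (z, s) = F (z, s).
  by move=> zI sI; rewrite /G/= !indicE !mem_set// !mulr1.
have e0 : leb.-integrable setT (EFin \o (eta \_ I)) by exact: integrable_extend0.
have Gb z s : `|G (z, s)| <= `|(eta \_ I) s|.
  have [[zI sI]|h] := pselect (I z /\ I s); last by rewrite Gout// normr0.
  rewrite Gin// patchE mem_set//; apply: Feta.
    by move: zI; rewrite /I/= in_itv.
  by move: sI; rewrite /I/= in_itv.
have m1 z : measurable_fun setT (fun s => G (z, s)).
  by apply: (measurableT_comp mG); exact: measurable_pair1.
have m2 s : measurable_fun setT (fun z => G (z, s)).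
  by apply: (measurableT_comp mG); exact: measurable_pair2.
have i1 z : leb.-integrable setT (EFin \o (fun s => G (z, s))).
  by apply: (@integrable_dom setT _ (eta \_ I)) => //.
have i2 s : leb.-integrable setT (EFin \o (fun z => G (z, s))).
  have : leb.-integrable setT (EFin \o ((cst ((eta \_ I) s)) \_ I)).
    apply: integrable_extend0 => //.
    by apply: (@cont_integrable R a b); exact: cstfun_cont.
  move=> /(@integrable_dom setT); apply => //.
  move=> z _ /=; rewrite patchE; case: ifPn => [//|zI].
  by rewrite Gout ?normr0// => -[zI' _]; move: zI; rewrite mem_set.
have iG : (leb \x leb)%E.-integrable setT (EFin \o G).
  apply/integrable12ltyP; first exact/measurable_EFinP.
  pose A : R := \int[leb]_s `|(eta \_ I) s|.
  have iA : (\int[leb]_s (`|(eta \_ I) s|)%:E = A%:E)%E.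
    by rewrite /A /Rintegral fineK//; apply: integrable_fin_num => //; exact: integrable_norm e0.
  have iAI : leb.-integrable setT (EFin \o ((cst A) \_ I)).
    apply: integrable_extend0 => //.
    by apply: (@cont_integrable R a b); exact: cstfun_cont.
  apply: (@le_lt_trans _ _ (\int[leb]_z (((cst A) \_ I) z)%:E)%E).
    apply: ge0_le_integral => //.
    - by move=> z _; apply: integral_ge0 => s _; rewrite lee_fin.
    - apply: (@measurable_fun_fubini_tonelli_F _ _ _ _ R leb (fun u => `|(EFin \o G) u|%E)) => //.
      by apply/measurable_EFinP/measurableT_comp.
    - by case/integrableP: iAI.
    - move=> z _; rewrite patchE; case: ifPn => zI.
        rewrite -iA; apply: ge0_le_integral => //.
        + by apply/measurable_EFinP; apply: measurableT_comp => //; exact: m1.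
        + by apply/measurable_EFinP; apply: measurableT_comp => //; apply/measurable_EFinP; case/integrableP: e0.
        + by move=> s _; rewrite /= lee_fin.
      rewrite integral0_eq// => s _ /=; rewrite Gout ?normr0// => -[zI' _].
      by move: zI; rewrite mem_set.
  rewrite -ge0_fin_numE; last first.
    apply: integral_ge0 => z _; rewrite lee_fin patchE; case: ifP => // _.
    exact: Rintegral_ge0.
  exact: (@integrable_fin_num _ _ _ leb setT measurableT _ iAI).
exact: (fubini_extend0 Gin Gout i1 i2 iG).
Qed.

Lemma ig_restrict a b c d (f : R -> R) : a <= c -> d <= b ->
  \int[leb]_(x in `[c, d]) f x =
  \int[leb]_(x in `[a, b]) (if c <= x <= d then f x else 0).
Proof.
move=> ac db; rewrite Rintegral_mkcond [RHS]Rintegral_mkcond.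
apply: eq_Rintegral => x _; rewrite !patchE.
have h : (x \in `[c, d]%classic) = (c <= x <= d).
  by apply/idP/idP; rewrite inE/= in_itv.
have h' : (x \in `[a, b]%classic) = (a <= x <= b).
  by apply/idP/idP; rewrite inE/= in_itv.
rewrite h h'; case: ifPn => // [/andP[cx xd]|_]; last by case: ifP.
by rewrite (le_trans ac cx) (le_trans xd db).
Qed.

(** The triangle z <= s is cut out of the square by an indicator function. *)
Lemma fubini_triangle a b (f : R * R -> R) : continuous f ->
  \int[leb]_(z in `[a, b]) (\int[leb]_(s in `[z, b]) f (z, s)) =
  \int[leb]_(s in `[a, b]) (\int[leb]_(z in `[a, s]) f (z, s)).
Proof.
move=> cf.
have cc : compact (`[a, b]%classic `*` `[a, b]%classic : set (R * R)).
  by apply: compact_setX; exact: segment_compact.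
have [C C0 HC] := compact_bound cc (continuous_subspaceT cf).
pose F (u : R * R) := if u.1 <= u.2 then f u else 0.
have mF : measurable_fun setT F.
  apply: measurable_fun_ifT => //; last exact: measurable_continuous2.
  by apply: measurable_fun_ler; [exact: measurable_fst|exact: measurable_snd].
have := @fubini_square a b F (cst C) mF.
move=> /(_ (@cont_integrable R a b _ (@cstfun_cont R R C))) h.
transitivity (\int[leb]_(z in `[a, b]) (\int[leb]_(s in `[a, b]) F (z, s))).
  apply: eq_ig => z /andP[az zb]; rewrite (@ig_restrict a b)//.
  by apply: eq_ig => s /andP[as_ sb]; rewrite /F/= sb andbT.
rewrite h.
  apply: eq_ig => s /andP[as_ sb]; rewrite [RHS](@ig_restrict a b)//.
  by apply: eq_ig => z /andP[az zb]; rewrite /F/= az.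
move=> z s zI sI; rewrite /F/=; case: ifP => _; last by rewrite normr0.
by rewrite (gtr0_norm C0); apply: HC; rewrite /= !in_itv.
Qed.

(** For an integrable eta the primitive need not be differentiable, so
    integration by parts is done by exchanging integrals: k b - k s is the
    integral of k' over [s, b]. *)
Lemma parts_prim a b (eta k k' : R -> R) : a <= b ->
  measurable_fun setT eta -> leb.-integrable `[a, b] (EFin \o eta) ->
  continuous k' -> (forall z, is_derive z (1:R) k (k' z)) ->
  \int[leb]_(z in `[a, b]) ((\int[leb]_(s in `[a, z]) eta s) * k' z) =
  k b * (\int[leb]_(s in `[a, b]) eta s) - \int[leb]_(s in `[a, b]) (eta s * k s).
Proof.
move=> ab meta ieta ck' dk.
have ck := derive_cont dk.
have [C C0 HC] := cont_bound a b ck'.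
pose F (u : R * R) := if u.2 <= u.1 then eta u.2 * k' u.1 else 0.
have mF : measurable_fun setT F.
  apply: measurable_fun_ifT => //.
    by apply: measurable_fun_ler; [exact: measurable_snd|exact: measurable_fst].
  apply: measurable_funM; first by apply: measurableT_comp => //; exact: measurable_snd.
  by apply: measurableT_comp; [exact: continuous_measurable_fun|exact: measurable_fst].
have iC : leb.-integrable `[a, b] (EFin \o (fun s => eta s * C)).
  exact: integrable_scaler.
have := fubini_square mF iC.
have -> : \int[leb]_(z in `[a, b]) \int[leb]_(s in `[a, b]) F (z, s) =
   \int[leb]_(z in `[a, b]) ((\int[leb]_(s in `[a, z]) eta s) * k' z).
  apply: eq_ig => z /andP[az zb].
  rewrite -RintegralZr//; last first.
    by apply: integrableS ieta => //; apply: subset_itvl; rewrite bnd_simp.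
  rewrite [RHS](@ig_restrict a b)//; apply: eq_ig => s /andP[as_ sb].
  by rewrite /F/= as_.
move=> ->; last first.
  move=> z s zI _; rewrite /F/=; case: ifP => _; last by rewrite normr0.
  by rewrite normrM normrM ler_wpM2l// (gtr0_norm C0) HC.
have ib : leb.-integrable `[a, b] (EFin \o (fun s => k b * eta s)).
  under [X in EFin \o X]eq_fun do rewrite mulrC; exact: integrable_scaler.
have [Ck Ck0 HCk] := cont_bound a b ck.
have ik : leb.-integrable `[a, b] (EFin \o (fun s => eta s * k s)).
  apply: (@integrable_dom _ _ (fun s => eta s * Ck)) => //; last 2 first.
  - exact: integrable_scaler.
  - move=> s /=; rewrite in_itv/= => sI; rewrite !normrM ler_wpM2l//.
    by rewrite (gtr0_norm Ck0) HCk.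
  apply: measurable_funTS; apply: measurable_funM => //.
  exact: continuous_measurable_fun.
rewrite -RintegralZl// -RintegralB//.
apply: eq_ig => s /andP[as_ sb].
have <- : eta s * (k b - k s) = k b * eta s - eta s * k s by ring.
rewrite -(ftc2 sb ck' dk) -igZ// [RHS](@ig_restrict a b)//.
by apply: eq_ig => z /andP[az zb]; rewrite /F/= zb andbT.
Qed.

End FubiniOnSquares.

(** * Square-integrable functions and their primitives *)

Section SquareIntegrable.
Context {R : realType}.
Variables (a b : R).
Hypothesis ab : a < b.
Implicit Types (f g k : R -> R).

Definition sqi g := measurable_fun setT g /\
  leb.-integrable `[a, b] (EFin \o (fun z => g z ^+ 2)).

Lemma integrable_add f g : leb.-integrable `[a, b] (EFin \o f) ->
  leb.-integrable `[a, b] (EFin \o g) ->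
  leb.-integrable `[a, b] (EFin \o (fun z => f z + g z)).
Proof.
by move=> intf intg; exact: (@integrableD _ _ _ leb _ (measurable_itv _) _ _ intf intg).
Qed.

Lemma sqi_mul f g : sqi f -> sqi g ->
  leb.-integrable `[a, b] (EFin \o (fun z => f z * g z)).
Proof.
move=> [mf f2] [mg g2].
have h : leb.-integrable `[a, b] (EFin \o (fun z => f z ^+ 2 + g z ^+ 2)).
  exact: integrable_add.
apply: (integrable_dom _ _ h) => //; first by apply: measurable_funTS; exact: measurable_funM.
move=> x _; rewrite normrM [leRHS]ger0_norm ?addr_ge0 ?sqr_ge0//.
rewrite -(real_normK (num_real (f x))) -(real_normK (num_real (g x))).
have := sqr_ge0 (`|f x| - `|g x|); have := normr_ge0 (f x); have := normr_ge0 (g x).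
set u := `|f x|; set v := `|g x|; nra.
Qed.

Lemma sqi_cont f : continuous f -> sqi f.
Proof.
move=> cf; split; first exact: continuous_measurable_fun.
by apply: cont_integrable; exact: expfun_cont.
Qed.

Lemma sqi_int g : sqi g -> leb.-integrable `[a, b] (EFin \o g).
Proof.
move=> sg; have := sqi_mul sg (sqi_cont (@cstfun_cont R R 1)).
by congr (_.-integrable _ _); apply/funext => x /=; rewrite mulr1.
Qed.

Lemma sqi_add f g : sqi f -> sqi g -> sqi (fun z => f z + g z).
Proof.
move=> sf sg; split; first by apply: measurable_funD; [exact: sf.1|exact: sg.1].
have h : leb.-integrable `[a, b] (EFin \o (fun z => f z ^+ 2 + g z ^+ 2 + (f z * g z) * 2)).
  apply: integrable_add; first by apply: integrable_add; [exact: sf.2|exact: sg.2].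
  by apply: integrable_scaler => //; exact: sqi_mul.
apply: (integrable_dom _ _ h) => //; last by move=> x _; rewrite sqrrD addrAC mulr_natr.
apply: measurable_funTS; apply: measurable_funX.
by apply: measurable_funD; [exact: sf.1|exact: sg.1].
Qed.

Lemma sqi_scale g c : sqi g -> sqi (fun z => c * g z).
Proof.
move=> sg; split; first by apply: measurable_funM => //; exact: sg.1.
have h := integrable_scaler (c ^+ 2) (measurable_itv `[a, b]) sg.2.
apply: (integrable_dom _ _ h) => //; last by move=> x _; rewrite exprMn mulrC.
by apply: measurable_funTS; apply: measurable_funX; apply: measurable_funM => //; exact: sg.1.
Qed.

Lemma sqi_norm g : sqi g -> sqi (fun z => `|g z|).
Proof.
move=> sg; split; first by apply: measurableT_comp => //; exact: sg.1.
have := sg.2; congr (_.-integrable _ _).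
by apply/funext => x /=; rewrite real_normK ?num_real.
Qed.

Lemma integrable_oo f : leb.-integrable `[a, b] (EFin \o f) ->
  leb.-integrable `]a, b[ (EFin \o f).
Proof. by apply: integrableS => //; exact: subset_itv_oo_cc. Qed.

Lemma ig_oo f : leb.-integrable `[a, b] (EFin \o f) ->
  \int[leb]_(z in `]a, b[) f z = \int[leb]_(z in `[a, b]) f z.
Proof.
move=> intf; rewrite Rintegral_itv_bndo_bndc; last exact: integrable_oo.
rewrite Rintegral_itv_obnd_cbnd//.
by apply: integrableS intf => //; exact: subset_itv_oc_cc.
Qed.

Lemma sqi_is_L2 g : sqi g -> is_L2 a b g.
Proof.
move=> [mg ig]; split; first exact: measurable_funTS.
exact: integrable_oo.
Qed.

Lemma is_L2_sqi g : is_L2 a b g -> sqi (g \_ (Oz a b)).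
Proof.
have mO : measurable (Oz a b) by exact: measurable_itv.
move=> [mg ig]; split; first by apply/(measurable_restrictT _ mO).
have := integrable_extend0 mO ig.
move=> h; have := @integrableS _ _ _ leb setT `[a, b] _ measurableT (measurable_itv `[a, b]) (@subsetT _ _) h.
congr (_.-integrable _ _); apply/funext => x /=; rewrite !patchE.
by case: ifP => // _; rewrite expr0n.
Qed.

Lemma ig_restrict_oo g k :
  \int[leb]_(z in `[a, b]) ((g \_ (Oz a b)) z * k z) =
  \int[leb]_(z in Oz a b) (g z * k z).
Proof.
rewrite Rintegral_mkcond [RHS]Rintegral_mkcond; apply: eq_Rintegral => x _.
rewrite !patchE; case: ifPn => xab; case: ifPn => xO => //; first by rewrite mul0r.
exfalso; move: xab; rewrite mem_set//.
by apply: (@subset_itv_oo_cc _ _ a b); exact: set_mem xO.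
Qed.

(** The discriminant of a nonnegative quadratic; z < 0 is excluded by a large t,
    and z = 0 forces y = 0. *)
Lemma cauchy_schwarz_form (x y z : R) :
  (forall t, 0 <= x + 2 * t * y + t ^+ 2 * z) -> y ^+ 2 <= x * z.
Proof.
move=> h.
have z0 : 0 <= z.
  rewrite leNgt; apply/negP => zn.
  have := h ((`|x| + 1 + 2 * `|y|) / (- z) + 1).
  set c := `|x| + 1 + 2 * `|y|.
  have c1 : 1 <= c by rewrite /c; have := normr_ge0 x; have := normr_ge0 y; lra.
  set t := c / - z + 1.
  have tz : (t - 1) * (- z) = c by rewrite /t addrK divfK// oppr_eq0 lt_eqF.
  have t1 : 1 <= t by rewrite lerDr divr_ge0//; lra.
  have : t ^+ 2 * - z >= t * c by rewrite expr2 -mulrA ler_pM2l; lra.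
  have := ler_norm x; have := ler_norm y.
  have : c * t >= `|x| + 1 + 2 * `|y| * t.
    rewrite /c; have := normr_ge0 x; have := normr_ge0 y; nra.
  have : t * y <= t * `|y| by rewrite ler_pM2l ?ler_norm//; lra.
  nra.
move: z0; rewrite le_eqVlt => /predU1P[z0|z0].
  rewrite -z0 mulr0; have [->|y0] := eqVneq y 0; first by rewrite expr0n.
  have := h (- (x + 1) / (2 * y)); rewrite -z0 mulr0 addr0.
  have -> : 2 * (- (x + 1) / (2 * y)) * y = - (x + 1) by field.
  lra.
have := h (- y / z).
have -> : x + 2 * (- y / z) * y + (- y / z) ^+ 2 * z = x - y ^+ 2 / z.
  by field; rewrite gt_eqF.
by rewrite subr_ge0 ler_pdivrMr.
Qed.

Lemma sqi_cauchy_schwarz f g : sqi f -> sqi g ->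
  (\int[leb]_(z in `[a, b]) (f z * g z)) ^+ 2 <=
  (\int[leb]_(z in `[a, b]) (f z ^+ 2)) * (\int[leb]_(z in `[a, b]) (g z ^+ 2)).
Proof.
move=> sf sg; apply: cauchy_schwarz_form => t.
have ifg := sqi_mul sf sg.
have i2 := integrable_scaler (2 * t) (measurable_itv `[a, b]) ifg.
have i3 := integrable_scaler (t ^+ 2) (measurable_itv `[a, b]) sg.2.
have [if2 ig2] := (sf.2, sg.2).
set A := \int[leb]_(z in _) _; set B := \int[leb]_(z in _) _; set C := \int[leb]_(z in _) _.
have <- : \int[leb]_(z in `[a, b]) (f z ^+ 2 + (f z * g z) * (2 * t) + g z ^+ 2 * t ^+ 2) =
   A + 2 * t * B + t ^+ 2 * C.
  rewrite RintegralD//; last exact: integrable_add.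
  by rewrite RintegralD// !RintegralZr// [B * _]mulrC [C * _]mulrC.
by apply: ig_ge0 => x _; have := sqr_ge0 (f x + t * g x); rewrite sqrrD exprMn; lra.
Qed.

End SquareIntegrable.

Section SobolevPrimitive.
Context {R : realType}.
Variables (a b : R).
Hypothesis ab : a < b.
Implicit Types (f g k : R -> R).
Local Notation sqi := (sqi a b).

(** For such an f, the density g is the weak derivative and f a = 0: this is how
    elements of H^1_0 are represented from here on. *)
Definition primitive_of f g := sqi g /\
  forall z, a <= z <= b -> f z = \int[leb]_(s in `[a, z]) g s.

Lemma sqi_int_sub g c d : sqi g -> a <= c -> d <= b ->
  leb.-integrable `[c, d] (EFin \o g).
Proof.
move=> sg ac db; apply: integrableS (sqi_int sg) => //.
by apply: subset_itv; rewrite bnd_simp.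
Qed.

Lemma primitive_add f1 f2 g1 g2 : primitive_of f1 g1 -> primitive_of f2 g2 ->
  primitive_of (fun z => f1 z + f2 z) (fun z => g1 z + g2 z).
Proof.
move=> [s1 p1] [s2 p2]; split; first exact: sqi_add.
move=> z /[dup] zab /andP[az zb].
by rewrite p1// p2// RintegralD//; exact: sqi_int_sub.
Qed.

Lemma primitive_scale f g c : primitive_of f g ->
  primitive_of (fun z => c * f z) (fun z => c * g z).
Proof.
move=> [s1 p1]; split; first exact: sqi_scale.
move=> z /[dup] zab /andP[az zb].
by rewrite p1// RintegralZl//; exact: sqi_int_sub.
Qed.

Lemma primitive_cont f g : primitive_of f g -> {within `[a, b], continuous f}.
Proof.
move=> [sg p].
have := parameterized_integral_continuous (ltW ab) (sqi_int sg).
apply: subspace_eq_continuous => z; rewrite inE/= in_itv/= => zab.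
by rewrite /from_subspace /parameterized_integral p.
Qed.

(** By Lebesgue differentiation, g vanishes almost everywhere. *)
Lemma primitive_eq0 g k : (forall z, a <= z <= b -> \int[leb]_(s in `[a, z]) g s = 0) ->
  sqi g -> sqi k -> \int[leb]_(z in `[a, b]) (g z * k z) = 0.
Proof.
move=> g0 sg sk.
pose g1 := g \_ `[a, b].
have ig1 : leb.-integrable setT (EFin \o g1).
  by apply: integrable_extend0 => //; exact: sqi_int.
have lg1 : locally_integrable [set: R] g1.
  split => //; first by apply/measurable_EFinP; case/integrableP: ig1.
    exact: openT.
  move=> K _ cK.
  have /integrableP[] := @integrableS _ _ _ leb setT K _ measurableT (compact_measurable cK) (@subsetT _ _) ig1.
  by [].
have ae0 : {ae leb, forall x, a < x < b -> g x = 0}.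
  have := @FTC1 R g1 (BLeft a) _ lg1.
  have h y : leb.-integrable [set` Interval (BLeft a) (BRight y)] (EFin \o g1).
    exact: integrableS ig1.
  move=> /(_ h); apply: filterS; first exact: (ae_filter_ringOfSetsType leb).
  move=> x hx /andP[ax xb].
  have /hx[_] : (a%:E < x%:E)%E by rewrite lte_fin.
  rewrite {2}/g1 patchE mem_set/= ?in_itv/= ?(ltW ax) ?(ltW xb)// => <-.
  rewrite derive1E.
  have e : \near x, (cst 0 : R -> R) x = \int[leb]_(t in [set` Interval (BLeft a) (BRight x)]) g1 t.
    near=> y.
    have ay : a <= y by near: y; apply: cvgr_ge (@idfun_cont R x) _ ax.
    have yb : y <= b by near: y; apply: cvgr_le (@idfun_cont R x) _ xb.
    rewrite /= -(g0 y) ?ay//; apply: eq_Rintegral => t; rewrite inE/= in_itv/= => /andP[at_ ty].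
    by rewrite /g1 patchE mem_set//= in_itv/= at_ (le_trans ty yb).
  have := @near_eq_is_derive _ _ _ _ _ x 1 0 e (is_derive_cst _ _ _).
  by move=> /@derive_val.
rewrite -ig_oo//; last exact: sqi_mul.
rewrite -(ig0 a b) -ig_oo; last exact: cont_integrable (@cstfun_cont _ _ 0).
congr fine; apply: ae_eq_integral => //.
  by apply/measurable_EFinP; apply: measurable_funTS; apply: measurable_funM; [exact: sg.1|exact: sk.1].
move: ae0; apply: filterS; first exact: (ae_filter_ringOfSetsType leb).
move=> x h; rewrite /= in_itv/= => /h ->.
by rewrite mul0r.
Unshelve. all: by end_near. Qed.

Lemma primitive_uniq f g1 g2 k : primitive_of f g1 -> primitive_of f g2 -> sqi k ->
  \int[leb]_(z in `[a, b]) (g1 z * k z) = \int[leb]_(z in `[a, b]) (g2 z * k z).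
Proof.
move=> [s1 p1] [s2 p2] sk.
have sm2 : sqi (fun z => - 1 * g2 z) by exact: sqi_scale.
apply/eqP; rewrite -subr_eq0 -RintegralB//; try exact: sqi_mul.
rewrite -[X in _ == X](@primitive_eq0 (fun z => g1 z + - 1 * g2 z) k)//.
- by apply/eqP/eq_ig => z _; rewrite mulN1r mulrBl.
- move=> z /[dup] zab /andP[az zb]; rewrite RintegralD//; try exact: sqi_int_sub.
  by rewrite RintegralZl -?p1 -?p2 ?mulN1r ?subrr//; exact: sqi_int_sub.
- exact: sqi_add.
Qed.

(** Test with the primitive of (f - m) chi, where chi is a hat function supported
    away from the endpoints and m the chi-weighted mean of f: the hypothesis then
    makes the integral of (f - m)^2 chi vanish, so f = m where chi > 0. *)
Lemma dubois_reymond f : continuous f ->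
  (forall t, test_fun a b t -> \int[leb]_(z in `[a, b]) (f z * derive1 t z) = 0) ->
  forall z, a <= z <= b -> f z = f a.
Proof.
move=> cf H.
have key e : 0 < e -> e < (b - a) / 2 ->
    exists m, forall z, a + e < z < b - e -> f z = m.
  move=> e0 eab.
  pose chi z := Num.max 0 (Num.min (z - (a + e)) ((b - e) - z)).
  have cchi : continuous chi.
    move=> z; apply: (@continuous_max R R (cst 0) (fun z => Num.min (z - (a + e)) (b - e - z)) z).
      exact: cvg_cst.
    apply: (@continuous_min R R (fun z => z - (a + e)) (fun z => b - e - z) z).
      by apply: subfun_cont; [exact: idfun_cont|exact: cstfun_cont].
    by apply: subfun_cont; [exact: cstfun_cont|exact: idfun_cont].
  have chi0 z : 0 <= chi z by rewrite /chi le_max lexx.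
  have chip z : a + e < z < b - e -> 0 < chi z.
    by move=> /andP[az zb]; rewrite /chi lt_max lt_min !subr_gt0 az zb orbT.
  have chiz z : ~ (a + e <= z <= b - e) -> chi z = 0.
    move=> h; rewrite /chi max_l// ge_min !subr_le0 -implyNb; apply/implyP => h1.
    by rewrite leNgt; apply/negP => h2; apply: h; rewrite -ltNge in h1; rewrite !ltW.
  pose S := \int[leb]_(z in `[a, b]) chi z.
  have S0 : 0 < S.
    rewrite lt_neqAle Rintegral_ge0// andbT; apply/eqP => h.
    have m0 : a < (a + b) / 2 < b by apply/andP; split; lra.
    have := ig_eq0 cchi (fun x _ => chi0 x) (esym h) m0.
    have : 0 < chi ((a + b) / 2) by apply: chip; apply/andP; split; lra.
    lra.
  have cfc : continuous (fun z => f z * chi z) by exact: mulfun_cont.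
  pose m := (\int[leb]_(z in `[a, b]) (f z * chi z)) / S.
  exists m.
  pose ph z := (f z - m) * chi z.
  have cph : continuous ph.
    by apply: mulfun_cont => //; apply: subfun_cont => //; exact: cstfun_cont.
  have phE : ph = fun z => f z * chi z + (- m) * chi z by apply/funext => z; rewrite /ph; ring.
  have iph : \int[leb]_(z in `[a, b]) ph z = 0.
    by rewrite phE ig_lin// -/S /m mulNr divfK ?subrr// gt_eqF.
  have ht : test_fun a b (prim a ph).
    split; first by move=> z; exact: (@ex_derive _ _ _ _ _ _ _ (prim_is_derive a z cph)).
    have dE : derive1 (prim a ph) = ph.
      by apply/funext => z; rewrite derive1E; exact: (@derive_val _ _ _ _ _ _ _ (prim_is_derive a z cph)).
    split; first by rewrite dE.
    exists (a + e), (b - e); split; [lra|lra|] => z hz.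
    have ph0 y : ~ (a + e <= y <= b - e) -> ph y = 0.
      by move=> hy; rewrite /ph chiz// mulr0.
    have [za|az] := leP z a.
      rewrite primNE// (@eq_ig _ _ _ _ (fun=> 0)) ?ig0 ?oppr0//.
      by move=> x /andP[_ xa]; apply: ph0; lra.
    have [zb|bz] := leP z b.
      have [za|za] := leP (a + e) z; last first.
        rewrite primE ?(ltW az)// (@eq_ig _ _ _ _ (fun=> 0)) ?ig0//.
        by move=> x /andP[ax xz]; apply: ph0; lra.
      have zb' : b - e < z by rewrite ltNge; apply/negP => h; apply: hz; rewrite za h.
      rewrite primE ?(ltW az)//.
      have := ig_split (ltW az) zb cph; rewrite iph.
      rewrite [X in _ = _ + X](@eq_ig _ _ _ _ (fun=> 0)) ?ig0 ?addr0 => [<-//|].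
      by move=> x /andP[zx xb]; apply: ph0; lra.
    rewrite primE ?(ltW az)// (ig_split (ltW ab) (ltW bz) cph) iph add0r.
    rewrite (@eq_ig _ _ _ _ (fun=> 0)) ?ig0//.
    by move=> x /andP[bx xz]; apply: ph0; lra.
  have := H _ ht.
  have dE : derive1 (prim a ph) = ph.
    by apply/funext => z; rewrite derive1E; exact: (@derive_val _ _ _ _ _ _ _ (prim_is_derive a z cph)).
  rewrite dE => i1.
  have i2 : \int[leb]_(z in `[a, b]) ((f z - m) ^+ 2 * chi z) = 0.
    rewrite (@eq_ig _ _ _ _ (fun z => f z * ph z + (- m) * ph z)); last first.
      by move=> z _; rewrite /ph; ring.
    by rewrite ig_lin ?i1 ?iph ?mulr0 ?addr0//; exact: mulfun_cont.
  move=> z zab.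
  have : (f z - m) ^+ 2 * chi z = 0.
    apply: (ig_eq0 _ _ i2); last by move: zab => /andP[h1 h2]; apply/andP; split; lra.
      by apply: mulfun_cont => //; apply: expfun_cont; apply: subfun_cont => //; exact: cstfun_cont.
    by move=> x _; rewrite mulr_ge0 ?sqr_ge0.
  move/eqP; rewrite mulf_eq0 (gt_eqF (chip _ zab)) orbF sqrf_eq0 subr_eq0.
  by move/eqP.
pose c := (a + b) / 2.
have inner z : a < z < b -> f z = f c.
  move=> /andP[az zb].
  pose e := Num.min (Num.min (z - a) (b - z)) ((b - a) / 2) / 2.
  have e0 : 0 < e by rewrite /e divr_gt0// !lt_min; apply/andP; split; [apply/andP; split|]; lra.
  have h1 : e < z - a.
    have : Num.min (Num.min (z - a) (b - z)) ((b - a) / 2) <= z - a by rewrite !ge_min lexx.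
    by move: e0; rewrite /e; lra.
  have h2 : e < b - z.
    have : Num.min (Num.min (z - a) (b - z)) ((b - a) / 2) <= b - z by rewrite !ge_min lexx orbT.
    by move: e0; rewrite /e; lra.
  have h3 : e < (b - a) / 2.
    have : Num.min (Num.min (z - a) (b - z)) ((b - a) / 2) <= (b - a) / 2 by rewrite !ge_min lexx !orbT.
    by move: e0; rewrite /e; lra.
  have [m hm] := key _ e0 h3.
  by rewrite (hm z) ?(hm c)//; apply/andP; split; rewrite /c; lra.
have bd x : a <= x <= b -> f x = f c.
  move=> /andP[ax xb]; apply/eqP; rewrite -subr_eq0; apply/eqP.
  have cg : continuous (fun z => (f z - f c) ^+ 2).
    by apply: expfun_cont; apply: subfun_cont => //; exact: cstfun_cont.
  apply/eqP; rewrite -sqrf_eq0; apply/eqP.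
  apply/eqP; rewrite eq_le sqr_ge0 andbT leNgt; apply/negP => fx.
  have : \forall y \near x, 0 < (f y - f c) ^+ 2 by apply: cvgr_gt (cg x) _ _.
  move=> [d /= d0 hd].
  pose y := if x <= c then x + Num.min (d / 2) ((b - a) / 4) else x - Num.min (d / 2) ((b - a) / 4).
  have m1 : Num.min (d / 2) ((b - a) / 4) <= d / 2 by rewrite ge_min lexx.
  have m2 : Num.min (d / 2) ((b - a) / 4) <= (b - a) / 4 by rewrite ge_min lexx orbT.
  have m0 : 0 < Num.min (d / 2) ((b - a) / 4) by rewrite lt_min !divr_gt0// subr_gt0.
  have yab : a < y < b.
    by rewrite /y; case: (leP x c); rewrite /c => xc; apply/andP; split; lra.
  suff : 0 < (f y - f c) ^+ 2 by rewrite (inner _ yab) subrr expr0n/= ltxx.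
  apply: hd; rewrite /y /=; case: ifP => _.
    rewrite opprD addrA subrr add0r normrN gtr0_norm//; lra.
  rewrite opprB addrC subrK gtr0_norm//; lra.
by move=> z zab; rewrite bd// bd// lexx ltW.
Qed.

End SobolevPrimitive.

(** * Weak derivatives as densities of primitives *)

Section SobolevScalar.
Context {R : realType}.
Variables (a b : R).
Hypothesis ab : a < b.
Implicit Types (f g k : R -> R).
Local Notation sqi := (sqi a b).
Local Notation primitive_of := (primitive_of a b).

Lemma clamped_cont f : {within `[a, b], continuous f} ->
  continuous (fun z => f (clamp a b z)).
Proof.
apply: within_comp_cont; first exact: clamp_cont.
by move=> z; rewrite /= in_itv/=; apply: clamp_in; exact: ltW.
Qed.

Lemma ig_clamp f k :
  \int[leb]_(z in `[a, b]) (f (clamp a b z) * k z) = \int[leb]_(z in `[a, b]) (f z * k z).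
Proof. by apply: eq_ig => z zab; rewrite clamp_id. Qed.

Lemma wderivP f : is_H1 a b f ->
  is_L2 a b (wderiv a b f) /\ weak_deriv a b f (wderiv a b f).
Proof.
move=> [_ [g hg]].
exact: (@xgetPex _ (fun=> 0) [set g | is_L2 a b g /\ weak_deriv a b f g] (ex_intro _ g hg)).
Qed.

Lemma test_fun_is_derive t z : test_fun a b t -> is_derive z (1 : R) t (derive1 t z).
Proof. by move=> [dt _]; rewrite derive1E; apply: DeriveDef. Qed.

Lemma test_fun_b t : test_fun a b t -> t b = 0.
Proof.
move=> [_ [_ [b1 [b2 [ab1 b2b]]]]]; apply; move=> /andP[_ bb2]; lra.
Qed.

Lemma parts_test g t : sqi g -> test_fun a b t ->
  \int[leb]_(z in `[a, b]) ((\int[leb]_(s in `[a, z]) g s) * derive1 t z) =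
  - \int[leb]_(z in `[a, b]) (g z * t z).
Proof.
move=> sg ht.
have dt z : is_derive z (1 : R) t (derive1 t z) by exact: test_fun_is_derive.
rewrite (parts_prim (ltW ab) sg.1 (sqi_int sg) ht.2.1 dt).
by rewrite (test_fun_b ht) mul0r sub0r.
Qed.

Lemma ig_oo_cont f k : {within `[a, b], continuous f} -> continuous k ->
  \int[leb]_(z in Oz a b) (f z * k z) = \int[leb]_(z in `[a, b]) (f z * k z).
Proof.
move=> cf ck; rewrite -ig_clamp -ig_oo; last first.
  by apply: cont_integrable; apply: mulfun_cont => //; exact: clamped_cont.
apply: eq_Rintegral => z; rewrite inE => zO.
rewrite clamp_id//; have := @subset_itv_oo_cc _ _ a b z zO.
by rewrite /= in_itv.
Qed.

(** The difference of f and the primitive of its weak derivative has weak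
    derivative zero, hence is constant by du Bois-Reymond, and it vanishes at a. *)
Lemma H1_primitive f : {within `[a, b], continuous f} -> is_H1 a b f -> f a = 0 ->
  primitive_of f (wderiv a b f \_ (Oz a b)).
Proof.
move=> cf Hf fa; have [L2g wg] := wderivP Hf.
set g := _ \_ _; have sg : sqi g by exact: is_L2_sqi.
pose F z := \int[leb]_(s in `[a, z]) g s.
have pF : primitive_of F g by split.
have cF := clamped_cont (primitive_cont ab pF).
have cfc := clamped_cont cf.
split => // z zab.
have cw : continuous (fun z => f (clamp a b z) + - 1 * F (clamp a b z)).
  by apply: addfun_cont => //; apply: mulfun_cont => //; exact: cstfun_cont.
have H t : test_fun a b t -> \int[leb]_(z in `[a, b])
    ((f (clamp a b z) + - 1 * F (clamp a b z)) * derive1 t z) = 0.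
  move=> ht; have ct' := ht.2.1.
  rewrite (@eq_ig _ _ _ _ (fun z => f (clamp a b z) * derive1 t z
     + - 1 * (F (clamp a b z) * derive1 t z))); last by move=> x _; ring.
  rewrite ig_lin ?ig_clamp; try exact: mulfun_cont.
  rewrite parts_test// -ig_oo_cont// wg// ig_restrict_oo//.
  by rewrite mulN1r opprK addNr.
have := dubois_reymond ab cw H zab.
rewrite !clamp_id ?lexx ?(ltW ab)// fa /F ig_point mulr0 addr0 mulN1r => /eqP.
by rewrite subr_eq0 => /eqP.
Qed.

Lemma primitive_is_L2 f g : primitive_of f g -> is_L2 a b f.
Proof.
move=> pf; have cf := clamped_cont (primitive_cont ab pf).
have [m i] := sqi_is_L2 (sqi_cont a b cf).
have e : {in Oz a b, (fun z => f (clamp a b z)) =1 f}.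
  move=> z; rewrite inE => zO; rewrite clamp_id//.
  by have := @subset_itv_oo_cc _ _ a b z zO; rewrite /= in_itv.
split; first exact: eq_measurable_fun m.
apply: (@integrable_dom _ (Oz a b) (fun z => f z ^+ 2) (fun z => f (clamp a b z) ^+ 2)) => //.
- exact: measurable_itv.
- by apply: measurable_funX; exact: eq_measurable_fun m.
- by move=> z zO; rewrite e// inE.
Qed.

Lemma primitive_weak_deriv f g : primitive_of f g -> weak_deriv a b f g.
Proof.
move=> pf t ht; have cf := primitive_cont ab pf.
rewrite ig_oo_cont//; last exact: ht.2.1.
have ct : continuous t by apply: (@derive_cont _ _ (derive1 t)) => z; exact: test_fun_is_derive.
rewrite ig_oo; last by apply: sqi_mul; [exact: pf.1|exact: sqi_cont].
rewrite -parts_test//; last exact: pf.1.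
by apply: eq_ig => z zab; rewrite pf.2.
Qed.

Lemma primitive_H1 f g : primitive_of f g -> is_H1 a b f.
Proof.
move=> pf; split; first exact: primitive_is_L2 pf.
exists g; split; last exact: primitive_weak_deriv.
by apply: sqi_is_L2 => //; exact: pf.1.
Qed.

Lemma primitive_a f g : primitive_of f g -> f a = 0.
Proof. by move=> [_ ->]; rewrite ?ig_point// lexx ltW. Qed.

Lemma primitive_wderiv f g : primitive_of f g ->
  primitive_of f (wderiv a b f \_ (Oz a b)).
Proof.
move=> pf; apply: H1_primitive; first exact: primitive_cont pf.
  exact: primitive_H1 pf.
exact: primitive_a pf.
Qed.

(** Two densities of the same function agree almost everywhere, so the chosen
    weak derivative may be replaced by any density at hand. *)
Lemma wderiv_dot f1 g1 f2 g2 : primitive_of f1 g1 -> primitive_of f2 g2 ->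
  \int[leb]_(z in Oz a b) (wderiv a b f1 z * wderiv a b f2 z) =
  \int[leb]_(z in `[a, b]) (g1 z * g2 z).
Proof.
move=> p1 p2; rewrite -ig_restrict_oo//.
have q1 := primitive_wderiv p1; have q2 := primitive_wderiv p2.
rewrite -(primitive_uniq q1 p1 p2.1).
transitivity (\int[leb]_(z in `[a, b]) ((wderiv a b f2 \_ (Oz a b)) z * (wderiv a b f1 \_ (Oz a b)) z)).
  apply: eq_ig => z _; rewrite [RHS]mulrC !patchE.
  by case: ifP => // _; rewrite !mul0r.
rewrite (primitive_uniq q2 p2 q1.1).
by apply: eq_ig => z _; rewrite mulrC.
Qed.

Lemma primitive_dot f1 g1 f2 g2 : primitive_of f1 g1 -> primitive_of f2 g2 ->
  \int[leb]_(z in Oz a b) (f1 z * f2 z) = \int[leb]_(z in `[a, b]) (f1 z * f2 z).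
Proof.
move=> p1 p2.
have c1 := primitive_cont ab p1; have c2 := clamped_cont (primitive_cont ab p2).
rewrite -[RHS](ig_clamp f1 f2).
transitivity (\int[leb]_(z in Oz a b) (f1 z * f2 (clamp a b z))).
  apply: eq_Rintegral => z; rewrite inE => zO; rewrite clamp_id//.
  by have := @subset_itv_oo_cc _ _ a b z zO; rewrite /= in_itv.
by rewrite ig_oo_cont//; apply: eq_ig => z zab; rewrite !clamp_id.
Qed.

Lemma primitive_sqi f g : primitive_of f g -> sqi (fun z => f (clamp a b z)).
Proof. by move=> p; apply: sqi_cont; exact: clamped_cont (primitive_cont ab p). Qed.

(** The one-dimensional Sobolev inequality: f z is an integral of g, to which
    Cauchy-Schwarz applies. *)
Lemma primitive_sup f g z : primitive_of f g -> a <= z <= b ->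
  f z ^+ 2 <= (b - a) * \int[leb]_(s in `[a, b]) (g s ^+ 2).
Proof.
move=> [sg p] zab; rewrite p//; have /andP[az zb] := zab.
have ige := sqi_int_sub sg (lexx a) zb.
have ign := sqi_int (sqi_norm sg).
have h1 : `|\int[leb]_(s in `[a, z]) g s| <= \int[leb]_(s in `[a, b]) `|g s|.
  apply: (le_trans (le_normr_Rintegral _ ige)) => //.
  rewrite (@ig_restrict _ a b)//; apply: le_Rintegral => //.
    apply: (integrable_dom _ _ ign) => //.
      apply: measurable_funTS; apply: measurable_fun_ifT => //.
        apply: measurable_and; apply: measurable_fun_ler => //.
      by apply: measurableT_comp => //; exact: sg.1.
    by move=> x _; case: ifP => _; rewrite normr_id// normr0.
  by move=> x _; case: ifP.
have := sqi_cauchy_schwarz (sqi_norm sg) (sqi_cont a b (@cstfun_cont R R 1)).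
under eq_Rintegral do rewrite mulr1.
rewrite [X in _ <= _ * X](@eq_ig _ _ _ _ (fun=> 1)); last by move=> x _; rewrite expr1n.
rewrite [X in _ * X](ig_cst _ (ltW ab)) mul1r mulrC.
under [X in _ * X]eq_Rintegral do rewrite real_normK ?num_real//.
apply: le_trans; rewrite -[leLHS]real_normK ?num_real//.
by rewrite lerXn2r ?nnegrE ?normr_ge0//; apply: Rintegral_ge0.
Qed.

End SobolevScalar.

(** * The Hilbert space of vector functions vanishing at the left endpoint *)

Section DerivativeRules.
Context {R : realType}.
Implicit Types (f g : R -> R).

Lemma der_mul f g (f' g' z : R) : is_derive z (1 : R) f f' -> is_derive z (1 : R) g g' ->
  is_derive z (1 : R) (fun x => f x * g x) (f z * g' + g z * f').
Proof. by move=> df dg; exact: (@is_deriveM _ _ f g z 1 _ _ df dg). Qed.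

Lemma der_add f g (f' g' z : R) : is_derive z (1 : R) f f' -> is_derive z (1 : R) g g' ->
  is_derive z (1 : R) (fun x => f x + g x) (f' + g').
Proof. by move=> df dg; exact: (@is_deriveD _ _ _ f g z 1 _ _ df dg). Qed.

Lemma der_scale f (f' k z : R) : is_derive z (1 : R) f f' ->
  is_derive z (1 : R) (fun x => k * f x) (k * f').
Proof. by move=> df; exact: (@is_deriveZ _ _ _ f k z 1 _ df). Qed.

Lemma der_cst (k z : R) : is_derive z (1 : R) (fun _ : R => k) (0 : R).
Proof. exact: is_derive_cst. Qed.

Lemma der_exp_affine c k (z : R) :
  is_derive z (1 : R) (fun x => expR (k * (x - c))) (k * expR (k * (z - c))).
Proof.
have h := is_derive_affine c k z.
have := @is_derive1_comp R expR _ z _ _ (is_derive_expR (k * (z - c))) h.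
by rewrite [X in is_derive _ _ _ X]mulrC.
Qed.

Lemma exp_affine_cont c k : continuous (fun x : R => expR (k * (x - c))).
Proof. by apply: (@derive_cont _ _ (fun z => k * expR (k * (z - c)))) => z; exact: der_exp_affine. Qed.

End DerivativeRules.

HB.lock Definition bil (R : realType) (a b : R) (f g : R -> R) : R :=
  \int[leb]_(z in `[a, b]) (f z * g z).

HB.lock Definition dot1 (R : realType) (a b : R) (I : finType) (P Q : I -> R -> R) : R :=
  dotH1 a b P Q.

HB.lock Definition nrm1 (R : realType) (a b : R) (I : finType) (Q : I -> R -> R) : R :=
  normH1 a b Q.

Section SobolevVector.
Context {R : realType}.
Variables (a b : R) (I : finType).
Hypothesis ab : a < b.
Implicit Types (P Q G H S : I -> R -> R).
Local Notation sqi := (sqi a b).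
Local Notation primitive_of := (primitive_of a b).
Local Notation H10 := (@H10 R a b I).
Local Notation dot1 := (@dot1 R a b I).
Local Notation nrm1 := (@nrm1 R a b I).

Definition grad Q : I -> R -> R := fun i => wderiv a b (Q i) \_ (Oz a b).

Lemma H10_primitive Q i : H10 Q -> primitive_of (Q i) (grad Q i).
Proof. by move=> /(_ i) [c h q]; exact: H1_primitive. Qed.

Lemma primitive_H10 Q G : (forall i, primitive_of (Q i) (G i)) -> H10 Q.
Proof.
move=> h i; split; first exact: primitive_cont (h i).
  exact: primitive_H1 (h i).
exact: primitive_a (h i).
Qed.

Lemma H10_lin P Q c : H10 P -> H10 Q -> H10 (fun i z => P i z + c * Q i z).
Proof.
move=> hP hQ; apply: (@primitive_H10 _ (fun i z => grad P i z + c * grad Q i z)) => i.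
by apply: primitive_add => //; [|apply: primitive_scale => //]; exact: H10_primitive.
Qed.

Lemma H10_add P Q : H10 P -> H10 Q -> H10 (P + Q).
Proof.
move=> hP hQ; have := H10_lin 1 hP hQ; congr (Defs.H10 _ _ _).
by apply/funext => i; apply/funext => z; rewrite mul1r.
Qed.

Lemma sub_lin P Q : P - Q = (fun i z => P i z + - 1 * Q i z).
Proof. by apply/funext => i; apply/funext => z; rewrite mulN1r. Qed.

Lemma H10_sub P Q : H10 P -> H10 Q -> H10 (P - Q).
Proof. by move=> hP hQ; rewrite sub_lin; exact: H10_lin. Qed.

Lemma H10_cont Q i : H10 Q -> continuous (fun z => Q i (clamp a b z)).
Proof. by move=> h; apply: clamped_cont => //; case: (h i). Qed.

Local Notation bil := (bil a b).

Lemma bilE f g : bil f g = \int[leb]_(z in `[a, b]) (f z * g z).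
Proof. by rewrite unlock. Qed.

Lemma bilC f g : bil f g = bil g f.
Proof. by rewrite !bilE; apply: eq_ig => z _; rewrite mulrC. Qed.

Lemma bil_lin f g k c : sqi f -> sqi g -> sqi k ->
  bil (fun z => f z + c * g z) k = bil f k + c * bil g k.
Proof.
move=> sf sg sk; rewrite !bilE -RintegralZl//; last exact: sqi_mul.
rewrite -RintegralD//; first by apply: eq_ig => z _; ring.
  exact: sqi_mul.
have := integrable_scaler c (measurable_itv `[a, b]) (sqi_mul sg sk).
by congr (_.-integrable _ _); apply/funext => x /=; rewrite mulrC.
Qed.

Lemma dot1E P Q G H : (forall i, primitive_of (P i) (G i)) ->
  (forall i, primitive_of (Q i) (H i)) ->
  dot1 P Q = \sum_i (bil (fun z => P i (clamp a b z)) (fun z => Q i (clamp a b z))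
                      + bil (G i) (H i)).
Proof.
move=> pP pQ; rewrite dot1.unlock /dotH1 /dotL2 -big_split/=; apply: eq_bigr => i _; rewrite !bilE; congr (_ + _).
  rewrite (primitive_dot ab (pP i) (pQ i)); apply: eq_ig => z zab.
  by rewrite !clamp_id.
exact: wderiv_dot.
Qed.

Lemma dot1_grad P Q : H10 P -> H10 Q ->
  dot1 P Q = \sum_i (bil (fun z => P i (clamp a b z)) (fun z => Q i (clamp a b z))
                      + bil (grad P i) (grad Q i)).
Proof. by move=> hP hQ; apply: dot1E => i; exact: H10_primitive. Qed.

Lemma dotL2C P Q : dotL2 a b P Q = dotL2 a b Q P.
Proof. by apply: eq_bigr => i _; apply: eq_Rintegral => z _; rewrite mulrC. Qed.

Lemma dot1C P Q : dot1 P Q = dot1 Q P.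
Proof.
rewrite dot1.unlock /dotH1 (dotL2C P Q).
by rewrite (dotL2C (fun i => wderiv a b (P i)) (fun i => wderiv a b (Q i))).
Qed.

Lemma dot1_ge0 Q : 0 <= dot1 Q Q.
Proof.
rewrite dot1.unlock /dotH1.
by rewrite addr_ge0//; apply: sumr_ge0 => i _; apply: Rintegral_ge0 => z _; rewrite -expr2 sqr_ge0.
Qed.

Lemma nrm1_ge0 Q : 0 <= nrm1 Q.
Proof. rewrite nrm1.unlock; exact: sqrtr_ge0. Qed.

Lemma nrm1_sqr Q : nrm1 Q ^+ 2 = dot1 Q Q.
Proof. by have := dot1_ge0 Q; rewrite nrm1.unlock dot1.unlock => h; rewrite sqr_sqrtr. Qed.

Lemma dot1_lin P Q S c : H10 P -> H10 Q -> H10 S ->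
  dot1 (fun i z => P i z + c * Q i z) S = dot1 P S + c * dot1 Q S.
Proof.
move=> hP hQ hS; rewrite (@dot1E _ _ (fun i z => grad P i z + c * grad Q i z) (grad S)); last 2 first.
- by move=> i; apply: primitive_add => //; [|apply: primitive_scale => //]; exact: H10_primitive.
- by move=> i; exact: H10_primitive.
rewrite !dot1_grad// mulr_sumr -big_split/=; apply: eq_bigr => i _.
have pP := H10_primitive i hP; have pQ := H10_primitive i hQ; have pS := H10_primitive i hS.
rewrite bil_lin; [|exact: primitive_sqi pP|exact: primitive_sqi pQ|exact: primitive_sqi pS].
rewrite bil_lin; [ring|exact: pP.1|exact: pQ.1|exact: pS.1].
Qed.

Lemma dot1_subl P Q S : H10 P -> H10 Q -> H10 S -> dot1 (P - Q) S = dot1 P S - dot1 Q S.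
Proof. by move=> hP hQ hS; rewrite sub_lin dot1_lin// mulN1r. Qed.

Lemma dot1_expand P Q t : H10 P -> H10 Q ->
  dot1 (fun i z => P i z + t * Q i z) (fun i z => P i z + t * Q i z) =
  dot1 P P + 2 * t * dot1 P Q + t ^+ 2 * dot1 Q Q.
Proof.
move=> hP hQ; have hPQ := H10_lin t hP hQ.
rewrite (dot1_lin t hP hQ hPQ) (dot1C P) (dot1C Q).
by rewrite (dot1_lin t hP hQ hP) (dot1_lin t hP hQ hQ) (dot1C Q P); ring.
Qed.

Lemma dot1_cauchy_schwarz P Q : H10 P -> H10 Q -> `|dot1 P Q| <= nrm1 P * nrm1 Q.
Proof.
move=> hP hQ; rewrite -ler_sqr ?nnegrE ?normr_ge0 ?mulr_ge0 ?nrm1_ge0//.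
rewrite (real_normK (num_real _)) exprMn (nrm1_sqr P) (nrm1_sqr Q).
apply: cauchy_schwarz_form => t.
by rewrite -dot1_expand// dot1_ge0.
Qed.

(** The sup norm is controlled by the H^1 norm; every smallness assumption in the
    H^1 norm is used through this inequality. *)
Lemma H10_sup Q i z : H10 Q -> a <= z <= b ->
  `|Q i z| <= Num.sqrt (b - a) * nrm1 Q.
Proof.
move=> hQ zab; have ba : 0 <= b - a by rewrite subr_ge0 ltW.
rewrite -ler_sqr ?nnegrE ?normr_ge0 ?mulr_ge0 ?nrm1_ge0 ?sqrtr_ge0//.
rewrite (real_normK (num_real _)) exprMn sqr_sqrtr// (nrm1_sqr Q).
apply: (le_trans (primitive_sup ab (H10_primitive i hQ) zab)).
rewrite ler_wpM2l// dot1_grad// (bigD1 i)//= -addrA.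
apply: (@le_trans _ _ (bil (grad Q i) (grad Q i))).
  by rewrite le_eqVlt (_ : (_ == _) = true)//; apply/eqP; rewrite bilE; apply: eq_ig => s _; rewrite expr2.
have b0 f : 0 <= bil f f by rewrite bilE; apply: Rintegral_ge0 => s _; rewrite -expr2 sqr_ge0.
rewrite ler_wpDl// lerDl; apply: sumr_ge0 => j _.
by rewrite addr_ge0.
Qed.

(** The representer solves g - g'' = rho with g a = 0 and g' b = 0, the second
    condition being the natural one at the free endpoint.  Variation of constants
    with e^z and e^{-z} gives a particular solution vanishing at a; a multiple of
    sinh (z - a), which also vanishes at a, corrects its derivative at b. *)
Lemma riesz_scalar (rho : R -> R) : continuous rho ->
  exists g k : R -> R, [/\ primitive_of g k, continuous g & forall h eta, primitive_of h eta ->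
    bil g (fun z => h (clamp a b z)) + bil k eta = bil rho (fun z => h (clamp a b z))].
Proof.
move=> cr.
have dp k z := @der_exp_affine R 0 k z.
pose ex (k : R) : R -> R := fun z => expR (k * (z - 0)).
have cex k : continuous (ex k) by exact: exp_affine_cont.
pose E1 := prim a (fun s => ex (- 1) s * rho s).
pose E2 := prim a (fun s => ex 1 s * rho s).
have d1 z : is_derive z (1 : R) E1 (ex (- 1) z * rho z).
  by apply: prim_is_derive; exact: mulfun_cont.
have d2 z : is_derive z (1 : R) E2 (ex 1 z * rho z).
  by apply: prim_is_derive; exact: mulfun_cont.
have ee z : ex 1 z * ex (- 1) z = 1 by rewrite /ex -expRD mulN1r mul1r subrr expR0.
(* the particular solution, and below its derivative P1 *)
pose P z := - (1 / 2) * (ex 1 z * E1 z + - 1 * (ex (- 1) z * E2 z)).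
pose P1 z := - (1 / 2) * (ex 1 z * E1 z + ex (- 1) z * E2 z).
have dP z : is_derive z (1 : R) P (P1 z).
  have := der_scale (- (1 / 2)) (der_add (der_mul (dp 1 z) (d1 z))
     (der_scale (- 1) (der_mul (dp (- 1) z) (d2 z)))).
  move/is_derive_eq; apply; rewrite /P1 -/(ex 1 z) -/(ex (- 1) z).
  transitivity (- (1 / 2) * ((ex 1 z * ex (- 1) z) * rho z - (ex 1 z * ex (- 1) z) * rho z
     + ex 1 z * E1 z + ex (- 1) z * E2 z)); first by ring.
  by rewrite ee; ring.
have dP1 z : is_derive z (1 : R) P1 (P z - rho z).
  have := der_scale (- (1 / 2)) (der_add (der_mul (dp 1 z) (d1 z))
     (der_mul (dp (- 1) z) (d2 z))).
  move/is_derive_eq; apply; rewrite /P -/(ex 1 z) -/(ex (- 1) z).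
  transitivity (- (1 / 2) * ((ex 1 z * ex (- 1) z) * rho z + (ex 1 z * ex (- 1) z) * rho z
     + ex 1 z * E1 z - ex (- 1) z * E2 z)); first by ring.
  by rewrite ee; field.
(* twice sinh (z - a), and below twice cosh (z - a) *)
pose S z : R := expR (1 * (z - a)) + - 1 * expR (- 1 * (z - a)).
pose C z : R := expR (1 * (z - a)) + expR (- 1 * (z - a)).
have dS z : is_derive z (1 : R) S (C z).
  have := der_add (der_exp_affine a 1 z) (der_scale (- 1) (der_exp_affine a (- 1) z)).
  by move/is_derive_eq; apply; rewrite /C; ring.
have dC z : is_derive z (1 : R) C (S z).
  have := der_add (der_exp_affine a 1 z) (der_exp_affine a (- 1) z).
  by move/is_derive_eq; apply; rewrite /S; ring.
have Cb : 0 < C b by rewrite /C addr_gt0// expR_gt0.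
pose c := - P1 b / C b.
pose g z := P z + c * S z; pose k z := P1 z + c * C z.
have dg z : is_derive z (1 : R) g (k z) by exact: der_add (dP z) (der_scale c (dS z)).
have dk z : is_derive z (1 : R) k (g z - rho z).
  have := der_add (dP1 z) (der_scale c (dC z)).
  by move/is_derive_eq; apply; rewrite /g; ring.
have cg := derive_cont dg; have ck := derive_cont dk.
have ga : g a = 0.
  by rewrite /g /P /E1 /E2 !prim_aa /S subrr !mulr0 expR0; ring.
have kb : k b = 0.
  by rewrite /k /c divfK ?subrr// gt_eqF.
have pg : primitive_of g k.
  split; first exact: sqi_cont.
  by move=> z /andP[az _]; rewrite (ftc2 az ck dg) ga subr0.
exists g, k; split => // h eta ph.
have cgr : continuous (fun z => g z - rho z) by exact: subfun_cont.
have ch := clamped_cont ab (primitive_cont ab ph).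
have := parts_prim (ltW ab) ph.1.1 (sqi_int ph.1) cgr dk.
rewrite kb mul0r sub0r.
have -> : \int[leb]_(z in `[a, b]) (\int[leb]_(s in `[a, z]) eta s * (g z - rho z)) =
   bil g (fun z => h (clamp a b z)) - bil rho (fun z => h (clamp a b z)).
  rewrite !bilE -igB; try exact: mulfun_cont.
  by apply: eq_ig => z zab; rewrite -(ph.2 _ zab) clamp_id//; ring.
rewrite (bilC k) (bilE eta) => h1.
by apply/eqP; rewrite -subr_eq0 addrAC h1 addNr.
Qed.

Lemma riesz_vector (rho : I -> R -> R) : (forall i, continuous (rho i)) ->
  exists g, H10 g /\ forall h, H10 h ->
    dot1 g h = \sum_i bil (rho i) (fun z => h i (clamp a b z)).
Proof.
move=> cr.
have /choice[g] : forall i, exists gk : (R -> R) * (R -> R),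
    [/\ primitive_of gk.1 gk.2, continuous gk.1 & forall h eta, primitive_of h eta ->
    bil gk.1 (fun z => h (clamp a b z)) + bil gk.2 eta = bil (rho i) (fun z => h (clamp a b z))].
  by move=> i; have [g [k hgk]] := riesz_scalar (cr i); exists (g, k).
move=> hg.
have pg i : primitive_of (g i).1 (g i).2 by have [] := hg i.
exists (fun i => (g i).1); split; first exact: (@primitive_H10 _ (fun i => (g i).2)).
move=> h hh; rewrite (dot1E pg (fun i => H10_primitive i hh)).
apply: eq_bigr => i _; have [_ cg hgi] := hg i; rewrite -(hgi _ _ (H10_primitive i hh)).
by congr (_ + _); rewrite !bilE; apply: eq_ig => z zab; rewrite clamp_id.
Qed.

End SobolevVector.

(** * The exponential-polynomial basis *)

(** The L_2(0, pi) product of P e^a and Q e^a: all the functions to be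
    orthonormalized have this form, so Gram-Schmidt acts on the polynomial factors. *)
HB.lock Definition ip (R : realType) (P Q : {poly R}) : R :=
  \int[leb]_(a in `[0, pi]) ((P.[a] * expR a) * (Q.[a] * expR a)).

Section ExponentialPolynomials.
Context {R : realType}.
Implicit Types (P Q D : {poly R}).

Definition poly_exp P : R -> R := fun a => P.[a] * expR a.

Lemma horner_cont P : continuous (fun a : R => P.[a]).
Proof. exact: continuous_horner. Qed.

Lemma pe_cont P : continuous (poly_exp P).
Proof. by apply: mulfun_cont; [exact: horner_cont|exact: continuous_expR]. Qed.

Lemma is_derive_horner P (a : R) : is_derive a (1 : R) (fun x => P.[x]) (P^`()).[a].
Proof.
have h : derivable (horner P) a (1 : R) by exact: derivable_horner.
by apply: DeriveDef => //; rewrite -derive1E derivE.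
Qed.

Lemma is_derive_pe P (a : R) : is_derive a (1 : R) (poly_exp P) (poly_exp (P + P^`()) a).
Proof.
have := @is_deriveM _ _ (horner P) expR a 1 _ _ (is_derive_horner P a) (is_derive_expR a).
by move/is_derive_eq; apply; rewrite /poly_exp hornerD /GRing.scale/=; ring.
Qed.

Lemma ipE P Q : ip P Q = \int[leb]_(a in `[0, pi]) (poly_exp P a * poly_exp Q a).
Proof. by rewrite ip.unlock. Qed.

Lemma ipC P Q : ip P Q = ip Q P.
Proof. by rewrite !ipE; apply: eq_ig => a _; rewrite mulrC. Qed.

Lemma ipDl P Q D : ip (P + Q) D = ip P D + ip Q D.
Proof.
rewrite !ipE -igD; try by apply: mulfun_cont; exact: pe_cont.
by apply: eq_ig => a _; rewrite /poly_exp hornerD; ring.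
Qed.

Lemma ipZl c P Q : ip (c *: P) Q = c * ip P Q.
Proof.
rewrite !ipE -igZ; last by apply: mulfun_cont; exact: pe_cont.
by apply: eq_ig => a _; rewrite /poly_exp hornerZ; ring.
Qed.

Lemma ip0l Q : ip 0 Q = 0.
Proof. by rewrite -(scale0r (0 : {poly R})) ipZl mul0r. Qed.

Lemma ipBl P Q D : ip (P - Q) D = ip P D - ip Q D.
Proof. by rewrite -scaleN1r ipDl ipZl mulN1r. Qed.

Lemma ip_suml (s : seq nat) (F : nat -> {poly R}) D :
  ip (\sum_(k <- s) F k) D = \sum_(k <- s) ip (F k) D.
Proof.
elim: s => [|k s IH]; first by rewrite !big_nil ip0l.
by rewrite !big_cons ipDl IH.
Qed.

(** If the integral were zero, P would vanish on (0, pi), and in particular at more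
    points than its degree allows. *)
Lemma ip_gt0 P : P != 0 -> 0 < ip P P.
Proof.
move=> P0; rewrite lt_neqAle; apply/andP; split; last first.
  by rewrite ipE; apply: Rintegral_ge0 => a _; rewrite -expr2 sqr_ge0.
apply/negP => /eqP /esym; rewrite ipE => i0.
have pi0 := pi_gt0 R.
have z a : 0 < a < pi -> P.[a] = 0.
  move=> a0; have : poly_exp P a * poly_exp P a = 0.
    apply: (ig_eq0 _ _ i0) a0; first by apply: mulfun_cont; exact: pe_cont.
    by move=> x _; rewrite -expr2 sqr_ge0.
  by move/eqP; rewrite mulf_eq0 orbb /poly_exp mulf_eq0 (gt_eqF (expR_gt0 _)) orbF => /eqP.
pose n := size P.
pose rs := [seq pi * (i.+1%:R / n.+1%:R) : R | i <- iota 0 n].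
have n1p : (0 : R) < n.+1%:R by rewrite ltr0n.
have := @max_poly_roots R P rs P0.
have -> : all (root P) rs.
  apply/allP => x /mapP[i]; rewrite mem_iota add0n => /andP[_ iN] ->.
  apply/rootP/z; rewrite pmulr_rgt0// divr_gt0// ?ltr0n//=.
  by rewrite -[ltRHS]mulr1 ltr_pM2l// ltr_pdivrMr// mul1r ltr_nat ltnS.
have -> : uniq rs.
  rewrite map_inj_uniq ?iota_uniq// => i j.
  move/(mulfI (lt0r_neq0 pi0)) /(mulIf (invr_neq0 (lt0r_neq0 n1p))) /eqP.
  by rewrite eqr_nat eqSS => /eqP.
by rewrite size_map size_iota ltnn => /(_ isT isT).
Qed.

Definition resid (s : seq {poly R}) P := P - \sum_(e <- s) ip P e *: e.

Definition stepP s P := (Num.sqrt (ip (resid s P) (resid s P)))^-1 *: resid s P.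

Variable beta : R.

Definition bshift n : {poly R} := ('X - (- beta)%:P) ^+ n.

Fixpoint GSP (n : nat) : seq {poly R} :=
  if n is n'.+1 then rcons (GSP n') (stepP (GSP n') (bshift n')) else [::].

Definition phi_poly n := stepP (GSP n) (bshift n).

Lemma psi_pe n : psi beta n = poly_exp (bshift n).
Proof. by apply/funext => a; rewrite /psi /poly_exp /bshift horner_exp !hornerE opprK. Qed.

Lemma dotL2pi_pe P Q : dotL2pi (poly_exp P) (poly_exp Q) = ip P Q.
Proof. by rewrite ipE. Qed.

Lemma GS_step_pe s P : GS_step [seq poly_exp e | e <- s] (poly_exp P) = poly_exp (stepP s P).
Proof.
have -> : GS_step [seq poly_exp e | e <- s] (poly_exp P) = fun a => poly_exp (resid s P) a /
    Num.sqrt (dotL2pi (poly_exp (resid s P)) (poly_exp (resid s P))).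
  have e : (fun a => poly_exp P a - \sum_(e <- [seq poly_exp e | e <- s]) dotL2pi (poly_exp P) e * e a) = poly_exp (resid s P).
    apply/funext => a; rewrite /poly_exp /resid hornerD hornerN horner_sum mulrDl mulNr; congr (_ - _).
    rewrite big_map mulr_suml; apply: eq_bigr => e _.
    by rewrite -/(poly_exp P) -/(poly_exp e) dotL2pi_pe hornerZ -mulrA.
  rewrite /GS_step/= e; apply/funext => a; congr (_ / _).
  exact: (congr1 (fun f => f a) e).
apply/funext => a; rewrite dotL2pi_pe /stepP /poly_exp hornerZ; ring.
Qed.

Lemma GS_pe n : GS beta n = [seq poly_exp e | e <- GSP n].
Proof.
elim: n => [//|n IH] /=.
by rewrite map_rcons -IH psi_pe {2}IH GS_step_pe.
Qed.

Lemma phi_pe n : phi beta n = poly_exp (phi_poly n).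
Proof. by rewrite /phi GS_pe psi_pe GS_step_pe. Qed.

Lemma GSPE n : GSP n = [seq phi_poly k | k <- iota 0 n].
Proof.
elim: n => [//|n IH]; rewrite -addn1 iotaD map_cat addn1 /=.
by rewrite -cats1 {1}IH.
Qed.

Lemma residE n P : resid (GSP n) P = P - \sum_(k <- iota 0 n) ip P (phi_poly k) *: phi_poly k.
Proof. by rewrite /resid GSPE big_map. Qed.

(** The n-th function to be orthonormalized has degree n, its projection on the
    previous ones a smaller degree; so the residual is not zero and can be
    normalized. *)
Lemma phiP_spec n :
  (forall k, (k < n)%N -> size (phi_poly k) = k.+1) /\
  (forall j k, (j < n)%N -> (k < n)%N -> ip (phi_poly j) (phi_poly k) = (j == k)%:R).
Proof.
elim: n => [//|n [IHs IHo]].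
have sb : size (bshift n) = n.+1 by rewrite /bshift size_exp_XsubC.
have st : (size (\sum_(k <- iota 0 n) ip (bshift n) (phi_poly k) *: phi_poly k)%R <= n)%N.
  rewrite big_seq_cond; apply: (big_ind (fun p : {poly R} => (size p <= n)%N)).
  - by rewrite size_poly0.
  - by move=> p q hp hq; apply: leq_trans (size_polyD _ _) _; rewrite geq_max hp.
  - move=> k; rewrite andbT mem_iota add0n /= => kn; apply: leq_trans (size_scale_leq _ _) _.
    by rewrite IHs.
have sr : size (resid (GSP n) (bshift n)) = n.+1.
  by rewrite residE size_polyDl ?sb// size_polyN ltnS.
have r0 : resid (GSP n) (bshift n) != 0 by rewrite -size_poly_eq0 sr.
have ip0 := ip_gt0 r0.
have s0 : Num.sqrt (ip (resid (GSP n) (bshift n)) (resid (GSP n) (bshift n))) != 0.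
  by rewrite gt_eqF// sqrtr_gt0.
have [c pn] : exists c, phi_poly n = c *: (bshift n - \sum_(k <- iota 0 n) ip (bshift n) (phi_poly k) *: phi_poly k).
  by eexists; rewrite -residE.
have on j : (j < n)%N -> ip (phi_poly n) (phi_poly j) = 0.
  move=> jn; rewrite pn ipZl ipBl ip_suml.
  rewrite (bigD1_seq j) ?iota_uniq ?mem_iota//= -/(phi_poly j) ipZl IHo// eqxx mulr1.
  rewrite big1_seq ?addr0 ?subrr ?mulr0// => k /andP[kj]; rewrite mem_iota add0n /= => kn.
  by rewrite ipZl IHo// (negbTE kj) mulr0.
have nn : ip (phi_poly n) (phi_poly n) = 1.
  rewrite /phi_poly /stepP ipZl ipC ipZl mulrA -invfM -expr2 sqr_sqrtr ?ltW//.
  by rewrite mulVf// gt_eqF.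
split=> [k|j k]; rewrite !ltnS.
  rewrite leq_eqVlt => /predU1P[->|]; last exact: IHs.
  by rewrite /phi_poly /stepP size_scale// invr_neq0.
rewrite leq_eqVlt => /predU1P[->|jn]; rewrite leq_eqVlt => /predU1P[->|kn].
- by rewrite nn eqxx.
- by rewrite on// gtn_eqF.
- by rewrite ipC on// ltn_eqF.
- exact: IHo.
Qed.

Lemma size_phiP n : size (phi_poly n) = n.+1.
Proof. by have [h _] := phiP_spec n.+1; exact: h. Qed.

Lemma phiP_orth j k : ip (phi_poly j) (phi_poly k) = (j == k)%:R.
Proof.
have [_ h] := phiP_spec (maxn j k).+1.
by apply: h; rewrite ltnS ?leq_maxl ?leq_maxr.
Qed.

Lemma resid_lin n c P Q : resid (GSP n) (c *: P + Q) = c *: resid (GSP n) P + resid (GSP n) Q.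
Proof.
rewrite !residE scalerBr scaler_sumr addrACA -opprD -big_split/=; congr (_ - _).
by apply: eq_bigr => k _; rewrite ipDl ipZl scalerDl -scalerA.
Qed.

Lemma resid_phiP n k : (k < n)%N -> resid (GSP n) (phi_poly k) = 0.
Proof.
move=> kn; rewrite residE (bigD1_seq k) ?iota_uniq ?mem_iota//= phiP_orth eqxx scale1r.
rewrite big1_seq ?addr0 ?subrr// => j /andP[jk _].
by rewrite phiP_orth eq_sym (negbTE jk) scale0r.
Qed.

(** The first n basis polynomials have degrees 0, ..., n-1 and therefore span all
    polynomials of degree less than n. *)
Lemma resid_small n D : (size D <= n)%N -> resid (GSP n) D = 0.
Proof.
suff H m : (m <= n)%N -> forall D, (size D <= m)%N -> resid (GSP n) D = 0 by exact: H.
elim: m => [_ D'|m IH mn D' sD].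
  rewrite leqn0 size_poly_eq0 => /eqP ->.
  by rewrite residE big1 ?subrr// => k _; rewrite ip0l scale0r.
pose c := D'`_m / (phi_poly m)`_m.
have lc : (phi_poly m)`_m != 0.
  have : lead_coef (phi_poly m) != 0 by rewrite lead_coef_eq0 -size_poly_eq0 size_phiP.
  by rewrite lead_coefE size_phiP.
have -> : D' = c *: phi_poly m + (D' - c *: phi_poly m) by rewrite addrC subrK.
rewrite resid_lin resid_phiP// scaler0 add0r; apply: IH; first exact: ltnW.
apply/leq_sizeP => j; rewrite leq_eqVlt => /predU1P[<-|mj].
  by rewrite coefB coefZ divfK ?subrr.
rewrite coefB coefZ (leq_sizeP _ _ sD)//.
by rewrite (@nth_default _ 0 (phi_poly m)) ?size_phiP// mulr0 subr0.
Qed.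

Lemma ip_small n D l : (size D <= n)%N -> (n <= l)%N -> ip D (phi_poly l) = 0.
Proof.
move=> sD nl; have /eqP := resid_small sD; rewrite residE subr_eq0 => /eqP ->.
rewrite ip_suml big1_seq// => k; rewrite mem_iota add0n /= => kn.
by rewrite ipZl phiP_orth ltn_eqF ?mulr0// (leq_trans kn).
Qed.

End ExponentialPolynomials.

Section BasisIndependence.
Context {R : realType}.
Variable beta : R.

(** (X + beta)^n and X^n differ by a polynomial of degree less than n, which
    orthogonalization removes. *)
Lemma GSP_indep n : GSP beta n = GSP 0 n.
Proof.
elim: n => [//|n IH] /=; rewrite IH; congr rcons.
suff e : resid (GSP 0 n) (bshift beta n) = resid (GSP 0 n) (bshift 0 n).
  by rewrite /stepP e.
have -> : bshift beta n = 1 *: bshift 0 n + (bshift beta n - bshift 0 n).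
  by rewrite scale1r addrC subrK.
rewrite resid_lin scale1r [X in _ + X]resid_small ?addr0//.
apply/leq_sizeP => j nj; rewrite coefB; apply/eqP; rewrite subr_eq0.
have h (b : R) : size (bshift b n) = n.+1 by rewrite /bshift size_exp_XsubC.
move: nj; rewrite leq_eqVlt => /predU1P[<-|nj]; last by rewrite !nth_default ?h.
have m (b : R) : bshift b n \is monic by rewrite /bshift monic_exp// monicXsubC.
have lc (b : R) : (bshift b n)`_n = 1.
  by have /monicP := m b; rewrite lead_coefE h.
by rewrite !lc.
Qed.

(** This makes all constants that come from the basis independent of beta. *)
Lemma phi_indep n : phi beta n = phi 0 n.
Proof.
have e : phi_poly beta n = phi_poly 0 n.
  by have := GSP_indep n.+1; rewrite /= => /rcons_inj[_].
by rewrite !phi_pe e.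
Qed.

End BasisIndependence.

Section StiffnessMatrix.
Context {R : realType}.

Lemma phi_cont (beta : R) n : continuous (phi beta n).
Proof. by rewrite phi_pe; exact: pe_cont. Qed.

Lemma derive1_phi (beta : R) n : derive1 (phi beta n) = poly_exp (phi_poly beta n + (phi_poly beta n)^`()).
Proof.
rewrite phi_pe; apply/funext => a; rewrite derive1E.
exact: (@derive_val _ _ _ _ _ _ _ (is_derive_pe (phi_poly beta n) a)).
Qed.

Lemma derive1_phi_cont (beta : R) n : continuous (derive1 (phi beta n)).
Proof. by rewrite derive1_phi; exact: pe_cont. Qed.

Lemma phi_is_derive (beta : R) n (a : R) : is_derive a (1 : R) (phi beta n) (derive1 (phi beta n) a).
Proof. by rewrite derive1_phi phi_pe; exact: is_derive_pe. Qed.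

Definition stiff (N : nat) : 'M[R]_N := \matrix_(l, n)
  \int[leb]_(a in Ipi) (derive1 (phi 0 n) a * phi 0 l a).

(** The derivative of P e^a is (P + P') e^a, and P' has smaller degree than P: the
    matrix is triangular with ones on the diagonal. *)
Lemma stiff_upper N (l n : 'I_N) : (n <= l)%N -> stiff N l n = (n == l)%:R.
Proof.
move=> nl; rewrite mxE derive1_phi (phi_pe 0 l).
rewrite (_ : (\int[leb]_(a in _) _) = ip (phi_poly 0 n + (phi_poly 0 n)^`()) (phi_poly 0 l)); last by rewrite ipE.
rewrite ipDl phiP_orth (@ip_small _ _ n) ?addr0//.
have := @lt_size_deriv R (phi_poly 0 n); rewrite size_phiP ltnS; apply.
by rewrite -size_poly_eq0 size_phiP.
Qed.

Lemma stiff_unit N : stiff N \in unitmx.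
Proof.
rewrite unitmxE -det_tr (@det_trig _ _ (stiff N)^T).
  rewrite big1 ?unitr1// => i _; by rewrite mxE stiff_upper// eqxx.
apply/is_trig_mxP => i j ij; rewrite mxE (stiff_upper (ltnW ij)).
by rewrite -val_eqE/= ltn_eqF.
Qed.

End StiffnessMatrix.

(** * Parametric integrals and one-sided derivatives *)

Section ParametricIntegrals.
Context {R : realType}.
Implicit Types (a b z : R).

Lemma prim_lin a (f g : R -> R) k z : continuous f -> continuous g ->
  prim a (fun s => f s + k * g s) z = prim a f z + k * prim a g z.
Proof.
move=> cf cg; have [az|/ltW za] := leP a z; first by rewrite !primE// ig_lin.
by rewrite !primNE// ig_lin//; ring.
Qed.

Lemma prim_sub a (f g : R -> R) z : continuous f -> continuous g ->
  prim a f z - prim a g z = prim a (fun s => f s - g s) z.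
Proof.
move=> cf cg; have [az|/ltW za] := leP a z; first by rewrite !primE// igB.
by rewrite !primNE// igB//; ring.
Qed.

Lemma prim_bound a (f : R -> R) z (M : R) : continuous f ->
  (forall s, Num.min a z <= s <= Num.max a z -> `|f s| <= M) ->
  `|prim a f z| <= M * `|z - a|.
Proof.
move=> cf; have [az|/ltW za] := leP a z => fM.
  by rewrite primE// [X in _ * X]ger0_norm ?subr_ge0//; apply: ig_bound.
rewrite primNE// normrN [X in _ * X]ler0_norm ?subr_le0// opprB.
by apply: ig_bound.
Qed.

(** The tube lemma: near t0, f depends on t uniformly over the compact set. *)
Lemma unif_near (U T : topologicalType) (K : set U) (f : U * T -> R) (t0 : T) e :
  compact K -> continuous f -> 0 < e ->
  \forall t \near t0, forall s, K s -> `|f (s, t) - f (s, t0)| <= e.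
Proof.
move=> /compact_near_coveringP cK cf e0.
have := cK T (nbhs t0) (fun t s => `|f (s, t) - f (s, t0)| <= e) _.
apply => s Ks; have e20 : 0 < e / 2 by rewrite divr_gt0.
have c1 := cf (s, t0); have /cvgrPdist_lt/(_ _ e20) h1 := c1.
have c2 : continuous (fun s' => f (s', t0)).
  exact: curry_left_cont.
have /cvgrPdist_lt/(_ _ e20) h2 := c2 s.
have h2' : \forall s' \near s & t \near t0, `|f (s, t0) - f (s', t0)| < e / 2.
  by exists ([set s' | `|f (s, t0) - f (s', t0)| < e / 2], setT) => /=; [split => //; exact: filterT|move=> [u v] []].
near=> u.
have k1 : `|f (s, t0) - f (u.1, u.2)| < e / 2.
  by rewrite -surjective_pairing; near: u; exact: h1.
have k2 : `|f (s, t0) - f (u.1, t0)| < e / 2 by near: u.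
rewrite (_ : f (u.1, u.2) - f (u.1, t0) =
  (f (s, t0) - f (u.1, t0)) - (f (s, t0) - f (u.1, u.2))); last by ring.
by apply: le_trans (ler_normB _ _) _; lra.
Unshelve. all: by end_near. Qed.

Lemma param_cont (T : topologicalType) a b (f : R * T -> R) : continuous f ->
  continuous (fun t => \int[leb]_(s in `[a, b]) f (s, t)).
Proof.
move=> cf t0.
have [ab|ba] := leP a b; last first.
  have e t : \int[leb]_(s in `[a, b]) f (s, t) = 0 by rewrite set_itv_ge ?Rintegral_set0// -leNgt bnd_simp.
  rewrite (_ : (fun t => _) = (fun=> 0)); last by apply/funext => t; exact: e.
  exact: cvg_cst.
have cs t : continuous (fun s => f (s, t)).
  exact: curry_left_cont.
apply/cvgrPdist_le => e e0.
have e1 : 0 < e / (b - a + 1) by rewrite divr_gt0// ltr_wpDl// subr_ge0.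
have := @unif_near _ _ _ _ t0 _ (@segment_compact R a b) cf e1.
apply: filterS => t ht; rewrite -igB//.
apply: (@le_trans _ _ (e / (b - a + 1) * (b - a))).
  apply: ig_bound => //; first exact: subfun_cont.
  by move=> s sab; rewrite distrC; apply: ht; rewrite /= in_itv.
by rewrite -mulrA ger_pMr// mulrC ler_pdivrMr; lra.
Qed.

Lemma near_fst (U T : topologicalType) (x : U) (y : T) (P : U -> Prop) :
  nbhs x P -> nbhs (x, y) (fun u => P u.1).
Proof.
move=> xP; exists (P, setT) => /=; first by split => //; exact: filterT.
by move=> u [].
Qed.

Lemma near_snd (U T : topologicalType) (x : U) (y : T) (P : T -> Prop) :
  nbhs y P -> nbhs (x, y) (fun u => P u.2).
Proof.
move=> yP; exists (setT, P) => /=; first by split => //; exact: filterT.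
by move=> u [].
Qed.

(** The increment is split into a variation of the endpoint, for a fixed
    parameter, and a variation of the parameter, which is uniformly small over a
    compact interval containing all endpoints concerned. *)
Lemma prim_joint_cont (T : topologicalType) b (f : R * T -> R) : continuous f ->
  continuous (fun u : R * T => prim b (fun s => f (s, u.2)) u.1).
Proof.
move=> cf [z0 t0].
have cs t : continuous (fun s => f (s, t)).
  exact: curry_left_cont.
apply/cvgrPdist_le => e e0 /=.
pose L := Num.min b z0 - 1; pose U := Num.max b z0 + 1.
have lb0 : Num.min b z0 <= b by rewrite ge_min lexx.
have n2 : Num.min b z0 <= z0 by rewrite ge_min lexx orbT.
have n3 : b <= Num.max b z0 by rewrite le_max lexx.
have n4 : z0 <= Num.max b z0 by rewrite le_max lexx orbT.
have LU : L < U by rewrite /L /U; lra.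
have Lb : L < b by rewrite /L; lra.
have bU : b < U by rewrite /U; lra.
have zL : L < z0 by rewrite /L; lra.
have zU : z0 < U by rewrite /U; lra.
have e1 : 0 < e / 2 / (U - L) by rewrite !divr_gt0// subr_gt0.
have h1 := @unif_near _ _ _ _ t0 _ (@segment_compact R L U) cf e1.
have e2 : 0 < e / 2 by rewrite divr_gt0.
have c3 : continuous (prim b (fun s => f (s, t0))) by exact: prim_cont.
have /cvgrPdist_le/(_ _ e2) h2 := c3 z0.
have g2 := near_fst t0 h2; have g1 := near_snd z0 h1.
have hL : \forall z \near z0, L <= z by apply: cvgr_ge (@idfun_cont R z0) _ zL.
have hU : \forall z \near z0, z <= U by apply: cvgr_le (@idfun_cont R z0) _ zU.
have gL := near_fst t0 hL; have gU := near_fst t0 hU.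
near=> u.
have k2 : `|prim b (fun s => f (s, t0)) z0 - prim b (fun s => f (s, t0)) u.1| <= e / 2.
  by near: u; exact: g2.
have k1 : forall s, `[L, U]%classic s -> `|f (s, u.2) - f (s, t0)| <= e / 2 / (U - L).
  by near: u; exact: g1.
have uL : L <= u.1 by near: u; exact: gL.
have uU : u.1 <= U by near: u; exact: gU.
have k3 : `|prim b (fun s => f (s, t0)) u.1 - prim b (fun s => f (s, u.2)) u.1| <= e / 2.
  rewrite prim_sub//.
  apply: (@le_trans _ _ (e / 2 / (U - L) * `|u.1 - b|)).
    apply: prim_bound; first exact: subfun_cont.
    move=> s /andP[]; rewrite ge_min le_max => h3 h4; rewrite distrC.
    apply: k1; rewrite /= in_itv/=; apply/andP; split.
      by move: h3 => /orP[]; apply: le_trans => //; exact: ltW.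
    by move: h4 => /orP[] /le_trans; apply => //; exact: ltW.
  rewrite -mulrA ger_pMr// mulrC ler_pdivrMr ?subr_gt0// mul1r ler_norml.
  by apply/andP; split; lra.
rewrite (_ : _ - _ = (prim b (fun s => f (s, t0)) z0 - prim b (fun s => f (s, t0)) u.1) +
   (prim b (fun s => f (s, t0)) u.1 - prim b (fun s => f (s, u.2)) u.1)); last by ring.
by apply: le_trans (ler_normD _ _) _; lra.
Unshelve. all: by end_near. Qed.

Lemma is_derive_eps (f : R -> R) z l :
  (forall e, 0 < e -> \forall h \near (0 : R), `|f (z + h) - f z - l * h| <= e * `|h|) ->
  is_derive z (1 : R) f l.
Proof.
move=> H.
have cv : (h^-1 *: (f (h *: (1 : R) + z) - f z)) @[h --> (0 : R)^'] --> l.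
  apply/cvgrPdist_le => e e0; near=> h.
  have h0 : h != 0 by near: h; exact: nbhs_dnbhs_neq.
  have nh0 : 0 < `|h| by rewrite normr_gt0.
  have : `|f (z + h) - f z - l * h| <= e * `|h|.
    by near: h; apply: nbhs_dnbhs; exact: H.
  rewrite -ler_pdivrMr//; apply: le_trans; rewrite -normfV -normrM -normrN.
  have -> : h *: (1 : R) = h by rewrite /GRing.scale/= mulr1.
  rewrite /GRing.scale/= (addrC h z) le_eqVlt; apply/orP; left; apply/eqP; congr `|_|.
  by field.
apply: DeriveDef; first by apply/cvg_ex; exists l.
exact/cvg_lim.
Unshelve. all: by end_near. Qed.

Lemma is_derive_quot (f : R -> R) z l : is_derive z (1 : R) f l ->
  forall e, 0 < e -> \forall t \near z, t != z -> `|(f t - f z) / (t - z) - l| <= e.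
Proof.
move=> [df dl] e e0.
have cv : (h^-1 *: (f (h *: (1 : R) + z) - f z)) @[h --> (0 : R)^'] --> l.
  by rewrite -dl; exact: df.
have /cvgrPdist_le/(_ _ e0) := cv.
rewrite /dnbhs /within /= => -[d /= d0 hd].
exists d => //= t zt tz.
have := hd (t - z); rewrite /= sub0r normrN distrC subr_eq0 => /(_ zt tz).
have -> : (t - z) *: (1 : R) + z = t by rewrite /GRing.scale/= mulr1 subrK.
by rewrite distrC /GRing.scale/= mulrC.
Qed.

End ParametricIntegrals.

Section OneSidedDerivatives.
Context {R : realType}.
Variables (a b : R).
Hypothesis ab : a < b.
Local Notation D := `[a, b]%classic.
Implicit Types (f g : R -> R) (x : R).

(** Both endpoints are limits of points of the interval, so one-sided limits are
    unique there as well. *)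
Lemma within_proper x : a <= x <= b -> ProperFilter (within (D `\ x) (nbhs x)).
Proof.
move=> /andP[ax xb]; apply: within_nbhs_proper.
move=> A [d /= d0 hA].
have [m [m0 m1 m2]] : exists m : R, [/\ 0 < m, m <= d / 2 & m <= (b - a) / 4].
  exists (Num.min (d / 2) ((b - a) / 4)).
  by rewrite ge_min lexx ge_min lexx orbT lt_min !divr_gt0// subr_gt0.
pose y := if x <= (a + b) / 2 then x + m else x - m.
exists y; split.
  split; last by move=> /= yx; move: yx; rewrite /y; case: ifP => _; lra.
  by rewrite /= in_itv/= /y; case: (leP x ((a + b) / 2)) => h; apply/andP; split; lra.
apply: hA; rewrite /= /y; case: ifP => _.
  by rewrite opprD addrA subrr add0r normrN gtr0_norm//; lra.
by rewrite opprB addrC subrK gtr0_norm//; lra.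
Qed.

Lemma deriv_in_lim f x l : a <= x <= b ->
  quot f x t @[t --> within (D `\ x) (nbhs x)] --> l ->
  derivable_in D f x /\ deriv_in D f x = l.
Proof.
move=> xab h; have pf := within_proper xab; split; first by apply/cvg_ex; exists l.
exact/cvg_lim.
Qed.

Lemma deriv_in_cvg f x : derivable_in D f x ->
  quot f x t @[t --> within (D `\ x) (nbhs x)] --> deriv_in D f x.
Proof. by []. Qed.

Lemma is_derive_deriv_in f x l : a <= x <= b -> is_derive x (1 : R) f l ->
  derivable_in D f x /\ deriv_in D f x = l.
Proof.
move=> xab df; apply: deriv_in_lim => //; apply/cvgrPdist_le => e e0.
have := is_derive_quot df e0.
rewrite /within /=; apply: filterS => t h [_ /eqP tx].
by rewrite distrC; exact: h.
Qed.

Lemma deriv_in_add f g x : a <= x <= b -> derivable_in D f x -> derivable_in D g x ->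
  derivable_in D (fun t => f t + g t) x /\
  deriv_in D (fun t => f t + g t) x = deriv_in D f x + deriv_in D g x.
Proof.
move=> xab df dg; apply: deriv_in_lim => //.
have pf := within_proper xab.
rewrite (_ : quot _ _ = fun t => quot f x t + quot g x t); last first.
  by apply/funext => t; rewrite /quot -mulrDl; congr (_ / _); ring.
by apply: cvgD; exact: deriv_in_cvg.
Qed.

Lemma deriv_in_is_derive f x : a < x < b -> derivable_in D f x ->
  is_derive x (1 : R) f (deriv_in D f x).
Proof.
move=> /andP[ax xb] /deriv_in_cvg; set l := deriv_in _ _ _ => /cvgrPdist_le h.
apply: is_derive_eps => e e0.
have := h _ e0; rewrite /within /= => -[d /= d0 hd].
pose m := Num.min d (Num.min (x - a) (b - x)).
have m1 : m <= d by rewrite ge_min lexx.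
have m2 : m <= x - a by rewrite !ge_min lexx orbT.
have m3 : m <= b - x by rewrite !ge_min lexx !orbT.
have m0 : 0 < m by rewrite !lt_min d0 !subr_gt0 ax.
exists m => //= k /=; rewrite sub0r normrN => km.
have [->|k0] := eqVneq k 0; first by rewrite addr0 subrr mulr0 subrr !normr0 mulr0.
have nk0 : 0 < `|k| by rewrite normr_gt0.
have := hd (x + k); rewrite /= opprD addrA subrr add0r normrN => /(_ (lt_le_trans km m1)).
have kk : - m < k < m by rewrite -ltr_norml.
have xk : (D `\ x) (x + k).
  split; first by rewrite /= in_itv/=; apply/andP; split; lra.
  by move=> /= /eqP; rewrite -subr_eq0 addrAC subrr add0r (negbTE k0).
move=> /(_ xk); rewrite /quot (_ : x + k - x = k); last by ring.
rewrite -ler_pdivrMr//; apply: le_trans; rewrite -normfV -normrM -normrN.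
rewrite le_eqVlt; apply/orP; left; apply/eqP; congr `|_|.
by field.
Qed.

Lemma derivable_in_cont f x : a <= x <= b -> derivable_in D f x ->
  f t @[t --> within D (nbhs x)] --> f x.
Proof.
move=> xab /deriv_in_cvg; set l := deriv_in _ _ _ => /cvgrPdist_le h.
apply/cvgrPdist_le => e e0.
have := h _ ltr01; rewrite /within /= => -[d /= d0 hd].
have c0 : 0 < `|l| + 1 by rewrite ltr_wpDl.
pose m := Num.min d (e / (`|l| + 1)).
have m0 : 0 < m by rewrite lt_min d0 divr_gt0.
suff : nbhs x (fun t => D t -> `|f x - f t| <= e) by [].
exists m => //= t /=; rewrite lt_min => /andP[td te] tD.
have [->|tx] := eqVneq t x; first by rewrite subrr normr0 ltW.
have tx0 : t - x != 0 by rewrite subr_eq0.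
have := hd t td; have xt : (D `\ x) t by split => //; exact/eqP.
move=> /(_ xt) hq.
have q1 : `|quot f x t| <= `|l| + 1.
  rewrite (_ : quot f x t = l - (l - quot f x t)); last by ring.
  by apply: le_trans (ler_normB _ _) _; rewrite lerD2l.
rewrite distrC (_ : f t - f x = quot f x t * (t - x)); last by rewrite /quot divfK.
rewrite normrM; apply: (@le_trans _ _ ((`|l| + 1) * (e / (`|l| + 1)))); last by rewrite mulrC divfK// gt_eqF.
by apply: ler_pM => //; rewrite distrC ltW.
Qed.

(** At interior points the relative derivative is the ordinary one, while at the
    endpoints relative differentiability gives the one-sided continuity that
    integration by parts requires. *)
Lemma deriv_in_parts f (g G : R -> R) : continuous g -> {within D, continuous (deriv_in D f)} ->
  (forall x, a <= x <= b -> derivable_in D f x) ->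
  (forall x : R, is_derive x (1 : R) G (g x)) ->
  \int[leb]_(x in `[a, b]) (deriv_in D f x * G x) =
  f b * G b - f a * G a - \int[leb]_(x in `[a, b]) (f x * g x).
Proof.
move=> cg cdf df dG.
have aab : a <= a <= b by rewrite lexx ltW.
have bab : a <= b <= b by rewrite lexx ltW.
have cG := derive_cont dG.
have dint x : a < x < b -> is_derive x (1 : R) f (deriv_in D f x).
  by move=> xab; apply: deriv_in_is_derive => //; apply: df; move: xab => /andP[/ltW -> /ltW ->].
have LR : derivable_oo_LRcontinuous f a b.
  split.
  - move=> x; rewrite in_itv/= => xab; exact: (@ex_derive _ _ _ _ _ _ _ (dint x xab)).
  - have := derivable_in_cont aab (df _ aab).
    move/cvgrPdist_le => h; apply/cvgrPdist_le => e e0; have := h _ e0.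
    move=> h1; have h2 : \forall t \near a, t <= b by apply: cvgr_le (@idfun_cont R a) _ ab.
    suff : nbhs a (fun t => a < t -> `|f a - f t| <= e) by [].
    have h3 : nbhs a (fun t => D t -> `|f a - f t| <= e) by exact: h1.
    apply: filterS2 h3 h2 => x hx xb ax.
    by apply: hx; rewrite /= in_itv/= (ltW ax).
  - have := derivable_in_cont bab (df _ bab).
    move/cvgrPdist_le => h; apply/cvgrPdist_le => e e0; have := h _ e0.
    move=> h1; have h2 : \forall t \near b, a <= t by apply: cvgr_ge (@idfun_cont R b) _ ab.
    suff : nbhs b (fun t => t < b -> `|f b - f t| <= e) by [].
    have h3 : nbhs b (fun t => D t -> `|f b - f t| <= e) by exact: h1.
    apply: filterS2 h3 h2 => x hx xa xb.
    by apply: hx; rewrite /= in_itv/= xa ltW.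
have LRG : derivable_oo_LRcontinuous G a b.
  split.
  - by move=> x _; exact: (@ex_derive _ _ _ _ _ _ _ (dG x)).
  - by apply: cvg_at_right_filter; exact: cG.
  - by apply: cvg_at_left_filter; exact: cG.
have := @Rintegration_by_parts R f G (deriv_in D f) g a b ab cdf LR _ (continuous_subspaceT cg) LRG _.
move=> -> //.
- by rewrite opprD opprK addrA addrN add0r.
- by move=> x; rewrite in_itv/= => xab; rewrite derive1E; exact: (@derive_val _ _ _ _ _ _ _ (dint x xab)).
- by move=> x _; rewrite derive1E; exact: (@derive_val _ _ _ _ _ _ _ (dG x)).
Qed.

End OneSidedDerivatives.

(** * The coefficient map *)

(** The triple integral of the system that defines Lambda, in the form obtained by
    integration by parts in a, which makes sense for every continuous f. *)
HB.lock Definition moment (R : realType) (l k m : nat) (f : R * R * R -> R) : R :=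
  \int[leb]_(y in `[0, pi]) \int[leb]_(x in `[0, pi])
    ((f (x, y, pi) * phi 0 l pi - f (x, y, 0) * phi 0 l 0
      - \int[leb]_(a in `[0, pi]) (f (x, y, a) * derive1 (phi 0 l) a))
     * sin (k.+1%:R * x) * sin (m.+1%:R * y)).

Section Moments.
Context {R : realType}.
Local Notation X := (R * R * R)%type.
Local Notation Pi := (@pi R).
Implicit Types (f g : X -> R).

Definition cube : set X := [set u | [/\ 0 <= u.1.1 <= pi, 0 <= u.1.2 <= pi & 0 <= u.2 <= pi]].

Lemma cube_compact : compact cube.
Proof.
have -> : cube = `[0, pi]%classic `*` `[0, pi]%classic `*` `[0, pi]%classic.
  apply/seteqP; split => -[[x y] a] /=; rewrite /cube/= !in_itv/=.
    by move=> [].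
  by move=> [[]].
by apply: compact_setX; [apply: compact_setX|]; exact: segment_compact.
Qed.

Definition bdry l f (x y : R) : R :=
  f (x, y, pi) * phi 0 l pi - f (x, y, 0) * phi 0 l 0
      - \int[leb]_(a in `[0, pi]) (f (x, y, a) * derive1 (phi 0 l) a).

Lemma piR_ge0 : 0 <= Pi. Proof. exact: pi_ge0. Qed.

Lemma sinaff_cont (k : nat) : continuous (fun x : R => sin (k.+1%:R * x)).
Proof.
apply: (compfun_cont (@continuous_sin R)).
by apply: mulfun_cont; [exact: cstfun_cont|exact: idfun_cont].
Qed.

Lemma bdry_cont l f : continuous f -> continuous (fun u : R * R => bdry l f u.1 u.2).
Proof.
move=> cf.
have ce (c : R) : continuous (fun u : R * R => f (u.1, u.2, c)).
  apply: (compfun_cont cf); apply: pairfun_cont; last exact: cst_continuous.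
  apply: pairfun_cont; [apply: fstfun_cont|apply: sndfun_cont]; exact: idfun_cont.
apply: subfun_cont.
  by apply: subfun_cont; apply: mulfun_cont => //; exact: cstfun_cont.
apply: (@param_cont R (R * R)%type 0 pi (fun v => f (v.2.1, v.2.2, v.1) * derive1 (phi 0 l) v.1)).
apply: mulfun_cont.
  apply: (compfun_cont cf); apply: pairfun_cont; last exact: fstfun_cont (@idfun_cont _).
  by apply: pairfun_cont; [apply: fstfun_cont|apply: sndfun_cont]; apply: sndfun_cont; exact: idfun_cont.
apply: (compfun_cont (@derive1_phi_cont R 0 l)); exact: fstfun_cont (@idfun_cont _).
Qed.

Lemma moment_inner_cont l k m f : continuous f ->
  continuous (fun u : R * R => bdry l f u.1 u.2 * sin (k.+1%:R * u.1) * sin (m.+1%:R * u.2)).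
Proof.
move=> cf; apply: mulfun_cont; [apply: mulfun_cont|].
- exact: bdry_cont.
- apply: (compfun_cont (@sinaff_cont k)); exact: fstfun_cont (@idfun_cont _).
- apply: (compfun_cont (@sinaff_cont m)); exact: sndfun_cont (@idfun_cont _).
Qed.

Lemma moment_x_cont l k m f y : continuous f ->
  continuous (fun x => bdry l f x y * sin (k.+1%:R * x) * sin (m.+1%:R * y)).
Proof.
move=> cf; apply: (@compfun_cont R (R * R)%type R _ (fun x : R => (x, y)) (@moment_inner_cont l k m f cf)).
by apply: pairfun_cont; [exact: idfun_cont|exact: cst_continuous].
Qed.

Lemma moment_y_cont l k m f : continuous f ->
  continuous (fun y => \int[leb]_(x in `[0, pi]) (bdry l f x y * sin (k.+1%:R * x) * sin (m.+1%:R * y))).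
Proof.
by move=> cf; apply: (@param_cont R R 0 pi _ (@moment_inner_cont l k m f cf)).
Qed.

Lemma bdry_lin l f g c x y : continuous f -> continuous g ->
  bdry l (fun u => f u + c * g u) x y = bdry l f x y + c * bdry l g x y.
Proof.
move=> cf cg.
have c1 (h : X -> R) : continuous h -> continuous (fun a => h (x, y, a) * derive1 (phi 0 l) a).
  by move=> ch; apply: mulfun_cont; [exact: curry_right_cont|exact: derive1_phi_cont].
rewrite /bdry (@eq_ig _ _ _ (fun a => (f (x, y, a) + c * g (x, y, a)) * derive1 (phi 0 l) a)
  (fun a => f (x, y, a) * derive1 (phi 0 l) a + c * (g (x, y, a) * derive1 (phi 0 l) a))); last first.
  by move=> a _; ring.
by rewrite ig_lin; [ring|exact: c1|exact: c1].
Qed.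

Lemma momentE l k m f : moment l k m f =
  \int[leb]_(y in `[0, pi]) \int[leb]_(x in `[0, pi])
    (bdry l f x y * sin (k.+1%:R * x) * sin (m.+1%:R * y)).
Proof. by rewrite moment.unlock. Qed.

Lemma moment_lin l k m f g c : continuous f -> continuous g ->
  moment l k m (fun u => f u + c * g u) = moment l k m f + c * moment l k m g.
Proof.
move=> cf cg; rewrite !momentE -ig_lin; [|exact: moment_y_cont|exact: moment_y_cont].
apply: eq_ig => y _; rewrite -ig_lin; [|exact: moment_x_cont|exact: moment_x_cont].
by apply: eq_ig => x _; rewrite bdry_lin//; ring.
Qed.

Lemma norm_sin_le1 (x : R) : `|sin x| <= 1.
Proof. by rewrite ler_norml sin_le1 sin_geN1. Qed.

Lemma moment_bound l k m : exists2 C : R, 0 < C & forall f (M : R), continuous f ->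
  (forall u, cube u -> `|f u| <= M) -> `|moment l k m f| <= C * M.
Proof.
have [D D0 HD] := cont_bound 0 Pi (@derive1_phi_cont R 0 l).
pose B := `|phi 0 l pi| + `|phi 0 l 0| + D * pi + 1.
have pi0 := pi_gt0 R.
have B0 : 0 < B by rewrite /B ltr_wpDl// !addr_ge0// mulr_ge0// ltW.
exists (B * pi * pi); first by rewrite !mulr_gt0.
move=> f M cf fM.
have p1 : 0 <= Pi <= Pi by rewrite lexx piR_ge0.
have p0 : 0 <= (0 : R) <= Pi by rewrite lexx piR_ge0.
have M0 : 0 <= M by apply: le_trans (fM (0, 0, 0) _).
rewrite momentE.
have hb x y : 0 <= x <= pi -> 0 <= y <= pi -> `|bdry l f x y| <= B * M.
  move=> x0 y0; rewrite /bdry.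
  have i1 : `|\int[leb]_(a in `[0, pi]) (f (x, y, a) * derive1 (phi 0 l) a)| <= M * D * (pi - 0).
    apply: ig_bound; [exact: ltW|by apply: mulfun_cont; [exact: curry_right_cont|exact: derive1_phi_cont]|].
    by move=> a a0; rewrite normrM ler_pM// ?fM// HD.
  have i2 : `|f (x, y, pi) * phi 0 l pi| <= M * `|phi 0 l pi|.
    by rewrite normrM ler_wpM2r// fM.
  have i3 : `|f (x, y, 0) * phi 0 l 0| <= M * `|phi 0 l 0|.
    by rewrite normrM ler_wpM2r// fM.
  apply: le_trans (ler_normB _ _) _; apply: le_trans (lerD (ler_normB _ _) (lexx _)) _.
  by rewrite /B; move: i1 i2 i3; rewrite subr0; nra.
have BM : 0 <= B * M by rewrite mulr_ge0// ltW.
rewrite (_ : B * pi * pi * M = (B * M * (pi - 0)) * (pi - 0)); last by ring.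
apply: ig_bound; [exact: ltW|exact: moment_y_cont|] => y y0.
apply: ig_bound; [exact: ltW|exact: moment_x_cont|] => x x0.
rewrite !normrM -mulrA -[leRHS]mulr1; apply: ler_pM => //; first exact: hb.
by apply: mulr_ile1 => //; exact: norm_sin_le1.
Qed.

End Moments.

Section CoefficientFunctional.
Context {R : realType}.
Variables (N K : nat).
Local Notation X := (R * R * R)%type.
Local Notation idx := (idx N K).
Implicit Types (f g : X -> R) (i : idx).

(** The inverse of the matrix of the system gives the coefficients of Lambda f in
    closed form. *)
Definition coef i f : R :=
  \sum_(l < N) (- (pi ^+ 2 / 4)^-1 * invmx (stiff N) i.1.1 l) * moment l i.1.2 i.2 f.

Lemma coef_lin i f g c : continuous f -> continuous g ->
  coef i (fun u => f u + c * g u) = coef i f + c * coef i g.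
Proof.
move=> cf cg; rewrite /coef mulr_sumr -big_split/=; apply: eq_bigr => l _.
by rewrite moment_lin//; ring.
Qed.

Lemma coef_bound1 i : exists2 C : R, 0 < C & forall f (M : R), continuous f ->
  (forall u, cube u -> `|f u| <= M) -> `|coef i f| <= C * M.
Proof.
have /choice[C hC] : forall l : 'I_N, exists C : R, 0 < C /\ forall f (M : R), continuous f ->
  (forall u, cube u -> `|f u| <= M) -> `|moment l i.1.2 i.2 f| <= C * M.
  by move=> l; have [C C0 hC] := @moment_bound R l i.1.2 i.2; exists C.
exists (\sum_(l < N) `|- (pi ^+ 2 / 4)^-1 * invmx (stiff N) i.1.1 l| * C l + 1).
  by rewrite ltr_wpDl// sumr_ge0// => l _; rewrite mulr_ge0// ltW//; case: (hC l).
move=> f M cf fM.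
have M0 : 0 <= M.
  by apply: le_trans (fM (0, 0, 0) _) => //; split; rewrite /= lexx pi_ge0.
apply: le_trans (ler_norm_sum _ _ _) _.
rewrite mulrDl mul1r mulr_suml ler_wpDr//; apply: ler_sum => l _.
by rewrite normrM -[leRHS]mulrA; apply: ler_wpM2l => //; case: (hC l) => _; apply.
Qed.

Lemma coef_bound : exists2 C : R, 0 < C & forall i f M, continuous f ->
  (forall u, cube u -> `|f u| <= M) -> `|coef i f| <= C * M.
Proof.
have /choice[C hC] : forall i, exists C : R, 0 < C /\ forall f (M : R), continuous f ->
  (forall u, cube u -> `|f u| <= M) -> `|coef i f| <= C * M.
  by move=> i; have [C C0 hC] := coef_bound1 i; exists C.
exists (\sum_i C i + 1).
  by rewrite ltr_wpDl// sumr_ge0// => i _; rewrite ltW//; case: (hC i).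
move=> i f M cf fM.
have M0 : 0 <= M.
  by apply: le_trans (fM (0, 0, 0) _) => //; split; rewrite /= lexx pi_ge0.
apply: (@le_trans _ _ (C i * M)); first by case: (hC i) => _; apply.
rewrite ler_wpM2r// (bigD1 i)//= -addrA lerDl addr_ge0// sumr_ge0// => j _.
by rewrite ltW//; case: (hC j).
Qed.

Lemma coef_sub i f g : continuous f -> continuous g ->
  coef i f - coef i g = coef i (fun u => f u - g u).
Proof.
move=> cf cg; have := coef_lin i (- 1) cf cg; rewrite mulN1r => <-.
by congr coef; apply/funext => u; rewrite mulN1r.
Qed.

Lemma unif_near_slice (T : topologicalType) (F : T * X -> R) z0 e : continuous F -> 0 < e ->
  \forall z \near z0, forall u, cube u -> `|F (z, u) - F (z0, u)| <= e.
Proof.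
move=> cF e0.
have cG : continuous (fun v : X * T => F (v.2, v.1)) by exact: swap_cont.
exact: (@unif_near R X T cube _ z0 e cube_compact cG e0).
Qed.

Lemma coef_cont i (T : topologicalType) (F : T * X -> R) : continuous F -> continuous (fun z => coef i (fun u => F (z, u))).
Proof.
move=> cF z0; have [C C0 hC] := coef_bound1 i.
apply/cvgrPdist_le => e e0.
have e1 : 0 < e / C by rewrite divr_gt0.
have := unif_near_slice z0 cF e1; apply: filterS => z hz.
rewrite coef_sub; [|exact: curry_right_cont|exact: curry_right_cont].
apply: le_trans (hC _ (e / C) _ _) _.
- by apply: subfun_cont; exact: curry_right_cont.
- by move=> u uD; rewrite distrC; exact: hz.
- by rewrite mulrC divfK// gt_eqF.
Qed.

(** As functions of z, both sides vanish at b and have the same derivative: the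
    difference quotients of the primitive converge uniformly on the cube, and coef
    is bounded for the sup norm. *)
Lemma coef_prim i (F : R * X -> R) b z : continuous F ->
  coef i (fun u => prim b (fun s => F (s, u)) z) = prim b (fun s => coef i (fun u => F (s, u))) z.
Proof.
move=> cF; have [C C0 hC] := coef_bound1 i.
pose D z := coef i (fun u => prim b (fun s => F (s, u)) z).
have cs u : continuous (fun s => F (s, u)) by exact: curry_left_cont.
have cp z1 : continuous (fun u => prim b (fun s => F (s, u)) z1).
  exact: (@curry_right_cont R R X (fun v => prim b (fun s => F (s, v.2)) v.1) z1 (@prim_joint_cont R X b F cF)).
have dD z0 : is_derive z0 (1 : R) D (coef i (fun u => F (z0, u))).
  apply: is_derive_eps => e e0.
  have e1 : 0 < e / C by rewrite divr_gt0.
  have := unif_near_slice z0 cF e1 => -[d /= d0 hd].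
  exists d => //= h /=; rewrite sub0r normrN => hd'.
  rewrite /D coef_sub//.
  have := @coef_lin i (fun u => prim b (fun s => F (s, u)) (z0 + h) - prim b (fun s => F (s, u)) z0)
     (fun u => F (z0, u)) (- h).
  rewrite mulNr [coef i (fun u => F (z0, u)) * h]mulrC => <-; last 2 first.
  - exact: subfun_cont.
  - exact: curry_right_cont.
  apply: le_trans (hC _ (e / C * `|h|) _ _) _.
  - apply: addfun_cont; first exact: subfun_cont.
    by apply: mulfun_cont; [exact: cstfun_cont|exact: curry_right_cont].
  - move=> u uD.
    have -> : prim b (fun s => F (s, u)) (z0 + h) - prim b (fun s => F (s, u)) z0 + - h * F (z0, u) =
       prim z0 (fun s => F (s, u) - F (z0, u)) (z0 + h).
      rewrite -prim_sub//; last exact: cstfun_cont.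
      pose w := Num.min (Num.min b z0) (z0 + h).
      have w1 : w <= b by rewrite !ge_min lexx.
      have w2 : w <= z0 by rewrite !ge_min lexx orbT.
      have w3 : w <= z0 + h by rewrite !ge_min lexx orbT.
      rewrite !(@prim_base _ _ _ w)//; try exact: cstfun_cont.
      rewrite !ig_cst//; ring.
    rewrite -[X in _ * `|X|](_ : z0 + h - z0 = h); last by ring.
    apply: prim_bound; first by apply: subfun_cont => //; exact: cstfun_cont.
    move=> s /andP[s1 s2]; apply: hd => //=.
    have : `|h| < d by [].
    rewrite ltr_norml => /andP[h1 h2]; rewrite ltr_norml; move: s1 s2.
    by rewrite ge_min le_max => /orP[] ? /orP[] ?; apply/andP; split; lra.
  - by rewrite mulrA [C * _]mulrC divfK// gt_eqF.
have cL : continuous (fun s => coef i (fun u => F (s, u))) by exact: coef_cont.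
have d0 z1 : is_derive z1 (1 : R) (D \- prim b (fun s => coef i (fun u => F (s, u)))) 0.
  rewrite -(subrr (coef i (fun u => F (z1, u)))).
  by apply: is_deriveB; exact: prim_is_derive.
have := @is_derive_0_is_cst R _ z b d0.
rewrite /= prim_aa subr0 {2}/D (_ : coef i (fun u => prim b _ b) = 0); last first.
  rewrite (_ : (fun u => _) = (fun u => (fun=> 0) u + (- 1) * (fun=> 0) u)); last first.
    by apply/funext => u; rewrite prim_aa mulr0 addr0.
  by rewrite coef_lin ?mulN1r ?subrr//; exact: cst_continuous.
by move/eqP; rewrite subr_eq0 => /eqP.
Qed.

End CoefficientFunctional.

Section CoefficientsSolveTheSystem.
Context {R : realType}.
Local Notation X := (R * R * R)%type.

(** For C^1 functions the two clauses in the definition agree by integration by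
    parts. *)
Lemma da_moment_eq (beta : R) (h g : R -> R) l : continuous g ->
  (forall a, 0 <= a <= pi -> h a = g a) ->
  da_moment beta h l = g pi * phi 0 l pi - g 0 * phi 0 l 0
     - \int[leb]_(a in `[0, pi]) (g a * derive1 (phi 0 l) a).
Proof.
move=> cg hg; have pi0 := pi_gt0 R.
rewrite /da_moment phi_indep.
have h0 : h 0 = g 0 by apply: hg; rewrite lexx ltW.
have hpi : h pi = g pi by apply: hg; rewrite lexx ltW.
have hi : \int[leb]_(a in `[0, pi]) (h a * derive1 (phi 0 l) a) =
   \int[leb]_(a in `[0, pi]) (g a * derive1 (phi 0 l) a).
  by apply: eq_ig => a a0; rewrite hg.
case: asboolP => [[d1 d2]|_]; last by rewrite h0 hpi -hi.
rewrite -h0 -hpi -hi.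
have dd x : 0 <= x <= pi -> derivable_in `[0, pi]%classic h x.
  by move=> x0; apply: d1; rewrite /Ipi /= in_itv.
exact: (@deriv_in_parts _ _ _ pi0 h _ _ (@derive1_phi_cont R 0 l) d2 dd (fun x => phi_is_derive 0 l x)).
Qed.

(** The matrix of the system is invertible, so the solution that defines Lambda is
    the explicit one. *)
Lemma Lambda_eq (N K : nat) (beta : R) (h : R -> R -> R -> R) (f : X -> R) (i : idx N K) :
  continuous f ->
  (forall x y a, 0 <= x <= pi -> 0 <= y <= pi -> 0 <= a <= pi -> h x y a = f (x, y, a)) ->
  Lambda beta h i = coef i f.
Proof.
move=> cf hf.
have rhs l k m : \int[leb]_(y in Ipi) (\int[leb]_(x in Ipi)
    (da_moment beta (h x y) l * sin (k.+1%:R * x) * sin (m.+1%:R * y))) = moment l k m f.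
  rewrite momentE; apply: eq_ig => y y0; apply: eq_ig => x x0.
  rewrite (@da_moment_eq beta (h x y) (fun a => f (x, y, a)) l)//.
    exact: curry_right_cont.
  by move=> a a0; apply: hf.
have p4 : (pi ^+ 2 / 4 : R) != 0.
  by rewrite mulf_neq0// ?invr_eq0 ?pnatr_eq0// sqrf_eq0 gt_eqF// pi_gt0.
have st (n l : 'I_N) : \int[leb]_(a in Ipi) (derive1 (phi beta n) a * phi beta l a) = stiff N l n.
  by rewrite mxE !phi_indep.
have sysP (w : idx N K -> R) : Lambda_system beta h w <-> forall k m : 'I_K,
    stiff N *m (\col_n w (n, k, m)) = \col_l (- (pi ^+ 2 / 4)^-1 * moment l k m f).
  split=> [H k m|H l k m].
    apply/colP => l; rewrite !mxE.
    have := H l k m; rewrite /sinK rhs => H1.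
    have {H1} H1 : \sum_(n < N) (\int[leb]_(a in Ipi) (derive1 (phi beta n) a * phi beta l a)) * w (n, k, m)
       = (pi ^+ 2 / 4)^-1 * - moment l k m f by rewrite -H1 mulKf.
    rewrite mulNr -mulrN -H1; apply: eq_bigr => n _.
    by rewrite st [in RHS]mulrC [in LHS]mulrC; congr (_ * _); rewrite mxE.
  have /colP/(_ l) := H k m; rewrite !mxE /sinK rhs => H1.
  have -> : \sum_(n < N) (\int[leb]_(a in Ipi) (derive1 (phi beta n) a * phi beta l a)) * w (n, k, m) =
     - (pi ^+ 2 / 4)^-1 * moment l k m f.
    by rewrite -H1; apply: eq_bigr => n _; rewrite st; congr (_ * _); rewrite mxE.
  by rewrite mulrA mulrN mulfV// mulN1r.
have sysF : Lambda_system beta h (fun i : idx N K => coef i f).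
  apply/sysP => k m.
  rewrite (_ : \col_n coef (n, k, m) f = invmx (stiff N) *m \col_l (- (pi ^+ 2 / 4)^-1 * moment l k m f)).
    by rewrite mulKVmx// stiff_unit.
  apply/colP => n; rewrite !mxE; apply: eq_bigr => l _; rewrite !mxE /=; ring.
have sysL : Lambda_system beta h (Lambda beta h : idx N K -> R).
  exact: (@xgetPex _ (fun=> 0) [set w | Lambda_system beta h w] (ex_intro _ _ sysF)).
case: i => [[n k] m].
have e : \col_n (Lambda beta h : idx N K -> R) (n, k, m) = \col_n coef (n, k, m) f.
  have [u1 u2] := ((sysP _).1 sysL k m, (sysP _).1 sysF k m).
  by rewrite -[LHS](mulKmx (stiff_unit N)) u1 -u2 mulKmx// stiff_unit.
by have /colP/(_ n) := e; rewrite !mxE.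
Qed.

End CoefficientsSolveTheSystem.

(** * Quantitative calculus of the reciprocal square root *)

Section ReciprocalRoot.
Context {R : realType}.
Implicit Types (c v d : R).

Definition rroot v : R := (Num.sqrt v)^-1.

Lemma rroot_gt0 v : 0 < v -> 0 < rroot v.
Proof. by move=> v0; rewrite invr_gt0 sqrtr_gt0. Qed.

Lemma rroot_le c v : 0 < c -> c <= v -> rroot v <= rroot c.
Proof.
move=> c0 cv; rewrite lef_pV2 ?posrE ?sqrtr_gt0// ?ler_wsqrtr//.
exact: lt_le_trans cv.
Qed.

(** With r_i = v_i^{-1/2}, this is r1^2 - r2^2 = r1^2 r2^2 (v2 - v1); the two estimates
    below divide it by r1 + r2. *)
Lemma rroot_diff v1 v2 : 0 < v1 -> 0 < v2 ->
  (rroot v1 - rroot v2) * (rroot v1 + rroot v2) =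
  rroot v1 ^+ 2 * rroot v2 ^+ 2 * (v2 - v1).
Proof.
move=> h1 h2; rewrite /rroot -{4}(sqr_sqrtr (ltW h2)) -{4}(sqr_sqrtr (ltW h1)).
have s1 : Num.sqrt v1 != 0 by rewrite gt_eqF// sqrtr_gt0.
have s2 : Num.sqrt v2 != 0 by rewrite gt_eqF// sqrtr_gt0.
by field; rewrite s1 s2.
Qed.

Lemma rroot_lip c v1 v2 : 0 < c -> c <= v1 -> c <= v2 ->
  `|rroot v2 - rroot v1| <= rroot c ^+ 3 * `|v2 - v1|.
Proof.
move=> c0 cv1 cv2; have p1 := lt_le_trans c0 cv1; have p2 := lt_le_trans c0 cv2.
have := rroot_diff p1 p2.
have [a1 a2 m0] := And3 (rroot_gt0 p1) (rroot_gt0 p2) (rroot_gt0 c0).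
have [b1 b2] := (rroot_le c0 cv1, rroot_le c0 cv2).
move: (rroot v1) (rroot v2) (rroot c) a1 a2 m0 b1 b2 => r1 r2 m a1 a2 m0 b1 b2 e.
have s0 : 0 < r1 + r2 by rewrite addr_gt0.
rewrite -(ler_pM2r s0) distrC -{1}(gtr0_norm s0) -normrM e normrM.
rewrite ger0_norm; last by rewrite mulr_ge0// sqr_ge0.
rewrite [leRHS]mulrAC; apply: ler_wpM2r => //.
rewrite (_ : r1 ^+ 2 * r2 ^+ 2 = (r1 * r2 * r2) * r1); last by ring.
rewrite mulrDr; apply: ler_wpDr; first by rewrite mulr_ge0// ?exprn_ge0// ltW.
apply: ler_wpM2r; first exact: ltW.
rewrite (_ : m ^+ 3 = m * m * m); last by ring.
have h : r1 * r2 <= m * m by apply: ler_pM => //; exact: ltW.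
by apply: ler_pM => //; [rewrite mulr_ge0// ltW|exact: ltW].
Qed.

Lemma rroot_taylor c v1 v2 : 0 < c -> c <= v1 -> c <= v2 ->
  `|rroot v2 - rroot v1 + rroot v1 ^+ 3 / 2 * (v2 - v1)| <= rroot c ^+ 5 * `|v2 - v1| ^+ 2.
Proof.
move=> c0 cv1 cv2; have p1 := lt_le_trans c0 cv1; have p2 := lt_le_trans c0 cv2.
have := rroot_diff p1 p2; have := rroot_lip c0 cv1 cv2.
have [a1 a2 m0] := And3 (rroot_gt0 p1) (rroot_gt0 p2) (rroot_gt0 c0).
have [b1 b2] := (rroot_le c0 cv1, rroot_le c0 cv2).
move: (rroot v1) (rroot v2) (rroot c) a1 a2 m0 b1 b2 => r1 r2 m a1 a2 m0 b1 b2 L e.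
have s0 : 0 < r1 + r2 by rewrite addr_gt0.
set D := v2 - v1 in L e *.
have T : (r2 - r1 + r1 ^+ 3 / 2 * D) * (r1 + r2) = D * r1 ^+ 2 * (r1 - r2) * ((r1 + 2 * r2) / 2).
  transitivity (- (r1 ^+ 2 * r2 ^+ 2 * D) + r1 ^+ 3 / 2 * D * (r1 + r2)).
    by rewrite -e; ring.
  by field.
rewrite -(ler_pM2r s0) -{1}(gtr0_norm s0) -normrM T 3!normrM.
have h2 : `|(r1 + 2 * r2) / 2| <= r1 + r2.
  by rewrite ger0_norm; lra.
apply: (@le_trans _ _ (`|D| * m ^+ 2 * (m ^+ 3 * `|D|) * (r1 + r2))); last first.
  by rewrite le_eqVlt; apply/orP; left; apply/eqP; ring.
apply: ler_pM => //; apply: ler_pM => //; [apply: ler_pM => //|by rewrite distrC].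
by rewrite normrX (gtr0_norm a1) lerXn2r// nnegrE ltW.
Qed.

(** The derivative of sqrt v in a direction in which v has derivative d.  The next
    two functions are its partial derivative in d and minus its partial derivative
    in v. *)
Definition dsqrt v d := d * (rroot v / 2).
Definition dsqrt_slope v := rroot v / 2.
Definition dsqrt_defect v d := d * (rroot v ^+ 3 / 4).

(** All differences reduce to those of v^{-1/2}: cubes by factoring, and the
    remainder of order two by splitting off the increment of d. *)
Lemma dsqrt_estimates c D : 0 < c -> 0 <= D -> exists2 C, 0 < C & forall v1 v2 d1 d2,
  c <= v1 -> c <= v2 -> `|d1| <= D -> `|d2| <= D ->
  [/\ `|dsqrt_slope v1| <= C, `|dsqrt_defect v1 d1| <= C, `|dsqrt v1 d1| <= C &
   [/\ `|dsqrt_slope v2 - dsqrt_slope v1| <= C * (`|v2 - v1| + `|d2 - d1|),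
      `|dsqrt_defect v2 d2 - dsqrt_defect v1 d1| <= C * (`|v2 - v1| + `|d2 - d1|),
      `|dsqrt v2 d2 - dsqrt v1 d1| <= C * (`|v2 - v1| + `|d2 - d1|) &
      `|dsqrt v2 d2 - dsqrt v1 d1 - ((d2 - d1) * dsqrt_slope v1 - (v2 - v1) * dsqrt_defect v1 d1)|
        <= C * (`|v2 - v1| + `|d2 - d1|) ^+ 2]].
Proof.
move=> c0 D0; pose m := rroot c; have m0 : 0 < m by exact: rroot_gt0.
have m0' := ltW m0.
pose C := m + D * m ^+ 3 + D * m + m ^+ 3 + m ^+ 3 + D * (3 * m ^+ 2 * m ^+ 3) + D * m ^+ 5.
have mn n : 0 <= m ^+ n by rewrite exprn_ge0// ltW.
have Dmn n : 0 <= D * m ^+ n by rewrite mulr_ge0.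
have Dm : 0 <= D * m by rewrite mulr_ge0// ltW.
have k0 : 0 <= D * (3 * m ^+ 2 * m ^+ 3).
  by apply: mulr_ge0 => //; apply: mulr_ge0 => //; apply: mulr_ge0 => //; exact: ler0n.
exists C; first by rewrite /C; move: (mn 3%N) (Dmn 3%N) (Dmn 5%N); lra.
move=> v1 v2 d1 d2 cv1 cv2 hd1 hd2.
have p1 := lt_le_trans c0 cv1; have p2 := lt_le_trans c0 cv2.
have L := rroot_lip c0 cv1 cv2; have T := rroot_taylor c0 cv1 cv2.
have [a1 a2] := (rroot_gt0 p1, rroot_gt0 p2).
have [b1 b2] := (rroot_le c0 cv1, rroot_le c0 cv2).
rewrite /dsqrt_slope /dsqrt_defect /dsqrt; rewrite -/m in L T b1 b2.
move: (rroot v1) (rroot v2) a1 a2 b1 b2 L T => r1 r2 a1 a2 b1 b2 L T.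
set x := `|v2 - v1| in L T *; set y := `|d2 - d1|.
have x0 : 0 <= x by exact: normr_ge0.
have y0 : 0 <= y by exact: normr_ge0.
have q1 : `|r1| <= m by rewrite gtr0_norm.
have q2 : `|r2| <= m by rewrite gtr0_norm.
have c1 : `|r1 ^+ 3| <= m ^+ 3 by rewrite normrX lerXn2r ?nnegrE// ltW.
have c2 : `|r2 ^+ 3| <= m ^+ 3 by rewrite normrX lerXn2r ?nnegrE// ltW.
have h2 : `|2^-1 : R| = 2^-1 by rewrite ger0_norm.
have h4 : `|4^-1 : R| = 4^-1 by rewrite ger0_norm.
have cub : `|r2 ^+ 3 - r1 ^+ 3| <= 3 * m ^+ 2 * m ^+ 3 * x.
  rewrite (_ : r2 ^+ 3 - r1 ^+ 3 = (r2 ^+ 2 + r2 * r1 + r1 ^+ 2) * (r2 - r1)); last by ring.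
  rewrite normrM -mulrA; apply: ler_pM => //.
  rewrite ger0_norm; last by rewrite !addr_ge0 ?sqr_ge0 ?mulr_ge0// ltW.
  have k1 : r2 ^+ 2 <= m ^+ 2 by rewrite lerXn2r ?nnegrE// ltW.
  have k2 : r1 ^+ 2 <= m ^+ 2 by rewrite lerXn2r ?nnegrE// ltW.
  have k3 : r2 * r1 <= m ^+ 2 by rewrite expr2; apply: ler_pM => //; exact: ltW.
  lra.
have mono A B : 0 <= B -> A <= C -> A * B <= C * B by move=> ? ?; apply: ler_wpM2r.
have xy0 : 0 <= x + y by rewrite addr_ge0.
have CE t : t = m \/ t = D * m ^+ 3 \/ t = D * m \/ t = m ^+ 3 -> t <= C.
  rewrite /C; move: (mn 3%N) (Dmn 3%N) (Dmn 5%N) => z1 z2 z3; move=> [|[|[|]]] ->; lra.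
split.
- by rewrite normrM h2; apply: le_trans (CE m _); [lra|left].
- rewrite (normrM d1) (normrM (r1 ^+ 3)) h4; apply: le_trans (CE (D * m ^+ 3) _); last by right; left.
  by apply: ler_pM => //; rewrite ?mulr_ge0//; move: (mn 3%N); lra.
- rewrite !normrM h2; apply: le_trans (CE (D * m) _); last by right; right; left.
  by apply: ler_pM => //; rewrite ?mulr_ge0//; lra.
split.
- rewrite -mulrBl normrM h2; apply: (@le_trans _ _ (m ^+ 3 * (x + y))).
    have : m ^+ 3 * x <= m ^+ 3 * (x + y) by rewrite ler_wpM2l// lerDl.
    by have : 0 <= m ^+ 3 * x by [rewrite mulr_ge0]; move: L; lra.
  by apply: mono => //; apply: CE; right; right; right.
- rewrite (_ : d2 * _ - _ = (d2 - d1) * (r2 ^+ 3 / 4) + d1 * ((r2 ^+ 3 - r1 ^+ 3) / 4)); last by ring.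
  apply: le_trans (ler_normD _ _) _.
  rewrite (normrM (d2 - d1)) (normrM d1) (normrM (r2 ^+ 3)) (normrM (r2 ^+ 3 - r1 ^+ 3)) h4 -/y.
  have t1 : y * (`|r2 ^+ 3| / 4) <= m ^+ 3 * y.
    by rewrite mulrC ler_wpM2r//; move: c2 (mn 3%N); lra.
  have t2 : `|d1| * (`|r2 ^+ 3 - r1 ^+ 3| / 4) <= D * (3 * m ^+ 2 * m ^+ 3) * x.
    rewrite -mulrA; apply: ler_pM => //; rewrite ?mulr_ge0//.
    have : 0 <= 3 * m ^+ 2 * m ^+ 3 * x.
      by apply: mulr_ge0 => //; apply: mulr_ge0 => //; apply: mulr_ge0 => //; exact: ler0n.
    move: cub; lra.
  apply: (@le_trans _ _ ((m ^+ 3 + D * (3 * m ^+ 2 * m ^+ 3)) * (x + y))).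
    have : 0 <= m ^+ 3 * x by rewrite mulr_ge0.
    have : 0 <= D * (3 * m ^+ 2 * m ^+ 3) * y by rewrite mulr_ge0.
    move: t1 t2; rewrite -/y; move: (D * _) => z; nra.
  apply: mono => //; rewrite /C; move: (mn 3%N) (Dmn 3%N) (Dmn 5%N); lra.
- rewrite (_ : d2 * _ - _ = (d2 - d1) * (r2 / 2) + d1 * ((r2 - r1) / 2)); last by ring.
  apply: le_trans (ler_normD _ _) _; rewrite !normrM h2.
  have t1 : y * (`|r2| / 2) <= m * y by rewrite mulrC ler_wpM2r//; lra.
  have t2 : `|d1| * (`|r2 - r1| / 2) <= D * m ^+ 3 * x.
    rewrite -mulrA; apply: ler_pM => //; rewrite ?mulr_ge0//.
    have : 0 <= m ^+ 3 * x by rewrite !mulr_ge0.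
    move: L; lra.
  apply: (@le_trans _ _ ((m + D * m ^+ 3) * (x + y))).
    have : 0 <= m * x by rewrite mulr_ge0// ltW.
    have : 0 <= D * m ^+ 3 * y by rewrite mulr_ge0.
    move: t1 t2; rewrite -/y; move: (D * _) => z; nra.
  apply: mono => //; rewrite /C; move: (mn 3%N) (Dmn 3%N) (Dmn 5%N); lra.
- rewrite (_ : _ - _ = (d2 - d1) * ((r2 - r1) / 2) + d1 * ((r2 - r1 + r1 ^+ 3 / 2 * (v2 - v1)) / 2)); last by field.
  apply: le_trans (ler_normD _ _) _; rewrite !normrM h2 -/y.
  have t1 : y * (`|r2 - r1| / 2) <= m ^+ 3 * (x + y) ^+ 2.
    apply: (@le_trans _ _ (y * (m ^+ 3 * x))).
      apply: ler_wpM2l => //; have : 0 <= m ^+ 3 * x by rewrite !mulr_ge0.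
      move: L; lra.
    rewrite mulrCA; apply: ler_wpM2l => //.
    have := sqr_ge0 x; have := sqr_ge0 y; have : 0 <= x * y by rewrite mulr_ge0.
    rewrite sqrrD; lra.
  have t2 : `|d1| * (`|r2 - r1 + r1 ^+ 3 / 2 * (v2 - v1)| / 2) <= D * m ^+ 5 * (x + y) ^+ 2.
    rewrite -[leRHS]mulrA; apply: ler_pM => //; rewrite ?mulr_ge0//.
    apply: (@le_trans _ _ (m ^+ 5 * x ^+ 2)).
      have : 0 <= m ^+ 5 * x ^+ 2 by rewrite mulr_ge0// sqr_ge0.
      move: T; lra.
    by apply: ler_wpM2l => //; rewrite lerXn2r ?nnegrE// lerDl.
  apply: (@le_trans _ _ ((m ^+ 3 + D * m ^+ 5) * (x + y) ^+ 2)); first by rewrite mulrDl lerD.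
  apply: mono; first exact: sqr_ge0.
  rewrite /C; move: (mn 3%N) (Dmn 3%N) (Dmn 5%N); lra.
Qed.

End ReciprocalRoot.

(** * Horizontal slopes of the travel time *)

Section OneDirection.
Context {R : realType} {X : topologicalType} {I : finType}.
Variables (a b : R).
Hypothesis ab : a <= b.
Implicit Types (w : R * X -> R) (bs : I -> X -> R) (e : X -> R) (Q h : I -> R -> R).

(** The field v and its horizontal derivatives are affine in the coefficients Q in
    this way; a point p = (z, u) has u = (x, y, a). *)
Definition ansatz w bs Q (p : R * X) : R := w p + \sum_i Q i p.1 * bs i p.2.

Definition l1norm h (s : R) : R := \sum_i `|h i s|.

(** Here w0 and bs0 describe v, while w1 and bs1 describe its derivative in one
    horizontal direction, and e is the slope of the travel time on the top face. *)
Definition dir_ok (M : R) w0 bs0 w1 bs1 e : Prop :=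
  [/\ continuous w0, (forall i, continuous (bs0 i)), continuous w1,
      (forall i, continuous (bs1 i)) & continuous e] /\
  [/\ (forall p, `|w1 p| <= M), (forall i u, `|bs0 i u| <= M),
      (forall i u, `|bs1 i u| <= M) & (forall u, `|e u| <= M)].

(** The lower bound on v keeps the square root regular. *)
Definition admissible (c rho : R) w0 bs0 Q : Prop :=
  [/\ (forall i, continuous (Q i)), (forall i s, `|Q i s| <= rho) &
      (forall p, c <= ansatz w0 bs0 Q p)].

Definition slowness w0 bs0 w1 bs1 Q p := dsqrt (ansatz w0 bs0 Q p) (ansatz w1 bs1 Q p).

(** The slope of the travel time in the given direction, integrated downwards from
    the top face z = b. *)
Definition time_slope w0 bs0 w1 bs1 e Q (p : R * X) : R :=
  prim b (fun s => slowness w0 bs0 w1 bs1 Q (s, p.2)) p.1 + e p.2.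

(** The derivative of slowness with respect to the j-th coefficient of Q at p. *)
Definition time_kernel w0 bs0 w1 bs1 Q j (p : R * X) : R :=
  bs1 j p.2 * dsqrt_slope (ansatz w0 bs0 Q p) - bs0 j p.2 * dsqrt_defect (ansatz w0 bs0 Q p) (ansatz w1 bs1 Q p).

Lemma ansatz_cont w bs Q : continuous w -> (forall i, continuous (bs i)) ->
  (forall i, continuous (Q i)) -> continuous (ansatz w bs Q).
Proof.
move=> cw cb cQ; apply: addfun_cont => //; apply: sumfun_cont => i; apply: mulfun_cont.
  by apply: (compfun_cont (cQ i)); exact: fstfun_cont (@idfun_cont _).
by apply: (compfun_cont (cb i)); exact: sndfun_cont (@idfun_cont _).
Qed.

Lemma l1norm_ge0 h s : 0 <= l1norm h s.
Proof. by apply: sumr_ge0 => i _. Qed.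

Lemma l1norm_cont h : (forall i, continuous (h i)) -> continuous (l1norm h).
Proof. by move=> ch; apply: sumfun_cont => i; apply: normfun_cont. Qed.

Lemma ansatz_diff w bs Q1 Q2 p (M : R) : (forall i u, `|bs i u| <= M) ->
  `|ansatz w bs Q2 p - ansatz w bs Q1 p| <= M * l1norm (fun i s => Q2 i s - Q1 i s) p.1.
Proof.
move=> bM; rewrite /ansatz opprD addrACA subrr add0r -sumrB /l1norm mulr_sumr.
apply: le_trans (ler_norm_sum _ _ _) _; apply: ler_sum => i _.
by rewrite -mulrBl normrM mulrC ler_wpM2r.
Qed.

Lemma ansatz_bound w bs Q p (M rho : R) : (forall p, `|w p| <= M) -> (forall i u, `|bs i u| <= M) ->
  (forall i s, `|Q i s| <= rho) -> `|ansatz w bs Q p| <= M + #|I|%:R * (rho * M).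
Proof.
move=> wM bM Qr; apply: le_trans (ler_normD _ _) _; apply: lerD => //.
apply: le_trans (ler_norm_sum _ _ _) _.
have <- : \sum_(i : I) (rho * M) = #|I|%:R * (rho * M) by rewrite sumr_const mulr_natl.
by apply: ler_sum => i _; rewrite normrM; apply: ler_pM.
Qed.

Lemma rroot_comp_cont (f : R * X -> R) (c : R) : 0 < c -> (forall p, c <= f p) -> continuous f ->
  continuous (fun p => rroot (f p)).
Proof.
move=> c0 cf cont; apply: invfun_cont.
  by move=> p; rewrite gt_eqF// sqrtr_gt0 (lt_le_trans c0).
by apply: (compfun_cont (@sqrt_continuous R)).
Qed.

Section Admissible.
Variables (c M rho : R) (w0 w1 : R * X -> R) (bs0 bs1 : I -> X -> R) (e : X -> R).
Hypothesis c0 : 0 < c.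
Hypothesis ok : dir_ok M w0 bs0 w1 bs1 e.

Lemma slowness_cont Q : admissible c rho w0 bs0 Q -> continuous (slowness w0 bs0 w1 bs1 Q).
Proof.
case: ok => -[cw0 cb0 cw1 cb1 ce] _ [cQ _ vQ].
apply: mulfun_cont; first exact: ansatz_cont.
apply: mulfun_cont; last exact: cst_continuous.
by apply: (rroot_comp_cont c0 vQ); exact: ansatz_cont.
Qed.

Lemma time_kernel_cont Q j : admissible c rho w0 bs0 Q -> continuous (time_kernel w0 bs0 w1 bs1 Q j).
Proof.
case: ok => -[cw0 cb0 cw1 cb1 ce] _ [cQ _ vQ].
have cr : continuous (fun p => rroot (ansatz w0 bs0 Q p)).
  by apply: (rroot_comp_cont c0 vQ); exact: ansatz_cont.
apply: subfun_cont; apply: mulfun_cont.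
- apply: (compfun_cont (cb1 j)); exact: sndfun_cont (@idfun_cont _).
- by apply: mulfun_cont => //; exact: cst_continuous.
- apply: (compfun_cont (cb0 j)); exact: sndfun_cont (@idfun_cont _).
- apply: mulfun_cont; first exact: ansatz_cont.
  by apply: mulfun_cont; [exact: expfun_cont|exact: cst_continuous].
Qed.

Lemma time_slope_cont Q : admissible c rho w0 bs0 Q -> continuous (time_slope w0 bs0 w1 bs1 e Q).
Proof.
move=> aQ; case: ok => -[_ _ _ _ ce] _.
apply: addfun_cont; first exact: (@prim_joint_cont R X b _ (@slowness_cont Q aQ)).
by apply: (compfun_cont ce); exact: sndfun_cont (@idfun_cont _).
Qed.

End Admissible.

(** Since v and its derivative are affine in Q, their increments are at most M * eta,
    and the estimates of dsqrt pass through the chain rule. *)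
Lemma dir_pointwise (c M rho : R) : 0 < c -> 0 <= M -> 0 <= rho ->
  exists2 C : R, 0 < C & forall w0 bs0 w1 bs1 e Q1 Q2, dir_ok M w0 bs0 w1 bs1 e ->
  admissible c rho w0 bs0 Q1 -> admissible c rho w0 bs0 Q2 -> forall p,
  let eta := l1norm (fun i s => Q2 i s - Q1 i s) p.1 in
  [/\ `|slowness w0 bs0 w1 bs1 Q1 p| <= C,
      (forall j, `|time_kernel w0 bs0 w1 bs1 Q1 j p| <= C),
      `|slowness w0 bs0 w1 bs1 Q2 p - slowness w0 bs0 w1 bs1 Q1 p| <= C * eta,
      `|slowness w0 bs0 w1 bs1 Q2 p - slowness w0 bs0 w1 bs1 Q1 p
         - \sum_j (Q2 j p.1 - Q1 j p.1) * time_kernel w0 bs0 w1 bs1 Q1 j p| <= C * eta ^+ 2 &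
      (forall j, `|time_kernel w0 bs0 w1 bs1 Q2 j p - time_kernel w0 bs0 w1 bs1 Q1 j p| <= C * eta)].
Proof.
move=> c0 M0 r0.
pose D := M + #|I|%:R * (rho * M).
have D0 : 0 <= D by rewrite addr_ge0// mulr_ge0// ?mulr_ge0.
have [S S0 HS] := dsqrt_estimates c0 D0.
have SM : 0 <= S * M by rewrite mulr_ge0// ltW.
have SMM : 0 <= S * M * M by rewrite mulr_ge0.
exists (S + 2 * (S * M) + 4 * (S * M * M)); first by lra.
move=> w0 bs0 w1 bs1 e Q1 Q2 ok [cQ1 rQ1 vQ1] [cQ2 rQ2 vQ2] p eta.
have [[cw0 cb0 cw1 cb1 ce] [wM b0M b1M eM]] := ok.
have eta0 : 0 <= eta by exact: l1norm_ge0.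
have dv : `|ansatz w0 bs0 Q2 p - ansatz w0 bs0 Q1 p| <= M * eta by exact: ansatz_diff.
have dd : `|ansatz w1 bs1 Q2 p - ansatz w1 bs1 Q1 p| <= M * eta by exact: ansatz_diff.
have B1 : `|ansatz w1 bs1 Q1 p| <= D by exact: ansatz_bound.
have B2 : `|ansatz w1 bs1 Q2 p| <= D by exact: ansatz_bound.
have [hA hB hG [lA lB lG tG]] := HS _ _ _ _ (vQ1 p) (vQ2 p) B1 B2.
set x := `|ansatz w0 bs0 Q2 p - _| in dv lA lB lG tG.
set y := `|ansatz w1 bs1 Q2 p - _| in dd lA lB lG tG.
have x0 : 0 <= x by exact: normr_ge0.
have y0 : 0 <= y by exact: normr_ge0.
have xy : x + y <= 2 * (M * eta) by lra.
have Sxy : S * (x + y) <= 2 * (S * M) * eta.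
  have : S * (x + y) <= S * (2 * (M * eta)) by rewrite ler_wpM2l// ltW.
  by rewrite (_ : S * (2 * (M * eta)) = 2 * (S * M) * eta)//; ring.
have Sxy2 : S * (x + y) ^+ 2 <= 4 * (S * M * M) * eta ^+ 2.
  have : S * (x + y) ^+ 2 <= S * (2 * (M * eta)) ^+ 2.
    apply: ler_wpM2l; first exact: ltW.
    by rewrite lerXn2r ?nnegrE ?addr_ge0 ?mulr_ge0.
  by rewrite (_ : S * (2 * (M * eta)) ^+ 2 = 4 * (S * M * M) * eta ^+ 2)//; ring.
have ekf Q j : time_kernel w0 bs0 w1 bs1 Q j p =
  bs1 j p.2 * dsqrt_slope (ansatz w0 bs0 Q p) - bs0 j p.2 * dsqrt_defect (ansatz w0 bs0 Q p) (ansatz w1 bs1 Q p) by [].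
have eSM : 0 <= S * M * eta by rewrite mulr_ge0.
have eSMM : 0 <= S * M * M * eta by rewrite mulr_ge0.
have eS : 0 <= S * eta by rewrite mulr_ge0// ltW.
have e2S : 0 <= S * eta ^+ 2 by rewrite mulr_ge0 ?sqr_ge0// ltW.
have e2SM : 0 <= S * M * eta ^+ 2 by rewrite mulr_ge0 ?sqr_ge0.
split.
- by apply: le_trans hG _; lra.
- move=> j; rewrite ekf; apply: le_trans (ler_normB _ _) _; rewrite (normrM (bs1 j p.2)) (normrM (bs0 j p.2)).
  have : `|bs1 j p.2| * `|dsqrt_slope (ansatz w0 bs0 Q1 p)| <= M * S by apply: ler_pM.
  have : `|bs0 j p.2| * `|dsqrt_defect (ansatz w0 bs0 Q1 p) (ansatz w1 bs1 Q1 p)| <= M * S by apply: ler_pM.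
  by move: SMM; rewrite [M * S]mulrC; lra.
- apply: le_trans lG _; apply: le_trans Sxy _; lra.
- have -> : \sum_j (Q2 j p.1 - Q1 j p.1) * time_kernel w0 bs0 w1 bs1 Q1 j p =
     (ansatz w1 bs1 Q2 p - ansatz w1 bs1 Q1 p) * dsqrt_slope (ansatz w0 bs0 Q1 p)
     - (ansatz w0 bs0 Q2 p - ansatz w0 bs0 Q1 p) * dsqrt_defect (ansatz w0 bs0 Q1 p) (ansatz w1 bs1 Q1 p).
    have dvE w bs : ansatz w bs Q2 p - ansatz w bs Q1 p = \sum_j (Q2 j p.1 - Q1 j p.1) * bs j p.2.
      by rewrite /ansatz opprD addrACA subrr add0r -sumrB; apply: eq_bigr => i _; rewrite mulrBl.
    rewrite !dvE !mulr_suml -sumrB; apply: eq_bigr => j _; rewrite ekf; ring.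
  apply: le_trans tG _; apply: le_trans Sxy2 _; lra.
- move=> j; rewrite !ekf.
  rewrite (_ : _ - _ = bs1 j p.2 * (dsqrt_slope (ansatz w0 bs0 Q2 p) - dsqrt_slope (ansatz w0 bs0 Q1 p)) -
    bs0 j p.2 * (dsqrt_defect (ansatz w0 bs0 Q2 p) (ansatz w1 bs1 Q2 p) - dsqrt_defect (ansatz w0 bs0 Q1 p) (ansatz w1 bs1 Q1 p))); last by ring.
  apply: le_trans (ler_normB _ _) _; rewrite (normrM (bs1 j p.2)) (normrM (bs0 j p.2)).
  have h1 : `|bs1 j p.2| * `|dsqrt_slope (ansatz w0 bs0 Q2 p) - dsqrt_slope (ansatz w0 bs0 Q1 p)| <= M * (2 * (S * M) * eta).
    by apply: ler_pM => //; exact: le_trans lA Sxy.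
  have h2 : `|bs0 j p.2| * `|dsqrt_defect (ansatz w0 bs0 Q2 p) (ansatz w1 bs1 Q2 p) - dsqrt_defect (ansatz w0 bs0 Q1 p) (ansatz w1 bs1 Q1 p)|
      <= M * (2 * (S * M) * eta).
    by apply: ler_pM => //; exact: le_trans lB Sxy.
  have e3 : M * (2 * (S * M) * eta) = 2 * (S * M * M * eta) by ring.
  rewrite e3 in h1 h2; lra.
Qed.

Lemma prim_le_ig (f g : R -> R) z : z <= b -> continuous f -> continuous g ->
  (forall s, `|f s| <= g s) -> `|prim b f z| <= \int[leb]_(s in `[z, b]) g s.
Proof.
move=> zb cf cg fg; rewrite primNE// normrN; apply: le_trans (ig_norm _ _ cf) _.
by apply: ig_le => //; exact: normfun_cont.
Qed.

Lemma ig_cst_bound z (k : R) : a <= z <= b -> 0 <= k -> \int[leb]_(s in `[z, b]) k <= k * (b - a).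
Proof. by move=> /andP[az zb] k0; rewrite ig_cst// ler_wpM2l// lerB. Qed.

(** Integration over [z, b] makes the slope at z sensitive only to the increments
    of Q on [z, b]. *)
Lemma dir_integrated (c M rho : R) : 0 < c -> 0 <= M -> 0 <= rho ->
  exists2 C : R, 0 < C & forall w0 bs0 w1 bs1 e Q1 Q2, dir_ok M w0 bs0 w1 bs1 e ->
  admissible c rho w0 bs0 Q1 -> admissible c rho w0 bs0 Q2 -> forall z u, a <= z <= b ->
  let eta := l1norm (fun i s => Q2 i s - Q1 i s) in
  let E Q := time_slope w0 bs0 w1 bs1 e Q (z, u) in
  [/\ `|E Q1| <= C, (forall j s, `|time_kernel w0 bs0 w1 bs1 Q1 j (s, u)| <= C),
      `|E Q2 - E Q1| <= C * \int[leb]_(s in `[z, b]) eta s,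
      `|E Q2 - E Q1 - prim b (fun s => \sum_j (Q2 j s - Q1 j s) * time_kernel w0 bs0 w1 bs1 Q1 j (s, u)) z|
         <= C * \int[leb]_(s in `[z, b]) eta s ^+ 2 &
      (forall j s, `|time_kernel w0 bs0 w1 bs1 Q2 j (s, u) - time_kernel w0 bs0 w1 bs1 Q1 j (s, u)| <= C * eta s)].
Proof.
move=> c0 M0 r0; have [C C0 HC] := dir_pointwise c0 M0 r0.
have ba0 : 0 <= b - a by rewrite subr_ge0.
have Cba : 0 <= C * (b - a) by rewrite mulr_ge0// ltW.
exists (C + C * (b - a) + M); first by lra.
move=> w0 bs0 w1 bs1 e Q1 Q2 ok a1 a2 z u zab eta E.
have /andP[az zb] := zab.
have H p := HC _ _ _ _ _ _ _ ok a1 a2 p.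
have [[_ _ _ _ ce] [_ _ _ eM]] := ok.
have cg1 : continuous (fun s => slowness w0 bs0 w1 bs1 Q1 (s, u)).
  exact: (@curry_left_cont R R X _ u (@slowness_cont c M rho _ _ _ _ _ c0 ok Q1 a1)).
have cg2 : continuous (fun s => slowness w0 bs0 w1 bs1 Q2 (s, u)).
  exact: (@curry_left_cont R R X _ u (@slowness_cont c M rho _ _ _ _ _ c0 ok Q2 a2)).
have ch i : continuous (fun s => Q2 i s - Q1 i s).
  by case: a1 a2 => [k1 _ _] [k2 _ _]; apply: subfun_cont.
have ceta : continuous eta by exact: l1norm_cont.
have ck : continuous (fun s => \sum_j (Q2 j s - Q1 j s) * time_kernel w0 bs0 w1 bs1 Q1 j (s, u)).
  apply: sumfun_cont => j; apply: mulfun_cont => //.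
  exact: (@curry_left_cont R R X _ u (@time_kernel_cont c M rho _ _ _ _ _ c0 ok Q1 j a1)).
have EE : E Q2 - E Q1 = prim b (fun s => slowness w0 bs0 w1 bs1 Q2 (s, u) - slowness w0 bs0 w1 bs1 Q1 (s, u)) z.
  by rewrite -prim_sub// /E /time_slope /=; ring.
have ieta : 0 <= \int[leb]_(s in `[z, b]) eta s by apply: ig_ge0 => s _; exact: l1norm_ge0.
have ieta2 : 0 <= \int[leb]_(s in `[z, b]) eta s ^+ 2 by apply: ig_ge0 => s _; exact: sqr_ge0.
split.
- apply: le_trans (ler_normD _ _) _; apply: lerD => //=.
  apply: (@le_trans _ _ (\int[leb]_(s in `[z, b]) C)).
    by apply: prim_le_ig => //; [exact: cst_continuous|move=> s; case: (H (s, u))].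
  by apply: le_trans (ig_cst_bound zab (ltW C0)) _; lra.
- by move=> j s; case: (H (s, u)) => _ /(_ j) + _ _ _ => /le_trans; apply; lra.
- rewrite EE; apply: (@le_trans _ _ (\int[leb]_(s in `[z, b]) (C * eta s))).
    apply: prim_le_ig => //; [exact: subfun_cont|by apply: mulfun_cont => //; exact: cst_continuous|].
    by move=> s; case: (H (s, u)).
  by rewrite igZ// ler_wpM2r//; lra.
- rewrite EE prim_sub//; last exact: subfun_cont.
  apply: (@le_trans _ _ (\int[leb]_(s in `[z, b]) (C * eta s ^+ 2))).
    apply: prim_le_ig => //.
    + by apply: subfun_cont => //; exact: subfun_cont.
    + by apply: mulfun_cont; [exact: cst_continuous|exact: expfun_cont].
    + by move=> s; case: (H (s, u)).
  by rewrite igZ ?ler_wpM2r//; [lra|exact: expfun_cont].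
- move=> j s; case: (H (s, u)) => _ _ _ _ /(_ j) /le_trans; apply.
  by rewrite ler_wpM2r ?l1norm_ge0//; lra.
Qed.

End OneDirection.

(** * The forward operator and its Volterra estimates *)

Section VolterraOperators.
Context {R : realType} {I : finType}.
Implicit Types (Q h : I -> R -> R).

(** With kernel kn it is minus the integral of kn h over [z, b]. *)
Definition volterra (b : R) (kn : I -> I -> R * R -> R) h i z : R :=
  prim b (fun s => \sum_j kn i j (z, s) * h j s) z.

(** The structure that the convexity argument rests on. *)
Definition volterra_estimates (a b C : R) (good : (I -> R -> R) -> Prop)
    (F : (I -> R -> R) -> I -> R -> R) (K : (I -> R -> R) -> I -> I -> R * R -> R) : Prop :=
  forall Q1 Q2, good Q1 -> good Q2 -> forall i z, a <= z <= b ->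
  let h := fun j s => Q2 j s - Q1 j s in let eta := l1norm h in
  [/\ `|F Q1 i z| <= C,
      (forall j s, `|K Q1 i j (z, s)| <= C),
      `|F Q2 i z - F Q1 i z| <= C * \int[leb]_(s in `[z, b]) eta s,
      `|F Q2 i z - F Q1 i z - volterra b (K Q1) h i z| <= C * \int[leb]_(s in `[z, b]) eta s ^+ 2 &
      (forall delta, (forall s, eta s <= delta) -> forall j s,
         `|K Q2 i j (z, s) - K Q1 i j (z, s)| <= C * delta)].

Lemma volterra_estimates_le a b (C C' : R) good F K : C <= C' ->
  volterra_estimates a b C good F K -> volterra_estimates a b C' good F K.
Proof.
move=> CC H Q1 Q2 a1 a2 i z zab h eta; have [e1 e2 e3 e4 e5] := H _ _ a1 a2 i z zab.
split.
- exact: le_trans e1 CC.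
- by move=> j s; exact: le_trans (e2 j s) CC.
- by apply: le_trans e3 _; apply: ler_wpM2r => //; apply: ig_ge0 => s _; exact: l1norm_ge0.
- by apply: le_trans e4 _; apply: ler_wpM2r => //; apply: ig_ge0 => s _; exact: sqr_ge0.
- move=> delta hd j s; apply: le_trans (e5 delta hd j s) _; apply: ler_wpM2r => //.
  by apply: le_trans (hd 0); exact: l1norm_ge0.
Qed.

End VolterraOperators.

Section ForwardMap.
Context {R : realType} {X : topologicalType} {I : finType}.
Variables (a b : R).
Hypothesis ab : a <= b.
Implicit Types (Q h : I -> R -> R) (L : I -> (X -> R) -> R).

(** The properties by which the coefficient map enters the analysis. *)
Definition functional_ok (CL : R) L : Prop :=
  [/\ (forall i (f g : X -> R) (c : R), continuous f -> continuous g ->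
        L i (fun u => f u + c * g u) = L i f + c * L i g),
      (forall i (f : X -> R) (M : R), continuous f -> (forall u, `|f u| <= M) -> `|L i f| <= CL * M),
      (forall i (F : R * R * X -> R), continuous F ->
         continuous (fun p : R * R => L i (fun u => F (p, u)))) &
      (forall i (F : R * X -> R) z, continuous F ->
         L i (fun u => prim b (fun s => F (s, u)) z) = prim b (fun s => L i (fun u => F (s, u))) z)].

(** The field v is described by dw0 and db0, its x- and y-derivatives by dwx, dbx and
    dwy, dby; dex and dey are the slopes on the top face, and dL gives the
    coefficients. *)
Record forward_data := ForwardData {
  dw0 : R * X -> R; db0 : I -> X -> R;
  dwx : R * X -> R; dbx : I -> X -> R; dex : X -> R;
  dwy : R * X -> R; dby : I -> X -> R; dey : X -> R;
  dL : I -> (X -> R) -> R }.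

Definition forward_data_ok (M CL : R) (D : forward_data) : Prop :=
  [/\ dir_ok M (dw0 D) (db0 D) (dwx D) (dbx D) (dex D),
      dir_ok M (dw0 D) (db0 D) (dwy D) (dby D) (dey D) & functional_ok CL (dL D)].

Definition adm_of (c rho : R) (D : forward_data) Q := admissible c rho (dw0 D) (db0 D) Q.

Definition EX D Q := time_slope b (dw0 D) (db0 D) (dwx D) (dbx D) (dex D) Q.
Definition EY D Q := time_slope b (dw0 D) (db0 D) (dwy D) (dby D) (dey D) Q.
Definition KX D Q := time_kernel (dw0 D) (db0 D) (dwx D) (dbx D) Q.
Definition KY D Q := time_kernel (dw0 D) (db0 D) (dwy D) (dby D) Q.

Definition forward D Q i z : R := dL D i (fun u => EX D Q (z, u) ^+ 2 + EY D Q (z, u) ^+ 2).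

Definition forward_kernel D Q i j (p : R * R) : R :=
  2 * dL D i (fun u => EX D Q (p.1, u) * KX D Q j (p.2, u) + EY D Q (p.1, u) * KY D Q j (p.2, u)).

Section Functional.
Variables (CL : R) (L : I -> (X -> R) -> R).
Hypothesis Lok : functional_ok CL L.

Lemma L_sum i (J : finType) (f : J -> X -> R) (k : J -> R) : (forall j, continuous (f j)) ->
  L i (fun u => \sum_j k j * f j u) = \sum_j k j * L i (f j).
Proof.
case: Lok => linL _ _ _ cf.
have L0 : L i (fun=> 0) = 0.
  have h0 := linL i (fun=> 0) (fun=> 0) (- 1) (@cst_continuous _ _ _) (@cst_continuous _ _ _).
  have e0 : L i (fun=> 0 + - 1 * 0) = L i (fun=> 0).
    by congr (L i _); apply/funext => u; rewrite mulr0 addr0.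
  by move: h0; rewrite e0; lra.
elim: (index_enum J) => [|j s IH].
  by rewrite big_nil -[RHS]L0; congr L; apply/funext => u; rewrite big_nil.
rewrite big_cons -IH [RHS]addrC -linL//; last first.
  by apply: sumseq_cont => j'; apply: mulfun_cont => //; exact: cst_continuous.
by congr L; apply/funext => u; rewrite big_cons addrC.
Qed.

Lemma L_sub i (f g : X -> R) : continuous f -> continuous g -> L i f - L i g = L i (fun u => f u - g u).
Proof.
case: Lok => linL _ _ _ cf cg; have := linL i f g (- 1) cf cg; rewrite mulN1r => <-.
by congr L; apply/funext => u; rewrite mulN1r.
Qed.

Lemma L_cont1 i (F : R * X -> R) : continuous F -> continuous (fun z => L i (fun u => F (z, u))).
Proof.
case: Lok => _ _ cL _ cF.
have cG : continuous (fun w : R * R * X => F (w.1.1, w.2)).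
  apply: (compfun_cont cF); apply: pairfun_cont.
    by do 2 apply: fstfun_cont; exact: idfun_cont.
  by apply: sndfun_cont; exact: idfun_cont.
have := cL i _ cG => h; apply: (compfun_cont h (g := fun z => (z, 0))).
by apply: pairfun_cont; [exact: idfun_cont|exact: cst_continuous].
Qed.

End Functional.

Section Regularity.
Variables (c M rho CL : R) (D : forward_data).
Hypothesis c0 : 0 < c.
Hypothesis ok : forward_data_ok M CL D.

Lemma EX_cont Q : adm_of c rho D Q -> continuous (EX D Q).
Proof. by move=> aQ; case: ok => h _ _; exact: (@time_slope_cont _ _ _ b c M rho _ _ _ _ _ c0 h Q aQ). Qed.

Lemma EY_cont Q : adm_of c rho D Q -> continuous (EY D Q).
Proof. by move=> aQ; case: ok => _ h _; exact: (@time_slope_cont _ _ _ b c M rho _ _ _ _ _ c0 h Q aQ). Qed.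

Lemma KX_cont Q j : adm_of c rho D Q -> continuous (KX D Q j).
Proof. by move=> aQ; case: ok => h _ _; exact: (@time_kernel_cont _ _ _ c M rho _ _ _ _ _ c0 h Q j aQ). Qed.

Lemma KY_cont Q j : adm_of c rho D Q -> continuous (KY D Q j).
Proof. by move=> aQ; case: ok => _ h _; exact: (@time_kernel_cont _ _ _ c M rho _ _ _ _ _ c0 h Q j aQ). Qed.

Lemma forward_cont Q i : adm_of c rho D Q -> continuous (forward D Q i).
Proof.
move=> aQ; case: ok => _ _ Lok.
apply: (@L_cont1 CL (dL D) Lok i (fun p => EX D Q p ^+ 2 + EY D Q p ^+ 2)).
by apply: addfun_cont; apply: expfun_cont; [exact: EX_cont|exact: EY_cont].
Qed.

Lemma EK_cont Q j : adm_of c rho D Q -> continuous (fun w : R * R * X =>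
  EX D Q (w.1.1, w.2) * KX D Q j (w.1.2, w.2) + EY D Q (w.1.1, w.2) * KY D Q j (w.1.2, w.2)).
Proof.
move=> aQ.
have p1 : continuous (fun w : R * R * X => (w.1.1, w.2)).
  apply: pairfun_cont; first by do 2 apply: fstfun_cont; exact: idfun_cont.
  by apply: sndfun_cont; exact: idfun_cont.
have p2 : continuous (fun w : R * R * X => (w.1.2, w.2)).
  apply: pairfun_cont; first by apply: sndfun_cont; apply: fstfun_cont; exact: idfun_cont.
  by apply: sndfun_cont; exact: idfun_cont.
apply: addfun_cont; apply: mulfun_cont.
- exact: (compfun_cont (@EX_cont Q aQ) p1).
- exact: (compfun_cont (@KX_cont Q j aQ) p2).
- exact: (compfun_cont (@EY_cont Q aQ) p1).
- exact: (compfun_cont (@KY_cont Q j aQ) p2).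
Qed.

Lemma forward_kernel_cont Q i j : adm_of c rho D Q -> continuous (forward_kernel D Q i j).
Proof.
move=> aQ; case: ok => _ _ [_ _ cL _].
apply: mulfun_cont; first exact: cst_continuous.
exact: (cL i _ (@EK_cont Q j aQ)).
Qed.

(** Moving the functional inside the z-integral exhibits the derivative of the
    squared slopes as a Volterra operator with a continuous kernel. *)
Lemma forward_derivative_eq Q i h z : adm_of c rho D Q -> (forall j, continuous (h j)) ->
  volterra b (forward_kernel D Q) h i z = dL D i (fun u =>
    2 * EX D Q (z, u) * prim b (fun s => \sum_j h j s * KX D Q j (s, u)) z +
    2 * EY D Q (z, u) * prim b (fun s => \sum_j h j s * KY D Q j (s, u)) z).
Proof.
move=> aQ ch; have [_ _ Lok] := ok; have [linL _ _ Lp] := Lok.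
have cs (k : I -> R * X -> R) u : (forall j, continuous (k j)) ->
    continuous (fun s => \sum_j h j s * k j (s, u)).
  move=> ck; apply: sumfun_cont => j; apply: mulfun_cont => //.
  exact: curry_left_cont.
have cx u := cs _ u (fun j => @KX_cont Q j aQ).
have cy u := cs _ u (fun j => @KY_cont Q j aQ).
have pl (k1 k2 : R) f g : continuous f -> continuous g ->
    k1 * prim b f z + k2 * prim b g z = prim b (fun s => k1 * f s + k2 * g s) z.
  move=> cf cg.
  have c1 : continuous (fun s => k1 * f s) by apply: mulfun_cont => //; exact: cst_continuous.
  rewrite (prim_lin b k2 z c1 cg); congr (_ + _).
  have := prim_lin b (f := fun=> 0) (g := f) k1 z (@cst_continuous _ _ _) cf.
  have -> : prim b (fun=> 0) z = 0 by rewrite /prim !ig0 oppr0 if_same.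
  by rewrite add0r => <-; congr prim; apply/funext => s; rewrite add0r.
have -> : (fun u => 2 * EX D Q (z, u) * prim b (fun s => \sum_j h j s * KX D Q j (s, u)) z +
    2 * EY D Q (z, u) * prim b (fun s => \sum_j h j s * KY D Q j (s, u)) z) =
   (fun u => prim b (fun s => \sum_j (2 * h j s) * (EX D Q (z, u) * KX D Q j (s, u) +
                                  EY D Q (z, u) * KY D Q j (s, u))) z).
  apply/funext => u; rewrite pl//; congr prim; apply/funext => s.
  by rewrite !mulr_sumr -big_split/=; apply: eq_bigr => j _; ring.
pose F (w : R * X) := \sum_j (2 * h j w.1) * (EX D Q (z, w.2) * KX D Q j w + EY D Q (z, w.2) * KY D Q j w).
have cEK j : continuous (fun w : R * X => EX D Q (z, w.2) * KX D Q j w + EY D Q (z, w.2) * KY D Q j w).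
  have p1 : continuous (fun w : R * X => (z, w.2)).
    by apply: pairfun_cont; [exact: cst_continuous|exact: sndfun_cont (@idfun_cont _)].
  apply: addfun_cont; apply: mulfun_cont.
  - exact: (compfun_cont (@EX_cont Q aQ) p1).
  - exact: KX_cont.
  - exact: (compfun_cont (@EY_cont Q aQ) p1).
  - exact: KY_cont.
have cF : continuous F.
  apply: sumfun_cont => j; apply: mulfun_cont => //.
  apply: mulfun_cont; first exact: cst_continuous.
  by apply: (compfun_cont (ch j)); exact: fstfun_cont (@idfun_cont _).
transitivity (dL D i (fun u => prim b (fun s => F (s, u)) z)); last first.
  by congr dL; apply/funext => u; congr prim; apply/funext => s; apply: eq_bigr => j _.
rewrite Lp// /volterra; congr prim; apply/funext => s.
rewrite (L_sum Lok i (J := I) (fun j => 2 * h j s) (f := fun j u => EX D Q (z, u) * KX D Q j (s, u) + EY D Q (z, u) * KY D Q j (s, u))).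
  by apply: eq_bigr => j _; rewrite /forward_kernel /=; ring.
by move=> j; exact: (@curry_right_cont R R X _ s (cEK j)).
Qed.

End Regularity.

(** The increment of a squared slope is that of the slope times a bounded factor,
    and the functionals preserve sup-norm bounds.  The square of a tail integral of eta is at
    most (b - a) times the tail integral of eta^2, so the quadratic error has Volterra
    form too. *)
Theorem forward_estimates (c M rho CL : R) : 0 < c -> 0 <= M -> 0 <= rho -> 0 <= CL ->
  exists2 C : R, 0 < C & forall D, forward_data_ok M CL D ->
    volterra_estimates a b C (adm_of c rho D) (forward D) (forward_kernel D).
Proof.
move=> c0 M0 r0 CL0; have [C C0 HC] := @dir_integrated R X I a b ab c M rho c0 M0 r0.
have ba0 : 0 <= b - a by rewrite subr_ge0.
have C1 := ltW C0.
have n1' : 0 <= CL * (2 * C ^+ 2) by rewrite mulr_ge0// mulr_ge0// sqr_ge0.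
have n2' : 0 <= CL * (4 * C ^+ 2) by rewrite mulr_ge0// mulr_ge0// sqr_ge0.
have n3' : 0 <= CL * (4 * C ^+ 2 + 2 * C ^+ 2 * (b - a)).
  by rewrite mulr_ge0// addr_ge0// !mulr_ge0 ?sqr_ge0.
have n4' : 0 <= 2 * (CL * (2 * C ^+ 2 + 2 * C ^+ 2 * (b - a))).
  by rewrite !mulr_ge0// addr_ge0// !mulr_ge0 ?sqr_ge0.
pose T := CL * (2 * C ^+ 2) + 2 * (CL * (2 * C ^+ 2)) + CL * (4 * C ^+ 2) +
   CL * (4 * C ^+ 2 + 2 * C ^+ 2 * (b - a)) +
   2 * (CL * (2 * C ^+ 2 + 2 * C ^+ 2 * (b - a))) + 1.
exists T; first by rewrite /T; lra.
move=> D ok Q1 Q2 a1 a2 i z zab h eta.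
have /andP[az zb] := zab.
have [okx oky Lok] := ok; have [linL bd _ _] := Lok.
have HX u := HC _ _ _ _ _ _ _ okx a1 a2 z u zab.
have HY u := HC _ _ _ _ _ _ _ oky a1 a2 z u zab.
have HX2 u := HC _ _ _ _ _ _ _ okx a2 a1 z u zab.
have HY2 u := HC _ _ _ _ _ _ _ oky a2 a1 z u zab.
have ch j : continuous (h j).
  by case: a1 a2 => [k1 _ _] [k2 _ _]; apply: subfun_cont.
have ceta : continuous eta by exact: l1norm_cont.
have cX1 : continuous (fun u => EX D Q1 (z, u)) by exact: (@curry_right_cont R R X _ z (@EX_cont c M rho CL D c0 ok Q1 a1)).
have cX2 : continuous (fun u => EX D Q2 (z, u)) by exact: (@curry_right_cont R R X _ z (@EX_cont c M rho CL D c0 ok Q2 a2)).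
have cY1 : continuous (fun u => EY D Q1 (z, u)) by exact: (@curry_right_cont R R X _ z (@EY_cont c M rho CL D c0 ok Q1 a1)).
have cY2 : continuous (fun u => EY D Q2 (z, u)) by exact: (@curry_right_cont R R X _ z (@EY_cont c M rho CL D c0 ok Q2 a2)).
have ckx Q j s : adm_of c rho D Q -> continuous (fun u => KX D Q j (s, u)).
  by move=> aQ; exact: (@curry_right_cont R R X _ s (@KX_cont c M rho CL D c0 ok Q j aQ)).
have cky Q j s : adm_of c rho D Q -> continuous (fun u => KY D Q j (s, u)).
  by move=> aQ; exact: (@curry_right_cont R R X _ s (@KY_cont c M rho CL D c0 ok Q j aQ)).
set J1 := \int[leb]_(s in `[z, b]) eta s.
set J2 := \int[leb]_(s in `[z, b]) eta s ^+ 2.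
have J10 : 0 <= J1 by apply: ig_ge0 => s _; exact: l1norm_ge0.
have J20 : 0 <= J2 by apply: ig_ge0 => s _; exact: sqr_ge0.
have CS : J1 ^+ 2 <= (b - a) * J2.
  apply: le_trans (cauchy_schwarz_ig zb ceta) _.
  by rewrite ler_wpM2r// lerB.
have bx1 u : `|EX D Q1 (z, u)| <= C by case: (HX u).
have by1 u : `|EY D Q1 (z, u)| <= C by case: (HY u).
have bx2 u : `|EX D Q2 (z, u)| <= C by case: (HX2 u).
have by2 u : `|EY D Q2 (z, u)| <= C by case: (HY2 u).
have kx1 j s u : `|KX D Q1 j (s, u)| <= C by case: (HX u) => _ k _ _ _; exact: k.
have ky1 j s u : `|KY D Q1 j (s, u)| <= C by case: (HY u) => _ k _ _ _; exact: k.
have kx2 j s u : `|KX D Q2 j (s, u)| <= C by case: (HX2 u) => _ k _ _ _; exact: k.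
have ky2 j s u : `|KY D Q2 j (s, u)| <= C by case: (HY2 u) => _ k _ _ _; exact: k.
have dx u : `|EX D Q2 (z, u) - EX D Q1 (z, u)| <= C * J1 by case: (HX u).
have dy u : `|EY D Q2 (z, u) - EY D Q1 (z, u)| <= C * J1 by case: (HY u).
have csum Q : continuous (fun u => EX D Q (z, u)) -> continuous (fun u => EY D Q (z, u)) ->
   continuous (fun u => EX D Q (z, u) ^+ 2 + EY D Q (z, u) ^+ 2).
  by move=> ? ?; apply: addfun_cont; exact: expfun_cont.
have cs1 := csum _ cX1 cY1; have cs2 := csum _ cX2 cY2.
have cprod Q j s : adm_of c rho D Q ->
   continuous (fun u => EX D Q (z, u) * KX D Q j (s, u) + EY D Q (z, u) * KY D Q j (s, u)).
  move=> aQ; apply: addfun_cont.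
    apply: mulfun_cont; last exact: (ckx Q j s aQ).
    exact: (@curry_right_cont R R X _ z (@EX_cont c M rho CL D c0 ok Q aQ)).
  apply: mulfun_cont; last exact: (cky Q j s aQ).
  exact: (@curry_right_cont R R X _ z (@EY_cont c M rho CL D c0 ok Q aQ)).
split.
- apply: (@le_trans _ _ (CL * (2 * C ^+ 2))); last by rewrite /T; lra.
  apply: (bd i _ _ cs1).
  move=> u; rewrite ger0_norm ?addr_ge0 ?sqr_ge0//.
  have h1 : EX D Q1 (z, u) ^+ 2 <= C ^+ 2 by rewrite -[leLHS]real_normK ?num_real// lerXn2r ?nnegrE.
  have h2 : EY D Q1 (z, u) ^+ 2 <= C ^+ 2 by rewrite -[leLHS]real_normK ?num_real// lerXn2r ?nnegrE.
  lra.
- move=> j s; rewrite /forward_kernel normrM ger0_norm//=.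
  apply: (@le_trans _ _ (2 * (CL * (2 * C ^+ 2)))); last by rewrite /T; lra.
  rewrite ler_pM2l//; apply: (bd i _ _ (cprod Q1 j s a1)).
  move=> u; apply: le_trans (ler_normD _ _) _; rewrite (normrM (EX D Q1 _)) (normrM (EY D Q1 _)).
  have h1 : `|EX D Q1 (z, u)| * `|KX D Q1 j (s, u)| <= C * C by apply: ler_pM.
  have h2 : `|EY D Q1 (z, u)| * `|KY D Q1 j (s, u)| <= C * C by apply: ler_pM.
  by rewrite expr2; lra.
- apply: (@le_trans _ _ (CL * (4 * C ^+ 2 * J1))); last first.
    by rewrite mulrA ler_wpM2r// /T; lra.
  rewrite /forward (L_sub Lok i cs2 cs1); apply: (bd i _ _ (subfun_cont cs2 cs1)).
  move=> u.
  rewrite (_ : _ - _ = (EX D Q2 (z, u) - EX D Q1 (z, u)) * (EX D Q2 (z, u) + EX D Q1 (z, u)) +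
     (EY D Q2 (z, u) - EY D Q1 (z, u)) * (EY D Q2 (z, u) + EY D Q1 (z, u))); last by ring.
  apply: le_trans (ler_normD _ _) _; rewrite (normrM (EX D Q2 _ - _)) (normrM (EY D Q2 _ - _)).
  have sx : `|EX D Q2 (z, u) + EX D Q1 (z, u)| <= 2 * C.
    by apply: le_trans (ler_normD _ _) _; rewrite mulr_natl mulr2n; apply: lerD.
  have sy : `|EY D Q2 (z, u) + EY D Q1 (z, u)| <= 2 * C.
    by apply: le_trans (ler_normD _ _) _; rewrite mulr_natl mulr2n; apply: lerD.
  have h1 : `|EX D Q2 (z, u) - EX D Q1 (z, u)| * `|EX D Q2 (z, u) + EX D Q1 (z, u)| <= (C * J1) * (2 * C).
    by apply: ler_pM.
  have h2 : `|EY D Q2 (z, u) - EY D Q1 (z, u)| * `|EY D Q2 (z, u) + EY D Q1 (z, u)| <= (C * J1) * (2 * C).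
    by apply: ler_pM.
  by rewrite expr2; lra.
- apply: (@le_trans _ _ (CL * ((4 * C ^+ 2 + 2 * C ^+ 2 * (b - a)) * J2))); last first.
    by rewrite mulrA ler_wpM2r// /T; lra.
  rewrite (@forward_derivative_eq c M rho CL D c0 ok Q1 i h z a1 ch).
  rewrite /forward (L_sub Lok i cs2 cs1).
  have cs (k : I -> R * X -> R) : (forall j, continuous (k j)) ->
     continuous (fun p : R * X => prim b (fun s => \sum_j h j s * k j (s, p.2)) p.1).
    move=> ck; apply: (@prim_joint_cont R X b (fun p => \sum_j h j p.1 * k j p)).
    apply: sumfun_cont => j; apply: mulfun_cont => //.
    by apply: (compfun_cont (ch j)); exact: fstfun_cont (@idfun_cont _).
  have cpx : continuous (fun u => prim b (fun s => \sum_j h j s * KX D Q1 j (s, u)) z).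
    exact: (@curry_right_cont R R X _ z (cs _ (fun j => @KX_cont c M rho CL D c0 ok Q1 j a1))).
  have cpy : continuous (fun u => prim b (fun s => \sum_j h j s * KY D Q1 j (s, u)) z).
    exact: (@curry_right_cont R R X _ z (cs _ (fun j => @KY_cont c M rho CL D c0 ok Q1 j a1))).
  have cdf : continuous (fun u => 2 * EX D Q1 (z, u) * prim b (fun s => \sum_j h j s * KX D Q1 j (s, u)) z +
    2 * EY D Q1 (z, u) * prim b (fun s => \sum_j h j s * KY D Q1 j (s, u)) z).
    by apply: addfun_cont; apply: mulfun_cont => //; apply: mulfun_cont => //; exact: cst_continuous.
  have cd := subfun_cont cs2 cs1.
  rewrite (L_sub Lok i cd cdf); apply: (bd i _ _ (subfun_cont cd cdf)).
  move=> u.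
  set px := prim b (fun s => \sum_j h j s * KX D Q1 j (s, u)) z.
  set py := prim b (fun s => \sum_j h j s * KY D Q1 j (s, u)) z.
  have tx : `|EX D Q2 (z, u) - EX D Q1 (z, u) - px| <= C * J2 by case: (HX u).
  have ty : `|EY D Q2 (z, u) - EY D Q1 (z, u) - py| <= C * J2 by case: (HY u).
  move: (bx1 u) (by1 u) (dx u) (dy u) tx ty.
  move: (EX D Q2 (z, u)) (EX D Q1 (z, u)) (EY D Q2 (z, u)) (EY D Q1 (z, u)) px py
    => x2 x1 y2 y1 px py bx by' dx' dy' tx ty.
  have sqd (t : R) : `|t| <= C * J1 -> t ^+ 2 <= C ^+ 2 * (b - a) * J2.
    move=> tb; rewrite -(real_normK (num_real t)).
    apply: (@le_trans _ _ ((C * J1) ^+ 2)); first by rewrite lerXn2r ?nnegrE// mulr_ge0.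
    by rewrite exprMn -mulrA ler_wpM2l// sqr_ge0.
  rewrite (_ : _ - _ = (2 * x1 * (x2 - x1 - px) + (x2 - x1) ^+ 2) +
    (2 * y1 * (y2 - y1 - py) + (y2 - y1) ^+ 2)); last by ring.
  have half (s1 s2 q : R) : `|s1| <= C -> `|s2 - s1| <= C * J1 -> `|s2 - s1 - q| <= C * J2 ->
     `|2 * s1 * (s2 - s1 - q) + (s2 - s1) ^+ 2| <= (2 * C ^+ 2 + C ^+ 2 * (b - a)) * J2.
    move=> k1 k2 k3; apply: le_trans (ler_normD _ _) _.
    have k4 : `|s1| * `|s2 - s1 - q| <= C * (C * J2) by apply: ler_pM.
    have k5 := sqd _ k2; have k6 := sqr_ge0 (s2 - s1).
    rewrite (ger0_norm k6) -mulrA (normrM 2) (normrM s1) (ger0_norm (ler0n R 2)).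
    by move: k4 k5; rewrite -[C ^+ 2 * (b - a) * J2]mulrA expr2; lra.
  apply: le_trans (ler_normD _ _) _.
  have e1 := half _ _ _ bx dx' tx; have e2 := half _ _ _ by' dy' ty.
  by apply: le_trans (lerD e1 e2) _; rewrite le_eqVlt; apply/orP; left; apply/eqP; ring.
- move=> delta hd j s.
  have dl0 : 0 <= delta by apply: le_trans (hd s); exact: l1norm_ge0.
  apply: (@le_trans _ _ (2 * (CL * ((2 * C ^+ 2 + 2 * C ^+ 2 * (b - a)) * delta)))); last first.
    by rewrite !mulrA ler_wpM2r// -!mulrA /T; move: n1' n2' n3'; lra.
  rewrite /forward_kernel -mulrBr normrM ger0_norm//= ler_pM2l// (L_sub Lok i (cprod Q2 j s a2) (cprod Q1 j s a1)).
  apply: (bd i _ _ (subfun_cont (cprod Q2 j s a2) (cprod Q1 j s a1))).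
  move=> u.
  have J1d : J1 <= delta * (b - a).
    apply: le_trans (ig_cst_bound zab dl0).
    by apply: ig_le => //; exact: cst_continuous.
  have hkx : `|KX D Q2 j (s, u) - KX D Q1 j (s, u)| <= C * delta.
    by case: (HX u) => _ _ _ _ /(_ j s) /le_trans; apply; exact: ler_wpM2l.
  have hky : `|KY D Q2 j (s, u) - KY D Q1 j (s, u)| <= C * delta.
    by case: (HY u) => _ _ _ _ /(_ j s) /le_trans; apply; exact: ler_wpM2l.
  have hex : `|EX D Q2 (z, u) - EX D Q1 (z, u)| <= C * (delta * (b - a)).
    by apply: le_trans (dx u) _; exact: ler_wpM2l.
  have hey : `|EY D Q2 (z, u) - EY D Q1 (z, u)| <= C * (delta * (b - a)).
    by apply: le_trans (dy u) _; exact: ler_wpM2l.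
  have half x1 x2 k1 k2 : `|x1| <= C -> `|k2| <= C -> `|x2 - x1| <= C * (delta * (b - a)) ->
      `|k2 - k1| <= C * delta -> `|x2 * k2 - x1 * k1| <= (C ^+ 2 + C ^+ 2 * (b - a)) * delta.
    move=> g1 g2 g3 g4; rewrite (_ : x2 * k2 - x1 * k1 = x1 * (k2 - k1) + (x2 - x1) * k2); last by ring.
    apply: le_trans (ler_normD _ _) _; rewrite (normrM x1) (normrM (x2 - x1)).
    have : `|x1| * `|k2 - k1| <= C * (C * delta) by apply: ler_pM.
    have : `|x2 - x1| * `|k2| <= C * (delta * (b - a)) * C by apply: ler_pM.
    by rewrite expr2; lra.
  have e1 := half _ _ _ _ (bx1 u) (kx2 j s u) hex hkx.
  have e2 := half _ _ _ _ (by1 u) (ky2 j s u) hey hky.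
  rewrite opprD addrACA; apply: le_trans (ler_normD _ _) _.
  by apply: le_trans (lerD e1 e2) _; rewrite le_eqVlt; apply/orP; left; apply/eqP; ring.
Qed.

End ForwardMap.

(** * Carleman-weighted residuals of Volterra operators *)

(** The Cauchy-Schwarz inequality for finite sums, by induction on the index list. *)
Lemma sum_sq_card (R : realType) (I : finType) (f : I -> R) :
  (\sum_i f i) ^+ 2 <= #|I|%:R * \sum_i f i ^+ 2.
Proof.
have h (s : seq I) : (\sum_(i <- s) f i) ^+ 2 <= (size s)%:R * \sum_(i <- s) f i ^+ 2.
  elim: s => [|i s IH]; first by rewrite !big_nil expr0n mulr0.
  rewrite !big_cons /= -natr1; set x := \sum_(_ <- s) _ in IH *; set y := \sum_(_ <- s) _ in IH *.
  have [s0|s0] := eqVneq (size s) 0%N.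
    by move: IH; rewrite s0 /x /y (size0nil s0) !big_nil; lra.
  have s1 : 0 < (size s)%:R :> R by rewrite ltr0n lt0n.
  have : 0 <= ((size s)%:R * f i - x) ^+ 2 / (size s)%:R by rewrite divr_ge0 ?sqr_ge0// ltW.
  rewrite (_ : _ / _ = (size s)%:R * f i ^+ 2 - 2 * f i * x + x ^+ 2 / (size s)%:R); last first.
    by field; rewrite gt_eqF.
  have : x ^+ 2 / (size s)%:R <= y by rewrite ler_pdivrMr// mulrC.
  by rewrite sqrrD; lra.
have := h (index_enum I); congr (_ <= _ * _).
congr (_%:R); rewrite cardT; apply: perm_size; apply: uniq_perm; [exact: index_enum_uniq|exact: enum_uniq|].
by move=> i; rewrite mem_index_enum mem_enum.
Qed.

Lemma lipschitz_arith (R : realType) (M k x c y u v : R) :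
  x <= M * (k * u) * (k * v) -> c * y <= c * (u * v) ->
  x + 2 * c * y <= (M * k * k + 2 * c) * u * v.
Proof. lra. Qed.

Lemma cancel_arith (R : realType) (M x y : R) : 0 <= M -> 0 <= x -> 0 <= y ->
  x * x <= M * y * x -> x <= (M + 1) * y.
Proof.
move=> M0 x0 y0; have [->|xn0] := eqVneq x 0; first by move=> _; rewrite mulr_ge0//; lra.
by rewrite ler_pM2r; [lra|rewrite lt_neqAle eq_sym xn0].
Qed.

Section WeightedResidual.
Context {R : realType} {I : finType}.
Variables (a b : R).
Hypothesis ab : a < b.
Variables (C rho lambda : R).
Hypotheses (C_ge0 : 0 <= C) (rho_ge0 : 0 <= rho) (lambda_gt0 : 0 < lambda).
Variables (admissible : (I -> R -> R) -> Prop) (F : (I -> R -> R) -> I -> R -> R)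
  (K : (I -> R -> R) -> I -> I -> R * R -> R) (cc : I -> R -> R).
Implicit Types (Q h k : I -> R -> R).

Local Notation volt := (@volterra R I b).

Hypothesis adm_cont : forall Q, admissible Q -> forall i, continuous (Q i).
Hypothesis adm_bound : forall Q, admissible Q -> forall i z, `|Q i z| <= rho.
Hypothesis F_cont : forall Q, admissible Q -> forall i, continuous (F Q i).
Hypothesis K_cont : forall Q, admissible Q -> forall i j, continuous (K Q i j).
Hypothesis cc_cont : forall i, continuous (cc i).
Hypothesis cc_bound : forall i z, a <= z <= b -> `|cc i z| <= C.
Hypothesis estimates : volterra_estimates a b C admissible F K.

Definition residual Q i z : R := Q i z - F Q i z - cc i z.

(** Normalization at a makes it at least 1 on the interval. *)
Definition weight (z : R) : R := expR (2 * lambda * (z - a)).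
Definition weighted_residual Q : R := \int[leb]_(z in `[a, b]) ((\sum_i residual Q i z ^+ 2) * weight z).
Definition residual_derivative Q h : R :=
  \int[leb]_(z in `[a, b]) (weight z * \sum_i 2 * residual Q i z * (h i z - volt (K Q) h i z)).

(** The i-th summand of the exact second-order remainder of the squared residual:
    the first term is quadratic, the second one the curvature of F. *)
Definition residual_remainder Q1 Q2 i z : R :=
  (residual Q2 i z - residual Q1 i z) ^+ 2
  - 2 * residual Q1 i z * (F Q2 i z - F Q1 i z - volt (K Q1) (fun j s => Q2 j s - Q1 j s) i z).

Let tau : R := rho + 2 * C.
Let tau_ge0 : 0 <= tau. Proof. by rewrite addr_ge0// mulr_ge0. Qed.
Let leab : a <= b := ltW ab.
Let ba_ge0 : 0 <= b - a. Proof. by rewrite subr_ge0. Qed.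

Lemma weight_cont : continuous weight.
Proof. exact: exp_affine_cont. Qed.

Lemma weight_ge1 z : a <= z <= b -> 1 <= weight z.
Proof.
move=> /andP[az zb]; rewrite -expR0 ler_expR mulr_ge0 ?subr_ge0// mulr_ge0// ltW//.
Qed.

Let W : R := expR (2 * lambda * (b - a)).

Lemma weight_le z : a <= z <= b -> weight z <= W.
Proof.
move=> /andP[az zb]; rewrite ler_expR ler_wpM2l// ?lerB//.
by rewrite mulr_ge0// ltW.
Qed.

Lemma volterra_cont kn h i : (forall i j, continuous (kn i j)) -> (forall j, continuous (h j)) ->
  continuous (volt kn h i).
Proof.
move=> ck ch.
have cf : continuous (fun p : R * R => \sum_j kn i j (p.2, p.1) * h j p.1).
  apply: sumfun_cont => j; apply: mulfun_cont.
    exact: (@swap_cont R R R _ (ck i j)).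
  by apply: (compfun_cont (ch j)); apply: fstfun_cont; exact: idfun_cont.
exact: (@diag_cont R R _ (@prim_joint_cont R R b _ cf)).
Qed.

Lemma residual_cont Q i : admissible Q -> continuous (residual Q i).
Proof.
move=> aQ; apply: subfun_cont; last exact: cc_cont.
by apply: subfun_cont; [exact: adm_cont|exact: F_cont].
Qed.

Lemma residual_bound Q i z : admissible Q -> a <= z <= b -> `|residual Q i z| <= tau.
Proof.
move=> aQ zab; have [f1 _ _ _ _] := estimates aQ aQ i zab.
have q1 := adm_bound aQ i z; have c1 := cc_bound i zab.
apply: le_trans (ler_normB _ _) _; apply: le_trans (lerD (ler_normB _ _) (lexx _)) _.
rewrite /tau; lra.
Qed.

Lemma volterra_bound kn h i z (M d : R) : a <= z <= b -> 0 <= M -> (forall i j, continuous (kn i j)) ->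
  (forall j, continuous (h j)) -> (forall j s, `|kn i j (z, s)| <= M) ->
  (forall s, l1norm h s <= d) -> `|volt kn h i z| <= M * d * (b - a).
Proof.
move=> zab M0 ck ch kM hd.
have cf : continuous (fun s => \sum_j kn i j (z, s) * h j s).
  apply: sumfun_cont => j; apply: mulfun_cont => //.
  exact: (@curry_right_cont R R R _ z (ck i j)).
have d0 : 0 <= d by apply: le_trans (hd 0); exact: l1norm_ge0.
have /andP[az zb] := zab.
apply: le_trans (ig_cst_bound zab (mulr_ge0 M0 d0)).
apply: prim_le_ig => //; first exact: cst_continuous.
move=> s; apply: le_trans (ler_norm_sum _ _ _) _.
apply: (@le_trans _ _ (M * l1norm h s)); last by rewrite ler_wpM2l.
rewrite /l1norm mulr_sumr; apply: ler_sum => j _; rewrite normrM ler_wpM2r//.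
Qed.

Lemma residual_derivative_cont Q h i : admissible Q -> (forall j, continuous (h j)) ->
  continuous (fun z => 2 * residual Q i z * (h i z - volt (K Q) h i z)).
Proof.
move=> aQ ch; apply: mulfun_cont.
  by apply: mulfun_cont; [exact: cst_continuous|exact: residual_cont].
by apply: subfun_cont => //; apply: volterra_cont => //; exact: K_cont.
Qed.

Lemma dif_cont Q1 Q2 : admissible Q1 -> admissible Q2 -> forall j, continuous (fun s => Q2 j s - Q1 j s).
Proof. by move=> a1 a2 j; apply: subfun_cont; exact: adm_cont. Qed.

Lemma residual_remainder_cont Q1 Q2 i : admissible Q1 -> admissible Q2 -> continuous (residual_remainder Q1 Q2 i).
Proof.
move=> a1 a2; apply: subfun_cont.
  by apply: expfun_cont; apply: subfun_cont; exact: residual_cont.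
apply: mulfun_cont.
  by apply: mulfun_cont; [exact: cst_continuous|exact: residual_cont].
apply: subfun_cont; first by apply: subfun_cont; exact: F_cont.
by apply: volterra_cont; [exact: K_cont|exact: dif_cont].
Qed.

Lemma weighted_residual_expand Q1 Q2 : admissible Q1 -> admissible Q2 ->
  weighted_residual Q2 - weighted_residual Q1 - residual_derivative Q1 (fun j s => Q2 j s - Q1 j s) =
  \int[leb]_(z in `[a, b]) (weight z * \sum_i residual_remainder Q1 Q2 i z).
Proof.
move=> a1 a2; have cw := weight_cont.
have cr Q : admissible Q -> continuous (fun z => (\sum_i residual Q i z ^+ 2) * weight z).
  move=> aQ; apply: mulfun_cont => //; apply: sumfun_cont => i; apply: expfun_cont.
  exact: residual_cont.
have clin : continuous (fun z => weight z * \sum_i 2 * residual Q1 i z *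
    (Q2 i z - Q1 i z - volt (K Q1) (fun j s => Q2 j s - Q1 j s) i z)).
  apply: mulfun_cont => //; apply: sumfun_cont => i.
  by apply: (@residual_derivative_cont Q1 (fun j s => Q2 j s - Q1 j s) i a1) => j; exact: (dif_cont a1 a2).
rewrite /weighted_residual /residual_derivative -igB; [|exact: cr|exact: cr].
rewrite -igB//; last by apply: subfun_cont; exact: cr.
apply: eq_ig => z _; rewrite -mulrBl mulrC -mulrBr -!sumrB; congr (_ * _).
by apply: eq_bigr => i _; rewrite /residual_remainder /residual; ring.
Qed.

Lemma l1norm_int (h : I -> R -> R) z (d : R) : a <= z <= b -> (forall j, continuous (h j)) ->
  (forall s, l1norm h s <= d) ->
  (\int[leb]_(s in `[z, b]) l1norm h s <= d * (b - a)) /\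
  (\int[leb]_(s in `[z, b]) l1norm h s ^+ 2 <= d ^+ 2 * (b - a)).
Proof.
move=> zab ch hd; have cn := l1norm_cont ch.
have d0 : 0 <= d by apply: le_trans (hd 0); exact: l1norm_ge0.
split.
  by apply: le_trans (ig_cst_bound zab d0); apply: ig_le => //; exact: cst_continuous.
apply: le_trans (ig_cst_bound zab (sqr_ge0 d)); apply: ig_le => //.
- exact: expfun_cont.
- exact: cst_continuous.
- by move=> s _; rewrite lerXn2r ?nnegrE// l1norm_ge0.
Qed.

Lemma residual_diff Q1 Q2 i z (d : R) : admissible Q1 -> admissible Q2 -> a <= z <= b ->
  (forall s, l1norm (fun j s => Q2 j s - Q1 j s) s <= d) ->
  `|residual Q2 i z - residual Q1 i z| <= (1 + C * (b - a)) * d.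
Proof.
move=> a1 a2 zab hd; have [_ _ dF _ _] := estimates a1 a2 i zab.
have [i1 _] := l1norm_int zab (dif_cont a1 a2) hd.
have h1 : `|Q2 i z - Q1 i z| <= d.
  apply: le_trans (hd z); rewrite /l1norm (bigD1 i)//= lerDl; exact: sumr_ge0.
have h2 : `|F Q2 i z - F Q1 i z| <= C * (d * (b - a)).
  by apply: le_trans dF _; exact: ler_wpM2l.
rewrite (_ : _ - _ = (Q2 i z - Q1 i z) - (F Q2 i z - F Q1 i z)); last by rewrite /residual; ring.
apply: le_trans (ler_normB _ _) _; lra.
Qed.

(** A quadratic bound in the sup norm, which gives Frechet differentiability. *)
Lemma weighted_residual_remainder : exists2 M : R, 0 <= M & forall Q1 Q2 (d : R), admissible Q1 -> admissible Q2 ->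
  (forall s, l1norm (fun j s => Q2 j s - Q1 j s) s <= d) ->
  `|weighted_residual Q2 - weighted_residual Q1 - residual_derivative Q1 (fun j s => Q2 j s - Q1 j s)| <= M * d ^+ 2.
Proof.
pose m := (1 + C * (b - a)) ^+ 2 + 2 * tau * (C * (b - a)).
have m0 : 0 <= m by rewrite addr_ge0 ?sqr_ge0// !mulr_ge0.
have W0 : 0 <= W by exact: expR_ge0.
exists (W * (#|I|%:R * m) * (b - a)); first by rewrite !mulr_ge0.
move=> Q1 Q2 d a1 a2 hd; rewrite weighted_residual_expand//.
have -> : W * (#|I|%:R * m) * (b - a) * d ^+ 2 = (W * (#|I|%:R * (m * d ^+ 2))) * (b - a) by ring.
apply: ig_bound => //.
  by apply: mulfun_cont; [exact: weight_cont|apply: sumfun_cont => i; exact: residual_remainder_cont].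
move=> z zab; rewrite normrM; apply: ler_pM => //.
  by rewrite ger0_norm ?weight_le ?expR_ge0.
apply: le_trans (ler_norm_sum _ _ _) _.
have -> : #|I|%:R * (m * d ^+ 2) = \sum_(i : I) m * d ^+ 2 by rewrite sumr_const mulr_natl.
apply: ler_sum => i _.
have h1 := residual_diff i a1 a2 zab hd.
have [_ _ _ tF _] := estimates a1 a2 i zab.
have [_ i2] := l1norm_int zab (dif_cont a1 a2) hd.
have h2 := le_trans tF (ler_wpM2l C_ge0 i2).
have h3 := residual_bound i a1 zab.
rewrite /residual_remainder; apply: le_trans (ler_normB _ _) _; rewrite ger0_norm ?sqr_ge0//.
have d0 : 0 <= d by apply: le_trans (hd 0); exact: l1norm_ge0.
have h4 : (residual Q2 i z - residual Q1 i z) ^+ 2 <= (1 + C * (b - a)) ^+ 2 * d ^+ 2.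
  rewrite -exprMn -(real_normK (num_real (residual Q2 i z - _))) lerXn2r ?nnegrE//.
  by rewrite mulr_ge0// addr_ge0// mulr_ge0.
rewrite (normrM (2 * _)) (normrM 2) (ger0_norm (ler0n R 2)).
have h5 : `|residual Q1 i z| * `|F Q2 i z - F Q1 i z - volt (K Q1) (fun j s => Q2 j s - Q1 j s) i z|
   <= tau * (C * (d ^+ 2 * (b - a))) by apply: ler_pM.
rewrite /m; lra.
Qed.

Lemma residual_derivative_lipschitz : exists2 M : R, 0 <= M & forall Q1 Q2 k (d e : R), admissible Q1 -> admissible Q2 ->
  (forall j, continuous (k j)) -> (forall s, l1norm (fun j s => Q2 j s - Q1 j s) s <= d) ->
  (forall s, l1norm k s <= e) ->
  `|residual_derivative Q2 k - residual_derivative Q1 k| <= M * d * e.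
Proof.
pose m := 2 * (1 + C * (b - a)) * (1 + C * (b - a)) + 2 * tau * (C * (b - a)).
have m0 : 0 <= m by rewrite addr_ge0// !mulr_ge0// ?addr_ge0// mulr_ge0.
have W0 : 0 <= W by exact: expR_ge0.
exists (W * (#|I|%:R * m) * (b - a)); first by rewrite !mulr_ge0.
move=> Q1 Q2 k d e a1 a2 ck hd he; rewrite /residual_derivative.
have cw := weight_cont.
have clin Q : admissible Q -> continuous (fun z => weight z * \sum_i 2 * residual Q i z * (k i z - volt (K Q) k i z)).
  by move=> aQ; apply: mulfun_cont => //; apply: sumfun_cont => i; exact: residual_derivative_cont.
rewrite -igB; [|exact: clin|exact: clin].
have -> : W * (#|I|%:R * m) * (b - a) * d * e = (W * (#|I|%:R * (m * (d * e)))) * (b - a) by ring.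
apply: ig_bound => //; first by apply: subfun_cont; exact: clin.
move=> z zab; rewrite -mulrBr normrM; apply: ler_pM => //.
  by rewrite ger0_norm ?weight_le ?expR_ge0.
rewrite -sumrB; apply: le_trans (ler_norm_sum _ _ _) _.
have -> : #|I|%:R * (m * (d * e)) = \sum_(i : I) m * (d * e) by rewrite sumr_const mulr_natl.
apply: ler_sum => i _.
have d0 : 0 <= d by apply: le_trans (hd 0); exact: l1norm_ge0.
have e0 : 0 <= e by apply: le_trans (he 0); exact: l1norm_ge0.
have h1 := residual_diff i a1 a2 zab hd.
have h3 := residual_bound i a1 zab.
have [_ k2 _ _ _] := estimates a2 a1 i zab.
have [_ _ _ _ /(_ _ hd) dk] := estimates a1 a2 i zab.
have kz : `|k i z| <= e by apply: le_trans (he z); rewrite /l1norm (bigD1 i)//= lerDl; exact: sumr_ge0.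
have v2 := volterra_bound zab C_ge0 (K_cont a2) ck k2 he.
have cdk i' j' : continuous (fun p => K Q2 i' j' p - K Q1 i' j' p).
  by apply: subfun_cont; exact: K_cont.
have dv : `|volt (K Q2) k i z - volt (K Q1) k i z| <= C * d * e * (b - a).
  have <- : volt (fun i j p => K Q2 i j p - K Q1 i j p) k i z = volt (K Q2) k i z - volt (K Q1) k i z.
    have ckk Q : admissible Q -> continuous (fun s => \sum_j K Q i j (z, s) * k j s).
      move=> aQ; apply: sumfun_cont => j; apply: mulfun_cont => //.
      exact: (@curry_right_cont R R R _ z (@K_cont Q aQ i j)).
    rewrite /volterra prim_sub; [|exact: ckk|exact: ckk]; congr prim; apply/funext => s.
    by rewrite -sumrB; apply: eq_bigr => j _; rewrite mulrBl.
  by apply: (volterra_bound zab _ cdk ck dk he); exact: mulr_ge0.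
rewrite (_ : _ - _ = 2 * ((residual Q2 i z - residual Q1 i z) * (k i z - volt (K Q2) k i z)) -
    2 * (residual Q1 i z * (volt (K Q2) k i z - volt (K Q1) k i z))); last by ring.
apply: le_trans (ler_normB _ _) _.
rewrite (normrM 2) (normrM 2) (ger0_norm (ler0n R 2)) (normrM (residual Q1 i z)) (normrM (residual Q2 i z - _)).
have g1 : `|residual Q2 i z - residual Q1 i z| * `|k i z - volt (K Q2) k i z| <=
   ((1 + C * (b - a)) * d) * ((1 + C * (b - a)) * e).
  apply: ler_pM => //; apply: le_trans (ler_normB _ _) _; lra.
have g2 : `|residual Q1 i z| * `|volt (K Q2) k i z - volt (K Q1) k i z| <= tau * (C * d * e * (b - a)).
  by apply: ler_pM.
rewrite /m; lra.
Qed.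

(** Exchanging the order of integration over the triangle z <= s transposes the
    Volterra operator, so that the derivative becomes an integral against h. *)
Lemma residual_derivative_density Q : admissible Q -> exists ro : I -> R -> R, (forall j, continuous (ro j)) /\
  forall h, (forall j, continuous (h j)) -> residual_derivative Q h = \sum_j bil a b (ro j) (h j).
Proof.
move=> aQ; have cw := weight_cont.
pose g j (p : R * R) := \sum_i weight p.1 * (2 * residual Q i p.1) * K Q i j p.
have cg j : continuous (g j).
  apply: sumfun_cont => i; apply: mulfun_cont; last exact: K_cont.
  apply: mulfun_cont; first by apply: (compfun_cont cw); exact: fstfun_cont (@idfun_cont _).
  apply: mulfun_cont; first exact: cst_continuous.
  by apply: (compfun_cont (@residual_cont Q i aQ)); exact: fstfun_cont (@idfun_cont _).
have cg1 j z : continuous (fun s => g j (z, s)) by exact: (@curry_right_cont R R R _ z (cg j)).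
have cg2 j s : continuous (fun z => g j (z, s)) by exact: (@curry_right_cont R R R _ s (@swap_cont R R R _ (cg j))).
(* the transposed operator applied to the weighted residual *)
pose l2 j s := prim a (fun z => g j (z, s)) s.
have cl2 j : continuous (l2 j).
  exact: (@diag_cont R R _ (@prim_joint_cont R R a _ (cg j))).
have cl1 j : continuous (fun z => weight z * (2 * residual Q j z)).
  by apply: mulfun_cont => //; apply: mulfun_cont; [exact: cst_continuous|exact: residual_cont].
exists (fun j s => weight s * (2 * residual Q j s) + l2 j s); split.
  by move=> j; exact: addfun_cont.
move=> h ch.
have cA : continuous (fun z => \sum_j weight z * (2 * residual Q j z) * h j z).
  by apply: sumfun_cont => j; exact: mulfun_cont.
have cp : continuous (fun p : R * R => \sum_j g j p * h j p.2).
  apply: sumfun_cont => j; apply: mulfun_cont => //.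
  by apply: (compfun_cont (ch j)); exact: sndfun_cont (@idfun_cont _).
have cB : continuous (fun z => prim b (fun s => \sum_j g j (z, s) * h j s) z).
  exact: (@diag_cont R R _ (@prim_joint_cont R R b _ (@swap_cont R R R _ cp))).
transitivity (\int[leb]_(z in `[a, b]) ((\sum_j weight z * (2 * residual Q j z) * h j z)
     - prim b (fun s => \sum_j g j (z, s) * h j s) z)).
  apply: eq_ig => z zab; have /andP[az zb] := zab.
  have ckz i j : continuous (fun s => K Q i j (z, s)).
    exact: (@curry_right_cont R R R _ z (@K_cont Q aQ i j)).
  have -> : prim b (fun s => \sum_j g j (z, s) * h j s) z =
      \sum_i weight z * (2 * residual Q i z) * volt (K Q) h i z.
    rewrite /volterra primNE//.
    have -> : \sum_i weight z * (2 * residual Q i z) * prim b (fun s => \sum_j K Q i j (z, s) * h j s) z =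
       \sum_i - \int[leb]_(s in `[z, b]) (weight z * (2 * residual Q i z) * \sum_j K Q i j (z, s) * h j s).
      apply: eq_bigr => i _; rewrite primNE// igZ ?mulrN//.
      by apply: sumfun_cont => j; exact: mulfun_cont.
    rewrite sumrN -ig_sum; last first.
      move=> i; apply: mulfun_cont; first exact: cst_continuous.
      by apply: sumfun_cont => j; exact: mulfun_cont.
    congr (- _); apply: eq_ig => s _.
    under [RHS]eq_bigr do rewrite mulr_sumr.
    rewrite exchange_big/=; apply: eq_bigr => j _; rewrite mulr_suml.
    by apply: eq_bigr => i _; ring.
  rewrite mulr_sumr -sumrB; apply: eq_bigr => i _; ring.
rewrite igB//.
have -> : \int[leb]_(z in `[a, b]) prim b (fun s => \sum_j g j (z, s) * h j s) z =
   - \int[leb]_(s in `[a, b]) \sum_j l2 j s * h j s.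
  transitivity (- \int[leb]_(z in `[a, b]) \int[leb]_(s in `[z, b]) (\sum_j g j (z, s) * h j s)).
    rewrite -[LHS]opprK -igN//; congr (- _).
    by apply: eq_ig => z /andP[az zb]; rewrite primNE// opprK.
  congr (- _); rewrite (fubini_triangle a b cp); apply: eq_ig => s /andP[az zb].
  rewrite (@ig_sum R I a s (fun j z => g j (z, s) * h j s)); last first.
    by move=> j; apply: mulfun_cont => //; exact: cstfun_cont.
  apply: eq_bigr => j _; rewrite /l2 primE// -[RHS]mulrC -igZ//.
  by apply: eq_ig => z _; rewrite mulrC.
rewrite opprK -igD//; last by apply: sumfun_cont => j; exact: mulfun_cont.
under [RHS]eq_bigr do rewrite bilE.
rewrite -ig_sum; last by move=> j; apply: mulfun_cont => //; exact: addfun_cont.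
by apply: eq_ig => z _; rewrite -[LHS]big_split/=; apply: eq_bigr => j _; rewrite [RHS]mulrDl.
Qed.

(** The factor of the tail integrals of |h|^2, which lambda has to dominate. *)
Definition volterra_gap : R := #|I|%:R ^+ 2 * (C ^+ 2 * (b - a) + 2 * tau * C).

Lemma volterra_gap_ge0 : 0 <= volterra_gap.
Proof. by rewrite mulr_ge0 ?sqr_ge0// addr_ge0// mulr_ge0// ?sqr_ge0// mulr_ge0. Qed.

(** (x - y)^2 >= x^2 / 2 - y^2 with x = h and y the increment of F; by Cauchy-Schwarz
    y^2 is at most a tail integral of eta^2, and so is the curvature term. *)
Lemma residual_remainder_lower Q1 Q2 i z : let h := fun j s => Q2 j s - Q1 j s in
  admissible Q1 -> admissible Q2 -> a <= z <= b ->
  h i z ^+ 2 / 2 - (C ^+ 2 * (b - a) + 2 * tau * C) * \int[leb]_(s in `[z, b]) l1norm h s ^+ 2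
    <= residual_remainder Q1 Q2 i z.
Proof.
move=> h a1 a2 zab; have /andP[az zb] := zab.
have [_ _ dF tF _] := estimates a1 a2 i zab.
have cn : continuous (l1norm h) by apply: l1norm_cont; exact: dif_cont.
have CS := cauchy_schwarz_ig zb cn.
rewrite -/h in dF tF.
set S2 := \int[leb]_(s in `[z, b]) l1norm h s ^+ 2 in tF CS *.
set S1 := \int[leb]_(s in `[z, b]) l1norm h s in dF CS.
have S10 : 0 <= S1 by apply: ig_ge0 => s _; exact: l1norm_ge0.
have S20 : 0 <= S2 by apply: ig_ge0 => s _; exact: sqr_ge0.
rewrite /residual_remainder -/h.
have -> : residual Q2 i z - residual Q1 i z = h i z - (F Q2 i z - F Q1 i z) by rewrite /residual /h; ring.
set dl := F Q2 i z - F Q1 i z in dF tF *; set t := dl - _ in tF *.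
have h3 := residual_bound i a1 zab.
have h5 : `|residual Q1 i z * t| <= tau * (C * S2) by rewrite normrM; apply: ler_pM.
have h6 := le_trans (ler_norm _) h5.
have h7 : dl ^+ 2 <= C ^+ 2 * ((b - a) * S2).
  rewrite -(real_normK (num_real dl)); apply: (@le_trans _ _ ((C * S1) ^+ 2)).
    by rewrite lerXn2r ?nnegrE// mulr_ge0.
  rewrite exprMn ler_wpM2l ?sqr_ge0//; apply: le_trans CS _.
  by rewrite ler_wpM2r// lerB.
have := sqr_ge0 (h i z - 2 * dl).
rewrite (_ : (h i z - 2 * dl) ^+ 2 = 2 * (h i z - dl) ^+ 2 - h i z ^+ 2 + 2 * dl ^+ 2); last by ring.
lra.
Qed.

(** By the Carleman inequality the tail integrals, summed over i, take at most a
    quarter of the squared weighted norm of h once lambda exceeds the gap.  A quarter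
    remains, and the weight is at least 1. *)
Lemma weighted_residual_convex Q1 Q2 : let h := fun j s => Q2 j s - Q1 j s in
  2 + 2 * volterra_gap <= lambda -> admissible Q1 -> admissible Q2 ->
  1 / 8 * (\int[leb]_(z in `[a, b]) \sum_i h i z ^+ 2) <= weighted_residual Q2 - weighted_residual Q1 - residual_derivative Q1 h.
Proof.
move=> h lam a1 a2; rewrite weighted_residual_expand//.
have cw := weight_cont; have ch := dif_cont a1 a2; rewrite -/h in ch.
pose S z := \sum_i h i z ^+ 2.
have cS : continuous S by apply: sumfun_cont => i; apply: expfun_cont; exact: ch.
have S0 z : 0 <= S z by apply: sumr_ge0 => i _; exact: sqr_ge0.
have cn := l1norm_cont ch.
pose n : R := #|I|%:R; have n0 : 0 <= n by exact: ler0n.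
have nS z : l1norm h z ^+ 2 <= n * S z.
  have := @sum_sq_card R I (fun i => `|h i z|).
  rewrite /n /S /l1norm; congr (_ <= _ * _).
  by apply: eq_bigr => i _; rewrite real_normK// num_real.
pose G := C ^+ 2 * (b - a) + 2 * tau * C.
have G0 : 0 <= G by rewrite addr_ge0// mulr_ge0// ?sqr_ge0// mulr_ge0.
pose f z := n * (G * (n * S z)).
have cf : continuous f.
  by do 3 (apply: mulfun_cont; first exact: cst_continuous).
have f0 z : 0 <= f z by rewrite !mulr_ge0.
have cv := @carleman_volterra R a b lambda f leab lambda_gt0 cf (fun z _ => f0 z).
have cp : continuous (prim b f) by exact: prim_cont.
have low : \int[leb]_(z in `[a, b]) (1 / 2 * (weight z * S z) - weight z * (- prim b f z)) <=
   \int[leb]_(z in `[a, b]) (weight z * \sum_i residual_remainder Q1 Q2 i z).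
  apply: ig_le.
  - apply: subfun_cont; first by apply: mulfun_cont; [exact: cst_continuous|exact: mulfun_cont].
    by apply: mulfun_cont => //; exact: oppfun_cont.
  - by apply: mulfun_cont => //; apply: sumfun_cont => i; exact: residual_remainder_cont.
  move=> z zab; have /andP[az zb] := zab.
  rewrite mulrCA -mulrBr ler_wpM2l ?expR_ge0//.
  have cnS : continuous (fun s => n * S s) by apply: mulfun_cont; [exact: cst_continuous|].
  have e1 : - prim b f z = n * (G * \int[leb]_(s in `[z, b]) (n * S s)).
    by rewrite primNE// opprK /f -!igZ//; apply: mulfun_cont => //; exact: cst_continuous.
  have e2 : \int[leb]_(s in `[z, b]) l1norm h s ^+ 2 <= \int[leb]_(s in `[z, b]) (n * S s).
    by apply: ig_le => //; exact: expfun_cont.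
  apply: (@le_trans _ _ (\sum_i (h i z ^+ 2 / 2 - G * \int[leb]_(s in `[z, b]) l1norm h s ^+ 2))).
    rewrite sumrB sumr_const -mulr_suml -/(S z) e1 mulrC mul1r lerB//.
    have -> : #|xpredT : pred I| = #|I| by apply: eq_card.
    by rewrite -mulr_natl ler_wpM2l// ler_wpM2l.
  by apply: ler_sum => i _; exact: residual_remainder_lower.
apply: le_trans low.
have cwS : continuous (fun z => weight z * S z) by exact: mulfun_cont.
rewrite igB; last 2 first.
- by apply: mulfun_cont => //; exact: cst_continuous.
- by apply: mulfun_cont => //; exact: oppfun_cont.
rewrite igZ//.
set Iw := \int[leb]_(z in `[a, b]) (weight z * S z).
have Iw1 : \int[leb]_(z in `[a, b]) S z <= Iw.
  by apply: ig_le => // z zab; rewrite -[leLHS]mul1r ler_wpM2r// weight_ge1.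
have Iw0 : 0 <= Iw by apply: ig_ge0 => z _; rewrite mulr_ge0// expR_ge0.
have e3 : \int[leb]_(z in `[a, b]) (expR (2 * lambda * (z - a)) * f z) = volterra_gap * Iw.
  rewrite -igZ//; apply: eq_ig => z _; rewrite /f /volterra_gap -/n -/G /weight; ring.
rewrite e3 in cv.
have g1 : (2 * lambda)^-1 * (volterra_gap * Iw) <= 1 / 4 * Iw.
  rewrite mulrA ler_wpM2r// mulrC ler_pdivrMr; last by rewrite mulr_gt0.
  lra.
rewrite -/(S _); move: cv g1 Iw1; rewrite -/(weight _); lra.
Qed.

Local Notation H10 := (@H10 R a b I).
Local Notation dot1 := (@dot1 R a b I).
Local Notation nrm1 := (@nrm1 R a b I).

(** It extends a function from [a, b], where alone its values matter, to a
    continuous function on the line. *)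
Definition clampz Q : I -> R -> R := fun i z => Q i (clamp a b z).

Let kap : R := #|I|%:R * Num.sqrt (b - a).
Let kap_ge0 : 0 <= kap. Proof. by rewrite mulr_ge0// sqrtr_ge0. Qed.

Lemma clampz_sup h i z : H10 h -> `|clampz h i z| <= Num.sqrt (b - a) * nrm1 h.
Proof. by move=> hh; exact: (@H10_sup R a b I ab h i _ hh (@clamp_in R a b z leab)). Qed.

Lemma clampz_l1norm h z : H10 h -> l1norm (clampz h) z <= kap * nrm1 h.
Proof.
move=> hh; have -> : kap * nrm1 h = \sum_(i : I) Num.sqrt (b - a) * nrm1 h.
  by rewrite sumr_const -mulr_natl /kap mulrA.
by apply: ler_sum => i _; exact: clampz_sup.
Qed.

Lemma clampzB Q1 Q2 : clampz (Q2 - Q1) = fun j s => clampz Q2 j s - clampz Q1 j s.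
Proof. by []. Qed.

Variables (alpha : R) (Jf : (I -> R -> R) -> R).
Hypothesis Jf_eq : forall Q, H10 Q -> admissible (clampz Q) -> Jf Q = weighted_residual (clampz Q) + alpha * nrm1 Q ^+ 2.

Definition is_grad Q g : Prop := H10 g /\
  forall h, H10 h -> dot1 g h = residual_derivative (clampz Q) (clampz h) + 2 * alpha * dot1 Q h.

Lemma is_grad_exists Q : H10 Q -> admissible (clampz Q) -> exists g, is_grad Q g.
Proof.
move=> hQ aQ; have [ro [cro hro]] := residual_derivative_density aQ.
have [g0 [hg0 dg0]] := riesz_vector ab cro.
exists (fun i z => g0 i z + 2 * alpha * Q i z); split; first exact: H10_lin.
move=> h hh; rewrite dot1_lin// dg0// hro//.
by move=> j; exact: (@H10_cont _ _ _ _ ab h j hh).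
Qed.

Lemma nrm1_sqrD Q h : H10 Q -> H10 h ->
  nrm1 (Q + h) ^+ 2 = nrm1 Q ^+ 2 + 2 * dot1 Q h + nrm1 h ^+ 2.
Proof.
move=> hQ hh; rewrite (@nrm1_sqr R a b I (Q + h)) (@nrm1_sqr R a b I Q) (@nrm1_sqr R a b I h).
have -> : Q + h = (fun i z => Q i z + 1 * h i z).
  by apply/funext => i; apply/funext => z; rewrite mul1r.
by rewrite dot1_expand// expr1n mul1r mulr1.
Qed.

(** It suffices that a whole H^1 neighbourhood of Q is admissible. *)
Lemma is_grad_frechet Q g (r0 : R) : H10 Q -> admissible (clampz Q) -> is_grad Q g -> 0 < r0 ->
  (forall h, H10 h -> nrm1 h < r0 -> admissible (clampz (Q + h))) -> frechet_grad a b Jf Q g.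
Proof.
move=> hQ hQ0 [hg dg] r00 near; split=> // eps eps0.
have [M M0 HM] := weighted_residual_remainder.
have Mk : 0 <= M * kap ^+ 2 + `|alpha| by rewrite addr_ge0// mulr_ge0// sqr_ge0.
have Mk1 : 0 < M * kap ^+ 2 + `|alpha| + 1 by lra.
exists (Num.min r0 (eps / (M * kap ^+ 2 + `|alpha| + 1))).
  by rewrite lt_min r00 divr_gt0.
move=> h hh; rewrite -[normH1 a b h]/(normH1 a b h).
have -> : normH1 a b h = nrm1 h by rewrite nrm1.unlock.
have -> : dotH1 a b g h = dot1 g h by rewrite dot1.unlock.
rewrite lt_min => /andP[h0 he].
have aQh := near _ hh h0.
rewrite (Jf_eq hQ hQ0) (Jf_eq (H10_add ab hQ hh) aQh) dg// nrm1_sqrD//.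
have e1 : (fun j s => clampz (Q + h) j s - clampz Q j s) = clampz h.
  by apply/funext => j; apply/funext => s; rewrite /clampz /= addrC addKr.
have := HM (clampz Q) (clampz (Q + h)) (kap * nrm1 h) hQ0 aQh; rewrite e1 => /(_ (fun s => clampz_l1norm s hh)) h1.
rewrite (_ : _ - _ = weighted_residual (clampz (Q + h)) - weighted_residual (clampz Q) - residual_derivative (clampz Q) (clampz h) + alpha * nrm1 h ^+ 2); last by ring.
apply: le_trans (ler_normD _ _) _.
have n0 : 0 <= nrm1 h by exact: nrm1_ge0.
rewrite (normrM alpha) (ger0_norm (sqr_ge0 (nrm1 h))).
apply: (@le_trans _ _ ((M * kap ^+ 2 + `|alpha|) * nrm1 h * nrm1 h)).
  by move: h1; rewrite exprMn expr2; lra.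
rewrite ler_wpM2r//.
apply: (@le_trans _ _ ((M * kap ^+ 2 + `|alpha| + 1) * nrm1 h)); first by rewrite ler_wpM2r//; lra.
by rewrite mulrC -ler_pdivlMr// ltW.
Qed.

(** The difference of the gradients is tested with itself. *)
Lemma is_grad_lipschitz : exists2 M : R, 0 < M & forall Q1 Q2 g1 g2,
  H10 Q1 -> H10 Q2 -> admissible (clampz Q1) -> admissible (clampz Q2) -> is_grad Q1 g1 -> is_grad Q2 g2 ->
  nrm1 (g2 - g1) <= M * nrm1 (Q2 - Q1).
Proof.
have [M M0 HM] := residual_derivative_lipschitz.
have Mk : 0 <= M * kap * kap + 2 * `|alpha| by rewrite addr_ge0// !mulr_ge0.
exists (M * kap * kap + 2 * `|alpha| + 1); first by lra.
move=> Q1 Q2 g1 g2 h1 h2 a1 a2 [hg1 d1] [hg2 d2].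
have hk : H10 (g2 - g1) by exact: H10_sub.
have hq : H10 (Q2 - Q1) by exact: H10_sub.
set k := g2 - g1 in hk *; have k0 : 0 <= nrm1 k by exact: nrm1_ge0.
have q0 : 0 <= nrm1 (Q2 - Q1) by exact: nrm1_ge0.
have hL := HM _ _ (clampz k) _ _ a1 a2 (fun j => @H10_cont _ _ _ _ ab k j hk)
  (fun s => clampz_l1norm s hq) (fun s => clampz_l1norm s hk).
have hD := dot1_cauchy_schwarz ab hq hk.
have e : nrm1 k ^+ 2 = residual_derivative (clampz Q2) (clampz k) - residual_derivative (clampz Q1) (clampz k) + 2 * alpha * dot1 (Q2 - Q1) k.
  have dk : dot1 k k = dot1 g2 k - dot1 g1 k by exact: dot1_subl.
  have dq : dot1 (Q2 - Q1) k = dot1 Q2 k - dot1 Q1 k by exact: dot1_subl.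
  rewrite nrm1_sqr dk dq (d1 _ hk) (d2 _ hk).
  move: (residual_derivative _ _) (residual_derivative _ _) (dot1 _ _) (dot1 _ _) => u1 u2 u3 u4; ring.
have : nrm1 k * nrm1 k <= ((M * kap * kap + 2 * `|alpha|) * nrm1 (Q2 - Q1)) * nrm1 k.
  rewrite -expr2 e; apply: le_trans (ler_norm _) _; apply: le_trans (ler_normD _ _) _.
  have : `|alpha| * `|dot1 (Q2 - Q1) k| <= `|alpha| * (nrm1 (Q2 - Q1) * nrm1 k) by rewrite ler_wpM2l.
  rewrite (normrM (2 * alpha)) (normrM 2) (ger0_norm (ler0n R 2)).
  exact: lipschitz_arith hL.
exact: cancel_arith.
Qed.

Lemma normL2_cl Q : H10 Q -> normL2 a b Q ^+ 2 = \int[leb]_(z in `[a, b]) \sum_i clampz Q i z ^+ 2.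
Proof.
move=> hQ; have cQ i : continuous (clampz Q i) by exact: (@H10_cont _ _ _ _ ab Q i hQ).
rewrite (@ig_sum R I a b (fun i z => clampz Q i z ^+ 2)); last by move=> i; exact: expfun_cont.
have -> : \sum_i \int[leb]_(z in `[a, b]) clampz Q i z ^+ 2 = dotL2 a b Q Q.
  apply: eq_bigr => i _; have pQ := H10_primitive ab i hQ.
  rewrite (primitive_dot ab pQ pQ); apply: eq_ig => z zab.
  by rewrite /clampz clamp_id// expr2.
rewrite /normL2 sqr_sqrtr//.
by apply: sumr_ge0 => i _; apply: Rintegral_ge0 => z _; rewrite -expr2 sqr_ge0.
Qed.

(** The Tikhonov term is quadratic and contributes its square exactly. *)
Lemma is_grad_convex Q1 Q2 g1 : 2 + 2 * volterra_gap <= lambda ->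
  H10 Q1 -> H10 Q2 -> admissible (clampz Q1) -> admissible (clampz Q2) -> is_grad Q1 g1 ->
  1 / 8 * normL2 a b (Q2 - Q1) ^+ 2 + alpha * nrm1 (Q2 - Q1) ^+ 2 <=
  Jf Q2 - Jf Q1 - dot1 g1 (Q2 - Q1).
Proof.
move=> lam h1 h2 a1 a2 [hg1 d1].
have hq : H10 (Q2 - Q1) by exact: H10_sub.
rewrite (Jf_eq h1 a1) (Jf_eq h2 a2) d1// normL2_cl//.
have := weighted_residual_convex lam a1 a2; rewrite /= -clampzB => hJ.
have e : nrm1 Q2 ^+ 2 = nrm1 Q1 ^+ 2 + 2 * dot1 Q1 (Q2 - Q1) + nrm1 (Q2 - Q1) ^+ 2.
  by rewrite -nrm1_sqrD// addrC subrK.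
rewrite e; apply: le_trans (lerD hJ (lexx _)) _.
by rewrite le_eqVlt; apply/orP; left; apply/eqP; ring.
Qed.

End WeightedResidual.

(** * Background field, basis functions and clamped data *)

Section Calculus.
Context {R : realType}.

Lemma supnorm_ub (T : topologicalType) (D : set T) (f : T -> R) u :
  compact D -> {within D, continuous f} -> D u -> `|f u| <= supnorm D f.
Proof.
move=> cD cf Du; have [C C0 HC] := compact_bound cD cf.
apply: ub_le_sup; last by exists u.
by exists C => _ [x Dx <-]; exact: HC.
Qed.

Lemma supnorm_ge0 (T : Type) (D : set T) (f : T -> R) : 0 <= supnorm D f.
Proof.
rewrite /supnorm; set S := [set _ | _ in _].
have [hs|/sup_out ->//] := pselect (has_sup S).
have [[s Ss] ubS] := hs; apply: le_trans (ub_le_sup ubS Ss).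
by case: Ss => x _ <-.
Qed.

Lemma der_sum (I : finType) (f : I -> R -> R) (f' : I -> R) (x : R) :
  (forall i, is_derive x (1 : R) (f i) (f' i)) ->
  is_derive x (1 : R) (fun t => \sum_i f i t) (\sum_i f' i).
Proof.
move=> df; elim: (index_enum I) => [|i s IH].
  by under eq_fun do rewrite big_nil; rewrite big_nil; exact: der_cst.
by under eq_fun do rewrite big_cons; rewrite big_cons; exact: (@der_add R (f i) (fun t => \sum_(j <- s) f j t)).
Qed.

Lemma der_sin (c x : R) : is_derive x (1 : R) (fun t => sin (c * t)) (c * cos (c * x)).
Proof.
have h := @der_scale R id 1 c x (is_derive_id x 1).
have := @is_derive1_comp R sin _ x _ _ (is_derive_sin (c * x)) h.
by rewrite mulr1 [X in is_derive _ _ _ X]mulrC.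
Qed.

(** As a function of x alone, or of y alone, v0 has this form, with e collecting the
    other terms. *)
Lemma der_v0_profile (k e s t : R) : 0 < e ->
  is_derive t (1 : R) (fun t => k / ((t - s) ^+ 2 + e)) (- (2 * k * (t - s)) / ((t - s) ^+ 2 + e) ^+ 2).
Proof.
move=> e0; have p0 x : 0 < (x - s) ^+ 2 + e by rewrite ltr_wpDl// sqr_ge0.
have d1 := is_derive_affine s 1 t.
have d2 := @der_add R _ _ _ _ t (@der_mul R _ _ _ _ t d1 d1) (der_cst e t).
have d2' : is_derive t (1 : R) (fun t => (t - s) ^+ 2 + e) (2 * (t - s)).
  have -> : (fun t => (t - s) ^+ 2 + e) = (fun z => 1 * (z - s) * (1 * (z - s)) + e).
    by apply/funext => z; rewrite !mul1r expr2.
  by move/is_derive_eq : d2; apply; ring.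
have := @der_scale R _ _ k t (@is_deriveV R _ t _ 1 (lt0r_neq0 (p0 t)) d2').
move/is_derive_eq; apply; rewrite /GRing.scale/=; field.
by rewrite gt_eqF.
Qed.

Lemma der_v0_profile_bound (k e m L s t : R) : 0 < m -> m <= e -> 0 <= k -> `|t - s| <= L ->
  `|- (2 * k * (t - s)) / ((t - s) ^+ 2 + e) ^+ 2| <= 2 * k * L / m ^+ 2.
Proof.
move=> m0 me k0 tL.
have p0 : m <= (t - s) ^+ 2 + e by rewrite ler_wpDl// sqr_ge0.
have p1 : 0 < (t - s) ^+ 2 + e by exact: lt_le_trans p0.
have L0 : 0 <= L by apply: le_trans tL.
rewrite (normrM (- _)) normrN (normrM (2 * k)) [`|2 * k|]ger0_norm ?mulr_ge0//.
have i0 : 0 <= (((t - s) ^+ 2 + e) ^+ 2)^-1 by rewrite invr_ge0 sqr_ge0.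
rewrite [`|_^-1|](ger0_norm i0); apply: ler_pM => //.
- by rewrite !mulr_ge0.
- by apply: ler_wpM2l => //; exact: mulr_ge0.
- by rewrite lef_pV2 ?posrE ?exprn_gt0// lerXn2r ?nnegrE// (ltW m0, ltW p1).
Qed.

End Calculus.

Section Data.
Context {R : realType}.
Variables (B1 B2 : R) (N K : nat).
Hypotheses (B1_gt0 : 0 < B1) (B12 : B1 < B2).
Local Notation X := (R * R * R)%type.
Local Notation I := (idx N K).
Local Notation Pi := (@pi R).
Local Notation sinK := Defs.sinK.

Let cp : R -> R := clamp 0 pi.
Let cz : R -> R := clamp B1 B2.

Let cpP t : 0 <= cp t <= pi. Proof. by apply: clamp_in; exact: pi_ge0. Qed.
Let czP t : B1 <= cz t <= B2. Proof. by apply: clamp_in; exact: ltW. Qed.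
Let cp_cont : continuous cp. Proof. exact: clamp_cont. Qed.
Let cz_cont : continuous cz. Proof. exact: clamp_cont. Qed.

Definition lift3 (f : R -> R -> R -> R) (u : X) : R := f (cp u.1.1) (cp u.1.2) (cp u.2).
Definition lift4 (f : R -> R -> R -> R -> R) (p : R * X) : R :=
  f (cp p.2.1.1) (cp p.2.1.2) (cz p.1) (cp p.2.2).

Lemma lift3_cont f : {within box3 Ipi Ipi Ipi, continuous (unc3 f)} -> continuous (lift3 f).
Proof.
pose r (u : X) : X := (cp u.1.1, cp u.1.2, cp u.2).
move=> cf; change (continuous (fun u => unc3 f (r u))).
apply: (within_comp_cont (D := box3 Ipi Ipi Ipi)) => //.
  apply: pairfun_cont; [apply: pairfun_cont|]; apply: (compfun_cont cp_cont).
  - by do 2 apply: fstfun_cont; exact: idfun_cont.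
  - by apply: sndfun_cont; apply: fstfun_cont; exact: idfun_cont.
  - by apply: sndfun_cont; exact: idfun_cont.
by move=> u; split; [split|]; rewrite /Ipi/= in_itv/=; exact: cpP.
Qed.

Lemma lift4_cont f : {within box4 Ipi Ipi (Iz B1 B2) Ipi, continuous (unc4 f)} -> continuous (lift4 f).
Proof.
pose r (p : R * X) : R * R * R * R := (cp p.2.1.1, cp p.2.1.2, cz p.1, cp p.2.2).
move=> cf; change (continuous (fun p => unc4 f (r p))).
apply: (within_comp_cont (D := box4 Ipi Ipi (Iz B1 B2) Ipi)) => //.
  apply: pairfun_cont; [apply: pairfun_cont; [apply: pairfun_cont|]|].
  - apply: (compfun_cont cp_cont); do 2 apply: fstfun_cont; apply: sndfun_cont; exact: idfun_cont.
  - apply: (compfun_cont cp_cont); apply: sndfun_cont; apply: fstfun_cont; apply: sndfun_cont; exact: idfun_cont.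
  - apply: (compfun_cont cz_cont); apply: fstfun_cont; exact: idfun_cont.
  - apply: (compfun_cont cp_cont); do 2 apply: sndfun_cont; exact: idfun_cont.
move=> p; split; [split; [split|]|]; rewrite /= ?/Ipi ?/Iz/= in_itv/=; by [exact: cpP|exact: czP].
Qed.

Definition v0x (x y a : R) : R :=
  - (2 * B1 ^+ 2 * (x - a)) / ((x - a) ^+ 2 + ((y - pi / 2) ^+ 2 + B1 ^+ 2)) ^+ 2.
Definition v0y (x y a : R) : R :=
  - (2 * B1 ^+ 2 * (y - pi / 2)) / ((y - pi / 2) ^+ 2 + ((x - a) ^+ 2 + B1 ^+ 2)) ^+ 2.

Let sB1 : 0 < B1 ^+ 2. Proof. exact: exprn_gt0. Qed.

Lemma v0_dx x y a : is_derive x (1 : R) (fun t => v0 B1 t y a) (v0x x y a).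
Proof.
have e0 : 0 < (y - pi / 2) ^+ 2 + B1 ^+ 2 by rewrite ltr_wpDl// sqr_ge0.
have := der_v0_profile (B1 ^+ 2) a x e0; rewrite -/(v0x x y a).
by rewrite (_ : (fun t => _) = (fun t => v0 B1 t y a))//; apply/funext => t; rewrite /v0 addrA.
Qed.

Lemma v0_dy x y a : is_derive y (1 : R) (fun t => v0 B1 x t a) (v0y x y a).
Proof.
have e0 : 0 < (x - a) ^+ 2 + B1 ^+ 2 by rewrite ltr_wpDl// sqr_ge0.
have := der_v0_profile (B1 ^+ 2) (pi / 2) y e0; rewrite -/(v0y x y a).
rewrite (_ : (fun t => _) = (fun t => v0 B1 x t a))//.
by apply/funext => t; rewrite /v0 addrCA addrA.
Qed.

Lemma v0x_bound x y a : 0 <= x <= pi -> 0 <= a <= pi -> `|v0x x y a| <= 2 * B1 ^+ 2 * pi / (B1 ^+ 2) ^+ 2.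
Proof.
move=> /andP[x0 x1] /andP[a0 a1]; apply: der_v0_profile_bound => //; first by rewrite ler_wpDl// sqr_ge0.
  exact: ltW.
by rewrite ler_norml; apply/andP; split; lra.
Qed.

Lemma v0y_bound x y a : 0 <= y <= pi -> `|v0y x y a| <= 2 * B1 ^+ 2 * pi / (B1 ^+ 2) ^+ 2.
Proof.
move=> /andP[y0 y1]; apply: der_v0_profile_bound => //; first by rewrite ler_wpDl// sqr_ge0.
  exact: ltW.
by rewrite ler_norml; apply/andP; split; lra.
Qed.

(** On the cube, |x - a| <= pi and |y - pi / 2| <= pi / 2. *)
Lemma v0_lower (x y a : R) : 0 <= x <= pi -> 0 <= y <= pi -> 0 <= a <= pi ->
  B1 ^+ 2 / (B1 ^+ 2 + 5 * pi ^+ 2 / 4) <= v0 B1 x y a.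
Proof.
move=> /andP[x0 x1] /andP[y0 y1] /andP[a0 a1]; have pi0 := pi_gt0 R.
have h1 : (x - a) ^+ 2 <= Pi ^+ 2.
  rewrite -real_normK ?num_real// lerXn2r ?nnegrE//; first exact: ltW.
  by rewrite ler_norml; apply/andP; split; lra.
have h2 : (y - pi / 2) ^+ 2 <= (Pi / 2) ^+ 2.
  rewrite -real_normK ?num_real// lerXn2r ?nnegrE//; first by lra.
  by rewrite ler_norml; apply/andP; split; lra.
have k1 := sqr_ge0 (x - a); have k2 := sqr_ge0 (y - pi / 2); have k3 := sqr_ge0 Pi.
apply: ler_wpM2l; first exact: ltW.
have q1 : 0 < (x - a) ^+ 2 + (y - pi / 2) ^+ 2 + B1 ^+ 2 by apply: ltr_wpDl => //; exact: addr_ge0.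
have q2 : 0 < B1 ^+ 2 + 5 * Pi ^+ 2 / 4 by apply: ltr_wpDr => //; rewrite divr_ge0// mulr_ge0.
rewrite lef_pV2 ?posrE//.
by move: h2; rewrite expr_div_n; lra.
Qed.

Lemma v0_le1 x y a : `|v0 B1 x y a| <= 1.
Proof.
have k1 := sqr_ge0 (x - a); have k2 := sqr_ge0 (y - pi / 2).
have p0 : 0 < (x - a) ^+ 2 + (y - pi / 2) ^+ 2 + B1 ^+ 2 by apply: ltr_wpDl => //; exact: addr_ge0.
rewrite ger0_norm; last by rewrite /v0 divr_ge0// ltW.
by rewrite /v0 ler_pdivrMr// mul1r; lra.
Qed.

Let crd1 : continuous (fun u : X => cp u.1.1).
Proof. by apply: (compfun_cont cp_cont); do 2 apply: fstfun_cont; exact: idfun_cont. Qed.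
Let crd2 : continuous (fun u : X => cp u.1.2).
Proof. by apply: (compfun_cont cp_cont); apply: sndfun_cont; apply: fstfun_cont; exact: idfun_cont. Qed.
Let crd3 : continuous (fun u : X => cp u.2).
Proof. by apply: (compfun_cont cp_cont); apply: sndfun_cont; exact: idfun_cont. Qed.

Lemma lift3_v0_cont : continuous (lift3 (v0 B1)).
Proof.
apply: mulfun_cont; first exact: cst_continuous.
apply: invfun_cont.
  by move=> u; rewrite gt_eqF// ltr_wpDl// addr_ge0// sqr_ge0.
apply: addfun_cont; last exact: cst_continuous.
apply: addfun_cont; apply: expfun_cont; apply: subfun_cont => //; exact: cst_continuous.
Qed.

Lemma lift3_v0x_cont : continuous (lift3 v0x).
Proof.
apply: mulfun_cont.
  apply: oppfun_cont; apply: mulfun_cont; first exact: cst_continuous.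
  exact: subfun_cont.
apply: invfun_cont.
  by move=> u; rewrite gt_eqF// exprn_gt0// ltr_wpDl ?sqr_ge0// ltr_wpDl ?sqr_ge0.
apply: expfun_cont; apply: addfun_cont; first by apply: expfun_cont; exact: subfun_cont.
apply: addfun_cont; last exact: cst_continuous.
by apply: expfun_cont; apply: subfun_cont => //; exact: cst_continuous.
Qed.

Lemma lift3_v0y_cont : continuous (lift3 v0y).
Proof.
apply: mulfun_cont.
  apply: oppfun_cont; apply: mulfun_cont; first exact: cst_continuous.
  by apply: subfun_cont => //; exact: cst_continuous.
apply: invfun_cont.
  by move=> u; rewrite gt_eqF// exprn_gt0// ltr_wpDl ?sqr_ge0// ltr_wpDl ?sqr_ge0.
apply: expfun_cont; apply: addfun_cont.
  by apply: expfun_cont; apply: subfun_cont => //; exact: cst_continuous.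
apply: addfun_cont; last exact: cst_continuous.
by apply: expfun_cont; exact: subfun_cont.
Qed.

Definition dsinK (k : 'I_K) (x : R) : R := k.+1%:R * cos (k.+1%:R * x).

Definition basis_fun (i : I) : X -> R := lift3 (fun x y a => phi 0 i.1.1 a * sinK i.1.2 x * sinK i.2 y).
Definition basis_dx (i : I) : X -> R := lift3 (fun x y a => phi 0 i.1.1 a * dsinK i.1.2 x * sinK i.2 y).
Definition basis_dy (i : I) : X -> R := lift3 (fun x y a => phi 0 i.1.1 a * sinK i.1.2 x * dsinK i.2 y).

Lemma sinK_cont (k : 'I_K) : continuous (sinK k : R -> R).
Proof. exact: sinaff_cont. Qed.

Lemma dsinK_cont (k : 'I_K) : continuous (dsinK k).
Proof.
apply: mulfun_cont; first exact: cst_continuous.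
apply: (compfun_cont (@continuous_cos R)).
by apply: mulfun_cont; [exact: cst_continuous|exact: idfun_cont].
Qed.

Lemma lift3_prod_cont (f g h : R -> R) : continuous f -> continuous g -> continuous h ->
  continuous (lift3 (fun x y a => f a * g x * h y)).
Proof.
move=> cf cg ch; apply: mulfun_cont; [apply: mulfun_cont|].
- exact: (compfun_cont cf crd3).
- exact: (compfun_cont cg crd1).
- exact: (compfun_cont ch crd2).
Qed.

Lemma basis_fun_cont i : continuous (basis_fun i).
Proof. by apply: lift3_prod_cont; [exact: phi_cont|exact: sinK_cont|exact: sinK_cont]. Qed.
Lemma basis_dx_cont i : continuous (basis_dx i).
Proof. by apply: lift3_prod_cont; [exact: phi_cont|exact: dsinK_cont|exact: sinK_cont]. Qed.
Lemma basis_dy_cont i : continuous (basis_dy i).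
Proof. by apply: lift3_prod_cont; [exact: phi_cont|exact: sinK_cont|exact: dsinK_cont]. Qed.

Lemma sinK_le1 (k : 'I_K) (x : R) : `|sinK k x| <= 1.
Proof. exact: norm_sin_le1. Qed.

Lemma dsinK_le (k : 'I_K) (x : R) : `|dsinK k x| <= K%:R.
Proof.
rewrite /dsinK normrM ger0_norm// -[leRHS]mulr1; apply: ler_pM => //; first by rewrite ler_nat.
by rewrite ler_norml cos_le1 cos_geN1.
Qed.

Lemma basis_bound : exists2 P : R, 0 < P & forall i u,
  [/\ `|basis_fun i u| <= P, `|basis_dx i u| <= P & `|basis_dy i u| <= P].
Proof.
have /choice[C hC] : forall n : 'I_N, exists C : R, 0 < C /\ forall a, 0 <= a <= pi -> `|phi 0 n a| <= C.
  by move=> n; have [C C0 hC] := cont_bound 0 Pi (@phi_cont R 0 n); exists C.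
pose S := \sum_(n < N) C n.
have S0 : 0 <= S by apply: sumr_ge0 => n _; rewrite ltW//; case: (hC n).
have CS n : C n <= S.
  by rewrite /S (bigD1 n)//= lerDl sumr_ge0// => m _; rewrite ltW//; case: (hC m).
exists (S * (1 + K%:R) + 1); first by rewrite ltr_wpDl// mulr_ge0// addr_ge0.
have K0 : 0 <= K%:R :> R by [].
have prod3 (x y z : R) : `|x| <= S -> `|y| <= 1 + K%:R -> `|z| <= 1 -> `|x * y * z| <= S * (1 + K%:R) + 1.
  move=> hx hy hz; rewrite !normrM; apply: (@le_trans _ _ (S * (1 + K%:R) * 1)); last by lra.
  by apply: ler_pM; rewrite ?mulr_ge0//; apply: ler_pM.
have ph (i : I) u : `|phi 0 i.1.1 (cp u)| <= S.
  by apply: le_trans (CS i.1.1); case: (hC i.1.1) => _; apply.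
have s1 (k : 'I_K) (x : R) : `|sinK k x| <= 1 + K%:R by apply: le_trans (sinK_le1 _ _) _; lra.
have s2 (k : 'I_K) (x : R) : `|dsinK k x| <= 1 + K%:R by apply: le_trans (dsinK_le _ _) _; lra.
move=> i u; split.
- by apply: prod3 => //; exact: sinK_le1.
- by apply: prod3 => //; exact: sinK_le1.
- by rewrite /basis_dy /lift3 mulrAC; apply: prod3 => //; exact: sinK_le1.
Qed.

End Data.

(** * Identification with the given functional *)

Section DataForwardMap.
Context {R : realType}.
Variables (B1 B2 : R) (N K : nat).
Hypotheses (B1_gt0 : 0 < B1) (B12 : B1 < B2).
Variables (p q : R -> R -> R -> R -> R).
Local Notation X := (R * R * R)%type.
Local Notation I := (idx N K).
Local Notation Pi := (@pi R).
Local Notation sinK := Defs.sinK.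

Let pB (x y a : R) := p x y B2 a.

Definition travel_data : @forward_data R X I := ForwardData
  (fun v => lift3 (v0 B1) v.2 + lift4 B1 B2 q v) (@basis_fun R N K)
  (fun v => lift3 (v0x B1) v.2 + lift4 B1 B2 (d1of4 Ipi q) v) (@basis_dx R N K) (lift3 (d1of3 Ipi pB))
  (fun v => lift3 (v0y B1) v.2 + lift4 B1 B2 (d2of4 Ipi q) v) (@basis_dy R N K) (lift3 (d2of3 Ipi pB))
  (@coef R N K).

Variable A : R.
Hypothesis C1p : C1_3 Ipi Ipi Ipi pB.
Hypothesis C1q : C1_4 Ipi Ipi (Iz B1 B2) Ipi q.
Hypothesis pA : normC1_3 Ipi Ipi Ipi pB <= A.
Hypothesis qA : normC1_4 Ipi Ipi (Iz B1 B2) Ipi q <= A.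

Let cpP t : 0 <= clamp 0 Pi t <= pi. Proof. by apply: clamp_in; exact: pi_ge0. Qed.
Let czP t : B1 <= clamp B1 B2 t <= B2. Proof. by apply: clamp_in; exact: ltW. Qed.

Let D3 : set X := box3 Ipi Ipi Ipi.
Let D4 : set (R * R * R * R) := box4 Ipi Ipi (Iz B1 B2) Ipi.

Let D3_compact : compact D3.
Proof. by apply: compact_setX; [apply: compact_setX|]; exact: segment_compact. Qed.
Let D4_compact : compact D4.
Proof.
by apply: compact_setX; [apply: compact_setX; [apply: compact_setX|]|]; exact: segment_compact.
Qed.

Lemma lift3_supnorm f u : {within D3, continuous (unc3 f)} -> `|lift3 f u| <= supnorm D3 (unc3 f).
Proof.
move=> cf; apply: (supnorm_ub (u := (clamp 0 Pi u.1.1, clamp 0 Pi u.1.2, clamp 0 Pi u.2)) D3_compact cf).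
by split; [split|]; rewrite /Ipi/= in_itv/=; exact: cpP.
Qed.

Lemma lift4_supnorm f v : {within D4, continuous (unc4 f)} ->
  `|lift4 B1 B2 f v| <= supnorm D4 (unc4 f).
Proof.
move=> cf; apply: (supnorm_ub (u := (clamp 0 Pi v.2.1.1, clamp 0 Pi v.2.1.2, clamp B1 B2 v.1, clamp 0 Pi v.2.2)) D4_compact cf).
by split; [split; [split|]|]; rewrite /= ?/Ipi ?/Iz/= in_itv/=; by [exact: cpP|exact: czP].
Qed.

Lemma q_bounds v : [/\ `|lift4 B1 B2 q v| <= A, `|lift4 B1 B2 (d1of4 Ipi q) v| <= A &
  `|lift4 B1 B2 (d2of4 Ipi q) v| <= A].
Proof.
case: C1q => _ [c0 c1 c2 c3 c4]; have := qA; rewrite /normC1_4 -/D4.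
have := lift4_supnorm v c0; have := lift4_supnorm v c1; have := lift4_supnorm v c2.
have := supnorm_ge0 D4 (unc4 q); have := supnorm_ge0 D4 (unc4 (d1of4 Ipi q)).
have := supnorm_ge0 D4 (unc4 (d2of4 Ipi q)); have := supnorm_ge0 D4 (unc4 (d3of4 (Iz B1 B2) q)).
have := supnorm_ge0 D4 (unc4 (d4of4 Ipi q)).
move: (supnorm _ _) (supnorm _ _) (supnorm _ _) (supnorm _ _) (supnorm _ _) => s0 s1 s2 s3 s4.
by move: `|_| `|_| `|_| => *; split; lra.
Qed.

Lemma p_bounds u : `|lift3 (d1of3 Ipi pB) u| <= A /\ `|lift3 (d2of3 Ipi pB) u| <= A.
Proof.
case: C1p => _ [c0 c1 c2 c3]; have := pA; rewrite /normC1_3 -/D3.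
have := lift3_supnorm u c1; have := lift3_supnorm u c2.
have := supnorm_ge0 D3 (unc3 pB); have := supnorm_ge0 D3 (unc3 (d1of3 Ipi pB)).
have := supnorm_ge0 D3 (unc3 (d2of3 Ipi pB)); have := supnorm_ge0 D3 (unc3 (d3of3 Ipi pB)).
move: (supnorm _ _) (supnorm _ _) (supnorm _ _) (supnorm _ _) => s0 s1 s2 s3.
by move: `|_| `|_| => *; split; lra.
Qed.

Definition v0_slope : R := 2 * B1 ^+ 2 * pi / (B1 ^+ 2) ^+ 2.

Lemma v0_slope_ge0 : 0 <= v0_slope.
Proof. by rewrite divr_ge0 ?sqr_ge0// mulr_ge0 ?pi_ge0// mulr_ge0// sqr_ge0. Qed.

Let snd_cont (T U : topologicalType) : continuous (fun v : T * U => v.2).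
Proof. exact: sndfun_cont (@idfun_cont _). Qed.

Lemma travel_data_ok (P CL : R) : 0 <= P -> 0 <= A ->
  (forall i u, [/\ `|@basis_fun R N K i u| <= P, `|@basis_dx R N K i u| <= P & `|@basis_dy R N K i u| <= P]) ->
  (forall i (f : X -> R) M, continuous f -> (forall u, cube u -> `|f u| <= M) -> `|@coef R N K i f| <= CL * M) ->
  forward_data_ok B2 (v0_slope + A + P) CL travel_data.
Proof.
move=> P0 A0 bP LC; have s0 := v0_slope_ge0.
case: (C1q) => _ [cq cqx cqy _ _]; case: (C1p) => _ [_ cpx cpy _].
have cs (f : X -> R) (g : R * X -> R) : continuous f -> continuous g ->
    continuous (fun v => f v.2 + g v).
  move=> cf cg; apply: addfun_cont => //; apply: (compfun_cont cf).
  exact: snd_cont.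
split.
- split; [split|split] => /=.
  + by apply: cs; [exact: lift3_v0_cont|exact: lift4_cont].
  + by move=> i; exact: basis_fun_cont.
  + by apply: cs; [exact: lift3_v0x_cont|exact: lift4_cont].
  + by move=> i; exact: basis_dx_cont.
  + exact: lift3_cont.
  + move=> v; apply: le_trans (ler_normD _ _) _.
    have h1 : `|lift3 (v0x B1) v.2| <= v0_slope by exact: v0x_bound.
    have [_ h2 _] := q_bounds v; lra.
  + move=> i u; have [h _ _] := bP i u; lra.
  + move=> i u; have [_ h _] := bP i u; lra.
  + move=> u; have [h _] := p_bounds u; lra.
- split; [split|split] => /=.
  + by apply: cs; [exact: lift3_v0_cont|exact: lift4_cont].
  + by move=> i; exact: basis_fun_cont.
  + by apply: cs; [exact: lift3_v0y_cont|exact: lift4_cont].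
  + by move=> i; exact: basis_dy_cont.
  + exact: lift3_cont.
  + move=> v; apply: le_trans (ler_normD _ _) _.
    have h1 : `|lift3 (v0y B1) v.2| <= v0_slope by exact: v0y_bound.
    have [_ _ h2] := q_bounds v; lra.
  + move=> i u; have [h _ _] := bP i u; lra.
  + move=> i u; have [_ _ h] := bP i u; lra.
  + move=> u; have [_ h] := p_bounds u; lra.
- split => /=.
  + by move=> i f g c cf cg; exact: coef_lin.
  + by move=> i f M cf fM; apply: LC.
  + by move=> i F cF; exact: (@coef_cont R N K i (R * R)%type F cF).
  + by move=> i F z cF; exact: coef_prim.
Qed.

Variable beta : R.
Local Notation VQ := (@VQ R N K beta).
Local Notation vQq := (@vQq R B1 N K beta q).

Lemma VQ_dx Q x y z a :
  is_derive x (1 : R) (fun t => VQ Q t y z a) (\sum_i Q i z * (phi 0 i.1.1 a * dsinK i.1.2 x * sinK i.2 y)).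
Proof.
apply: der_sum => i; rewrite phi_indep.
have := @der_scale R _ _ (Q i z * phi 0 i.1.1 a * sinK i.2 y) x (der_sin i.1.2.+1%:R x).
rewrite (_ : (fun t => _) = (fun t => Q i z * phi 0 i.1.1 a * sinK i.1.2 t * sinK i.2 y)); last first.
  by apply/funext => t; rewrite /Defs.sinK; ring.
by move/is_derive_eq; apply; rewrite /dsinK; ring.
Qed.

Lemma VQ_dy Q x y z a :
  is_derive y (1 : R) (fun t => VQ Q x t z a) (\sum_i Q i z * (phi 0 i.1.1 a * sinK i.1.2 x * dsinK i.2 y)).
Proof.
apply: der_sum => i; rewrite phi_indep.
have := @der_scale R _ _ (Q i z * phi 0 i.1.1 a * sinK i.1.2 x) y (der_sin i.2.+1%:R y).
rewrite (_ : (fun t => _) = (fun t => Q i z * phi 0 i.1.1 a * sinK i.1.2 x * sinK i.2 t)); last first.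
  by apply/funext => t; rewrite /Defs.sinK; ring.
by move/is_derive_eq; apply; rewrite /dsinK; ring.
Qed.

Section Point.
Variables (Q : I -> R -> R) (x y z a : R).
Hypotheses (x01 : 0 <= x <= pi) (y01 : 0 <= y <= pi) (z01 : B1 <= z <= B2) (a01 : 0 <= a <= pi).

Let pt : R * X := (z, (x, y, a)).

Let lift3E f : lift3 f (x, y, a) = f x y a. Proof. by rewrite /lift3 /= !clamp_id. Qed.
Let lift4E f : lift4 B1 B2 f pt = f x y z a. Proof. by rewrite /lift4 /= !clamp_id. Qed.
Let QE i : clampz B1 B2 Q i z = Q i z. Proof. by rewrite /clampz clamp_id. Qed.

Lemma ansatz_vQq : ansatz (dw0 travel_data) (db0 travel_data) (clampz B1 B2 Q) pt = vQq Q x y z a.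
Proof.
rewrite /ansatz /= lift3E lift4E /Defs.vQq; congr (_ + _); apply: eq_bigr => i _.
by rewrite QE /basis_fun lift3E phi_indep !mulrA.
Qed.

Let pi0 : (0 : R) < pi. Proof. exact: pi_gt0. Qed.

Lemma ansatz_vQq_dx : ansatz (dwx travel_data) (dbx travel_data) (clampz B1 B2 Q) pt = d1of4 Ipi (vQq Q) x y z a.
Proof.
case: (C1q) => /(_ x y z a) dq _.
have [|||| dqx _ _ _] := dq; rewrite ?/Ipi ?/Iz/= ?in_itv//=.
have [d1 e1] := is_derive_deriv_in pi0 x01 (v0_dx B1_gt0 x y a).
have [d2 e2] := is_derive_deriv_in pi0 x01 (VQ_dx Q x y z a).
have [d3 e3] := deriv_in_add pi0 x01 d1 dqx.
have [_ e4] := deriv_in_add pi0 x01 d3 d2.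
rewrite /ansatz /= lift3E lift4E [RHS]e4 e3 e1 e2; congr (_ + _); apply: eq_bigr => i _.
by rewrite QE /basis_dx lift3E.
Qed.

Lemma ansatz_vQq_dy : ansatz (dwy travel_data) (dby travel_data) (clampz B1 B2 Q) pt = d2of4 Ipi (vQq Q) x y z a.
Proof.
case: (C1q) => /(_ x y z a) dq _.
have [|||| _ dqy _ _] := dq; rewrite ?/Ipi ?/Iz/= ?in_itv//=.
have [d1 e1] := is_derive_deriv_in pi0 y01 (v0_dy B1_gt0 x y a).
have [d2 e2] := is_derive_deriv_in pi0 y01 (VQ_dy Q x y z a).
have [d3 e3] := deriv_in_add pi0 y01 d1 dqy.
have [_ e4] := deriv_in_add pi0 y01 d3 d2.
rewrite /ansatz /= lift3E lift4E [RHS]e4 e3 e1 e2; congr (_ + _); apply: eq_bigr => i _.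
by rewrite QE /basis_dy lift3E.
Qed.

End Point.

Lemma dsqrtE (v d : R) : d / (2 * Num.sqrt v) = dsqrt v d.
Proof. by rewrite /dsqrt /rroot invfM [2^-1 * _]mulrC. Qed.

Lemma EX_Ex Q x y z a : 0 <= x <= pi -> 0 <= y <= pi -> B1 <= z <= B2 -> 0 <= a <= pi ->
  Ex B1 B2 beta p q Q x y z a = EX B2 travel_data (clampz B1 B2 Q) (z, (x, y, a)).
Proof.
move=> x01 y01 /andP[z0 z1] a01; rewrite /EX /time_slope /= primNE//; congr (- _ + _).
  apply: eq_ig => s /andP[s0 s1]; have sab : B1 <= s <= B2 by rewrite s1 (le_trans z0).
  by rewrite dsqrtE /slowness ansatz_vQq// ansatz_vQq_dx.
by rewrite /lift3 /= !clamp_id.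
Qed.

Lemma EY_Ey Q x y z a : 0 <= x <= pi -> 0 <= y <= pi -> B1 <= z <= B2 -> 0 <= a <= pi ->
  Ey B1 B2 beta p q Q x y z a = EY B2 travel_data (clampz B1 B2 Q) (z, (x, y, a)).
Proof.
move=> x01 y01 /andP[z0 z1] a01; rewrite /EY /time_slope /= primNE//; congr (- _ + _).
  apply: eq_ig => s /andP[s0 s1]; have sab : B1 <= s <= B2 by rewrite s1 (le_trans z0).
  by rewrite dsqrtE /slowness ansatz_vQq// ansatz_vQq_dy.
by rewrite /lift3 /= !clamp_id.
Qed.

Definition shift_term (i : I) (z : R) : R :=
  coef i (lift3 (v0 B1)) + coef i (fun u : X => lift4 B1 B2 q (z, u)).

Lemma shift_term_cont i : continuous (shift_term i).
Proof.
case: (C1q) => _ [cq _ _ _ _].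
apply: addfun_cont; first exact: cst_continuous.
exact: (@coef_cont R N K i R _ (lift4_cont B12 cq)).
Qed.

Lemma shift_term_bound (CL : R) i z :
  (forall i (f : X -> R) M, continuous f -> (forall u, cube u -> `|f u| <= M) -> `|@coef R N K i f| <= CL * M) ->
  `|shift_term i z| <= CL * (1 + A).
Proof.
move=> LC; case: (C1q) => _ [cq _ _ _ _].
apply: le_trans (ler_normD _ _) _; rewrite mulrDr; apply: lerD.
  by apply: LC; [exact: lift3_v0_cont|move=> u _; exact: v0_le1].
apply: LC; first exact: (@curry_right_cont R R X _ z (lift4_cont B12 cq)).
by move=> u _; case: (q_bounds (z, u)).
Qed.

Section Identification.
Variables (c M rho CL : R).
Hypothesis c0 : 0 < c.
Hypothesis ok : forward_data_ok B2 M CL travel_data.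

Lemma calF_forward Q i z : adm_of c rho travel_data (clampz B1 B2 Q) -> B1 <= z <= B2 ->
  calF B1 B2 beta p q Q i z = forward B2 travel_data (clampz B1 B2 Q) i z.
Proof.
move=> aQ zab.
apply: (@Lambda_eq R N K beta _ (fun u => EX B2 travel_data (clampz B1 B2 Q) (z, u) ^+ 2 + EY B2 travel_data (clampz B1 B2 Q) (z, u) ^+ 2)).
  apply: addfun_cont; apply: expfun_cont.
    exact: (@curry_right_cont R R X _ z (@EX_cont _ _ _ _ _ _ _ _ _ c0 ok _ aQ)).
  exact: (@curry_right_cont R R X _ z (@EY_cont _ _ _ _ _ _ _ _ _ c0 ok _ aQ)).
by move=> x y a x01 y01 a01; rewrite EX_Ex// EY_Ey.
Qed.

Lemma shift_term_hat i z : B1 <= z <= B2 -> v0_hat B1 beta i + q_hat beta q i z = shift_term i z.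
Proof.
move=> zab; case: (C1q) => _ [cq _ _ _ _]; congr (_ + _); apply: Lambda_eq.
- exact: lift3_v0_cont.
- by move=> x y a x01 y01 a01; rewrite /lift3 /= !clamp_id.
- exact: (@curry_right_cont R R X _ z (lift4_cont B12 cq)).
- by move=> x y a x01 y01 a01; rewrite /lift4 /= !clamp_id.
Qed.

(** The factor e^{-2 lambda B1} is absorbed by the normalization of the weight. *)
Lemma J_weighted_residual (lambda alpha : R) Q : adm_of c rho travel_data (clampz B1 B2 Q) ->
  J B1 B2 beta p q lambda alpha Q =
  weighted_residual B1 B2 lambda (forward B2 travel_data) shift_term (clampz B1 B2 Q) + alpha * nrm1 B1 B2 Q ^+ 2.
Proof.
move=> aQ; rewrite /J nrm1.unlock; congr (_ + _); rewrite /weighted_residual.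
have cr i : continuous (fun z => residual (forward B2 travel_data) shift_term (clampz B1 B2 Q) i z).
  apply: subfun_cont; last exact: shift_term_cont.
  by apply: subfun_cont; [case: aQ|exact: (@forward_cont _ _ _ _ _ _ _ _ _ c0 ok _ i aQ)].
have cS : continuous (fun z => \sum_i residual (forward B2 travel_data) shift_term (clampz B1 B2 Q) i z ^+ 2).
  by apply: sumfun_cont => i; apply: expfun_cont; exact: cr.
rewrite (@eq_ig _ _ _ _ (fun z => (\sum_i residual (forward B2 travel_data) shift_term (clampz B1 B2 Q) i z ^+ 2) * expR (2 * lambda * (z - 0)))).
  rewrite -igZ; last by apply: mulfun_cont => //; exact: exp_affine_cont.
  apply: eq_ig => z _; rewrite /weight mulrCA; congr (_ * _); rewrite -expRD; congr expR; ring.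
move=> z zab; rewrite subr0; congr (_ * _); apply: eq_bigr => i _; congr (_ ^+ 2).
by rewrite /residual -shift_term_hat// calF_forward// [in RHS]/clampz clamp_id//; ring.
Qed.

End Identification.

End DataForwardMap.

(** * Differentiability and strict convexity *)

Section ConvexifiedFunctional.
Context {R : realType}.
Variables (B1 B2 : R) (N K : nat).
Hypotheses (B1_gt0 : 0 < B1) (B12 : B1 < B2).
Variables (r A d : R).
Hypotheses (r_gt0 : 0 < r) (A_gt0 : 0 < A).
Hypothesis d_lt : d < B1 ^+ 2 / (B1 ^+ 2 + 5 * pi ^+ 2 / 4).
Local Notation X := (R * R * R)%type.
Local Notation I := (idx N K).
Local Notation H10 := (@H10 R B1 B2 I).
Local Notation nrm1 := (@nrm1 R B1 B2 I).
Local Notation clz := (@clampz R I B1 B2).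
Local Notation travel_data := (@travel_data R B1 B2 N K).
Implicit Types (Q h : I -> R -> R).

(** Half of the lower bound of v on the ball; the other half is the room needed
    around each point for differentiability. *)
Definition half_gap : R := (B1 ^+ 2 / (B1 ^+ 2 + 5 * pi ^+ 2 / 4) - d) / 2.

(** The sup-norm bound on the ball of radius 2 r, with a margin of 1 for the same
    reason. *)
Definition sup_radius : R := Num.sqrt (B2 - B1) * (2 * r) + 1.

Lemma half_gap_gt0 : 0 < half_gap.
Proof. by apply: divr_gt0 => //; rewrite subr_gt0. Qed.

Lemma sup_radius_ge0 : 0 <= sup_radius.
Proof.
have r0 := ltW r_gt0; rewrite /sup_radius.
by apply: addr_ge0 => //; rewrite mulr_ge0 ?sqrtr_ge0// mulr_ge0.
Qed.

Definition data_ok (p q : R -> R -> R -> R -> R) : Prop :=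
  [/\ data_pair B1 B2 p q, normC1_3 Ipi Ipi Ipi (fun x y a => p x y B2 a) <= A &
      normC1_4 Ipi Ipi (Iz B1 B2) Ipi q <= A].

Definition adms p q Q : Prop := adm_of half_gap sup_radius (travel_data p q) Q.

(** The hypotheses of the abstract theory, for one constant C which will serve all
    data at once. *)
Definition setting (C : R) p q : Prop :=
  [/\ forall Q, adms p q Q -> forall i, continuous (forward B2 (travel_data p q) Q i),
      forall Q, adms p q Q -> forall i j, continuous (forward_kernel B2 (travel_data p q) Q i j),
      forall i, continuous (@shift_term R B1 B2 N K q i) &
  [/\ forall i z, B1 <= z <= B2 -> `|@shift_term R B1 B2 N K q i z| <= C,
      volterra_estimates B1 B2 C (adms p q) (forward B2 (travel_data p q)) (forward_kernel B2 (travel_data p q)) &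
      forall beta lambda alpha Q, H10 Q -> adms p q (clz Q) ->
        J B1 B2 beta p q lambda alpha Q =
        weighted_residual B1 B2 lambda (forward B2 (travel_data p q)) (@shift_term R B1 B2 N K q) (clz Q) + alpha * nrm1 Q ^+ 2]].

Lemma setting_holds : exists2 C : R, 0 <= C & forall p q, data_ok p q -> setting C p q.
Proof.
have [P P0 bP] := @basis_bound R N K.
have [CL CL0 LC] := @coef_bound R N K.
have c0 := half_gap_gt0; have r0 := sup_radius_ge0.
have M0 : 0 <= v0_slope B1 + A + P.
  by have := v0_slope_ge0 B1; move: (ltW P0) (ltW A_gt0) => ? ? ?; rewrite !addr_ge0.
have [C C0 HC] := @forward_estimates R X I B1 B2 (ltW B12) half_gap _ sup_radius CL c0 M0 r0 (ltW CL0).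
have A0 := ltW A_gt0; have CL1 := ltW CL0.
have cA : 0 <= CL * (1 + A) by rewrite mulr_ge0// addr_ge0.
exists (C + CL * (1 + A)); first by rewrite addr_ge0// ltW.
move=> p q [[C1p _ C1q _ _] pA qA].
have ok := travel_data_ok B1_gt0 B12 C1p C1q pA qA (ltW P0) (ltW A_gt0) bP LC.
split; [| | |split].
- by move=> Q aQ i; exact: (@forward_cont _ _ _ _ _ _ _ _ _ c0 ok _ i aQ).
- by move=> Q aQ i j; exact: (@forward_kernel_cont _ _ _ _ _ _ _ _ _ c0 ok _ i j aQ).
- by move=> i; exact: shift_term_cont.
- move=> i z zab; apply: (@le_trans _ _ (CL * (1 + A))); last by rewrite lerDr ltW.
  exact: (shift_term_bound B1_gt0 B12 C1q qA).
- by apply: volterra_estimates_le (HC _ ok); rewrite lerDl.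
- move=> beta lambda alpha Q hQ aQ.
  exact: (J_weighted_residual B1_gt0 B12 C1q beta c0 ok lambda alpha aQ).
Qed.

Section GoodPoints.
Variables (p q : R -> R -> R -> R -> R) (beta : R).
Hypothesis C1q : C1_4 Ipi Ipi (Iz B1 B2) Ipi q.

(** Admissibility with a margin, so that it persists in an H^1 neighbourhood. *)
Definition interior_adm Q : Prop :=
  [/\ H10 Q, (forall i s, `|clz Q i s| <= sup_radius - 1) &
      (forall v, 2 * half_gap <= ansatz (dw0 (travel_data p q)) (db0 (travel_data p q)) (clz Q) v)].

Lemma ansatz_stable Q1 Q2 (P : R) v : (forall i u, `|@basis_fun R N K i u| <= P) -> 0 <= P -> H10 Q1 -> H10 Q2 ->
  `|ansatz (dw0 (travel_data p q)) (db0 (travel_data p q)) (clz Q2) v - ansatz (dw0 (travel_data p q)) (db0 (travel_data p q)) (clz Q1) v|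
  <= P * (#|I|%:R * Num.sqrt (B2 - B1)) * nrm1 (Q2 - Q1).
Proof.
move=> bP P0 h1 h2; apply: le_trans (ansatz_diff _ _ _ _ bP) _.
rewrite -mulrA ler_wpM2l//.
exact: (@clampz_l1norm R I B1 B2 B12 (Q2 - Q1) v.1 (H10_sub B12 h2 h1)).
Qed.

Lemma interior_adm_near Q : interior_adm Q -> exists2 delta : R, 0 < delta &
  forall h, H10 h -> nrm1 h < delta -> adms p q (clz (Q + h)).
Proof.
move=> [hQ rQ vQ]; have [P P0 bP] := @basis_bound R N K.
have b0 i u : `|@basis_fun R N K i u| <= P by case: (bP i u).
have c0 := half_gap_gt0.
pose s := Num.sqrt (B2 - B1); have s0 : 0 <= s by exact: sqrtr_ge0.
pose k := P * (#|I|%:R * s); have k0 : 0 <= k by rewrite mulr_ge0 ?(ltW P0)// mulr_ge0.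
exists (Num.min (1 / (s + 1)) (half_gap / (k + 1))).
  by rewrite lt_min; apply/andP; split; apply: divr_gt0 => //; exact: ltr_wpDl.
move=> h hh; rewrite lt_min => /andP[l1 l2].
have hn := nrm1_ge0 B1 B2 h.
have e1 : s * nrm1 h <= 1.
  apply: (@le_trans _ _ ((s + 1) * (1 / (s + 1)))).
    by apply: ler_pM => //; [lra|exact: ltW].
  by rewrite mul1r divff// gt_eqF// ltr_wpDl.
have e2 : k * nrm1 h <= half_gap.
  apply: (@le_trans _ _ ((k + 1) * (half_gap / (k + 1)))).
    by apply: ler_pM => //; [lra|exact: ltW].
  by rewrite mulrC divfK// gt_eqF// ltr_wpDl.
have hQh := H10_add B12 hQ hh.
split.
- by move=> i; exact: (@H10_cont _ _ _ _ B12 _ i hQh).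
- move=> i z; apply: le_trans (ler_normD _ _) _.
  have := rQ i z; have := clampz_sup B12 i z hh; rewrite -/s /clampz => u1 u2; lra.
- move=> v; have := ansatz_stable v b0 (ltW P0) hQ hQh; rewrite -/s -/k.
  have -> : Q + h - Q = h by rewrite addrC addKr.
  by move/ler_normlP => [w1 _]; have := vQ v; lra.
Qed.

Lemma interior_adm_adm Q : interior_adm Q -> adms p q (clz Q).
Proof.
move=> [hQ rQ vQ]; have c0 := half_gap_gt0; split.
- by move=> i; exact: (@H10_cont _ _ _ _ B12 _ i hQ).
- by move=> i s; apply: le_trans (rQ i s) _; lra.
- by move=> v; apply: le_trans (vQ v); lra.
Qed.

Lemma ansatz_clamp Q v :
  ansatz (dw0 (travel_data p q)) (db0 (travel_data p q)) (clz Q) v =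
  vQq B1 beta q Q (clamp 0 pi v.2.1.1) (clamp 0 pi v.2.1.2) (clamp B1 B2 v.1) (clamp 0 pi v.2.2).
Proof.
have pi0 : (0 : R) <= pi := pi_ge0 R; have leB := ltW B12.
rewrite -(ansatz_vQq p q beta Q (clamp_in _ pi0) (clamp_in _ pi0) (clamp_in _ leB) (clamp_in _ pi0)).
rewrite /ansatz /= /lift3 /lift4 /= !(clamp_id (clamp_in _ _))//; congr (_ + _).
apply: eq_bigr => i _; rewrite /clampz /basis_fun /lift3 /=.
by rewrite !(clamp_id (clamp_in _ _)).
Qed.

Lemma ball_lower rr Q v : ball_Rqd B1 B2 beta rr q d Q ->
  2 * half_gap <= ansatz (dw0 (travel_data p q)) (db0 (travel_data p q)) (clz Q) v.
Proof.
have pi0 : (0 : R) <= pi := pi_ge0 R; have leB := ltW B12.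
move=> [_ _ vQ]; rewrite ansatz_clamp /vQq -addrA.
have h1 := v0_lower B1_gt0 (clamp_in v.2.1.1 pi0) (clamp_in v.2.1.2 pi0) (clamp_in v.2.2 pi0).
have := vQ (clamp 0 pi v.2.1.1) (clamp 0 pi v.2.1.2) (clamp B1 B2 v.1) (clamp 0 pi v.2.2).
rewrite /Ipi /Iz /= !in_itv/= !clamp_in// => /(_ isT isT isT isT) h2.
by rewrite /half_gap; lra.
Qed.

Lemma ball_interior_adm Q : ball_Rqd B1 B2 beta (2 * r) q d Q -> interior_adm Q.
Proof.
move=> bQ; have [hQ nQ _] := bQ; split=> //; last by move=> v; exact: ball_lower bQ.
move=> i s; apply: le_trans (clampz_sup B12 i s hQ) _; rewrite /sup_radius addrK ler_wpM2l ?sqrtr_ge0//.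
by rewrite nrm1.unlock ltW.
Qed.

(** Both bounds pass to H^1 limits because the sup norm is controlled by the H^1
    norm. *)
Lemma closure_interior_adm Q : closureH10 B1 B2 (ball_Rqd B1 B2 beta r q d) Q -> interior_adm Q.
Proof.
move=> [hQ clQ]; split=> //.
- move=> i s; have [P [hP nP _] nPQ] := clQ _ r_gt0.
  rewrite /sup_radius addrK (_ : clz Q i s = clz P i s - clz (P - Q) i s); last first.
    by rewrite /clampz opprB addrC subrK.
  apply: le_trans (ler_normB _ _) _.
  have := clampz_sup B12 i s hP; have := clampz_sup B12 i s (H10_sub B12 hP hQ).
  have s0 := sqrtr_ge0 (B2 - B1).
  have nP1 : nrm1 P <= r by rewrite nrm1.unlock; exact: ltW.
  have nPQ1 : nrm1 (P - Q) <= r by rewrite nrm1.unlock; exact: ltW.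
  have e1 := ler_wpM2l s0 nP1; have e2 := ler_wpM2l s0 nPQ1.
  rewrite mulrCA mulr_natl mulr2n => h1 h2.
  by apply: lerD; [exact: le_trans h2 e1|exact: le_trans h1 e2].
- move=> v; have [P P0 bP] := @basis_bound R N K.
  have b0 i u : `|@basis_fun R N K i u| <= P by case: (bP i u).
  set k := P * (#|I|%:R * Num.sqrt (B2 - B1)).
  have k0 : 0 <= k by rewrite mulr_ge0 ?(ltW P0)// mulr_ge0// sqrtr_ge0.
  apply/ler_addgt0Pr => e e0.
  have [|S bS nS] := clQ (e / (k + 1)); first by rewrite divr_gt0// ltr_wpDl.
  have [hS _ _] := bS.
  have := ansatz_stable v b0 (ltW P0) hQ hS; rewrite -/k => /ler_normlP [_ w].
  have n2 : k * nrm1 (S - Q) <= e.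
    apply: (@le_trans _ _ ((k + 1) * (e / (k + 1)))).
      by apply: ler_pM => //; [exact: nrm1_ge0|lra|rewrite nrm1.unlock ltW].
    by rewrite mulrC divfK// gt_eqF// ltr_wpDl.
  have := ball_lower v bS; lra.
Qed.

End GoodPoints.

Lemma frechet_at (C lambda alpha beta : R) p q Q : 0 <= C -> 0 < lambda ->
  setting C p q -> interior_adm p q Q -> exists g,
  is_grad B1 B2 lambda (forward B2 (travel_data p q)) (forward_kernel B2 (travel_data p q)) (@shift_term R B1 B2 N K q) alpha Q g /\
  frechet_grad B1 B2 (J B1 B2 beta p q lambda alpha) Q g.
Proof.
move=> C0 l0 [cF cK cc [bc est Je]] gQ; have [hQ _ _] := gQ.
have aQ := interior_adm_adm gQ.
have [delta d0 near] := interior_adm_near gQ.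
have cQ : forall Q, adms p q Q -> forall i, continuous (Q i) by move=> ? [].
have bQ : forall Q, adms p q Q -> forall i z, `|Q i z| <= sup_radius by move=> ? [].
have [g hg] := is_grad_exists B12 lambda cQ cF cK cc alpha hQ aQ.
exists g; split => //.
exact: (is_grad_frechet B12 C0 sup_radius_ge0 l0 cQ bQ cF cK cc bc est (Je beta lambda alpha) hQ aQ hg d0 near).
Qed.

End ConvexifiedFunctional.

Theorem theorem6p1 (R : realType) (B1 B2 : R) (N K : nat)
    (B1_gt0 : 0 < B1) (B12 : B1 < B2) (N_gt0 : (0 < N)%N) (K_gt0 : (0 < K)%N)
    (r A d : R) (r_gt0 : 0 < r) (A_gt0 : 0 < A)
    (d_gt0 : 0 < d) (d_lt : d < B1 ^+ 2 / (B1 ^+ 2 + 5 * pi ^+ 2 / 4)) :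
  (forall (beta : R) (p q : R -> R -> R -> R -> R) (lambda alpha : R),
     0 < beta ->
     data_pair B1 B2 p q ->
     normC1_3 Ipi Ipi Ipi (fun x y a => p x y B2 a) <= A ->
     normC1_4 Ipi Ipi (Iz B1 B2) Ipi q <= A ->
     0 < lambda -> 0 < alpha < 1 ->
     exists J' : (idx N K -> R -> R) -> (idx N K -> R -> R),
       (forall Q, ball_Rqd B1 B2 beta (2 * r) q d Q ->
          frechet_grad B1 B2 (J B1 B2 beta p q lambda alpha) Q (J' Q)) /\
       exists2 M : R, 0 < M &
         forall Q1 Q2,
           ball_Rqd B1 B2 beta (2 * r) q d Q1 ->
           ball_Rqd B1 B2 beta (2 * r) q d Q2 ->
           normH1 B1 B2 (J' Q2 - J' Q1) <= M * normH1 B1 B2 (Q2 - Q1)) /\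
  (exists2 lambda_bar : R, 1 < lambda_bar &
     forall (beta : R) (p q : R -> R -> R -> R -> R) (lambda alpha : R),
       0 < beta ->
       data_pair B1 B2 p q ->
       normC1_3 Ipi Ipi Ipi (fun x y a => p x y B2 a) <= A ->
       normC1_4 Ipi Ipi (Iz B1 B2) Ipi q <= A ->
       lambda_bar <= lambda -> 0 < alpha < 1 ->
       forall Q1 Q2 : idx N K -> R -> R,
         closureH10 B1 B2 (ball_Rqd B1 B2 beta r q d) Q1 ->
         closureH10 B1 B2 (ball_Rqd B1 B2 beta r q d) Q2 ->
         exists2 g : idx N K -> R -> R,
           frechet_grad B1 B2 (J B1 B2 beta p q lambda alpha) Q1 g &
           J B1 B2 beta p q lambda alpha Q2 - J B1 B2 beta p q lambda alpha Q1
             - dotH1 B1 B2 g (Q2 - Q1)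
           >= 1 / 8 * normL2 B1 B2 (Q2 - Q1) ^+ 2
              + alpha * normH1 B1 B2 (Q2 - Q1) ^+ 2).
Proof.
have [C C0 HC] := @setting_holds R B1 B2 N K B1_gt0 B12 r A d r_gt0 A_gt0 d_lt.
have rad := sup_radius_ge0 B1 B2 r_gt0.
split.
- move=> beta p q lambda alpha _ dpq pA qA l0 _.
  have st := HC p q (And3 dpq pA qA); have [cF cK cc [bc est Je]] := st.
  have good (Q : idx N K -> R -> R) : ball_Rqd B1 B2 beta (2 * r) q d Q -> interior_adm B1 B2 r d p q Q.
    exact: ball_interior_adm.
  have /choice[J' hJ'] : forall Q : idx N K -> R -> R, exists g, ball_Rqd B1 B2 beta (2 * r) q d Q ->
      is_grad B1 B2 lambda (forward B2 (travel_data B1 B2 N K p q)) (forward_kernel B2 (travel_data B1 B2 N K p q)) (shift_term B1 B2 q) alpha Q g /\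
      frechet_grad B1 B2 (J B1 B2 beta p q lambda alpha) Q g.
    move=> Q; have [bQ|] := pselect (ball_Rqd B1 B2 beta (2 * r) q d Q); last by exists Q.
    have [g hg] := frechet_at B12 r_gt0 d_lt alpha beta C0 l0 st (good Q bQ).
    by exists g.
  exists J'; split; first by move=> Q /hJ' [].
  have cQ : forall Q : idx N K -> R -> R, adms B1 B2 r d p q Q -> forall i, continuous (Q i) by move=> ? [].
  have bQ : forall Q : idx N K -> R -> R, adms B1 B2 r d p q Q -> forall i z, `|Q i z| <= sup_radius B1 B2 r by move=> ? [].
  have [M M0 HM] := is_grad_lipschitz B12 C0 rad l0 cQ bQ cF cK cc bc est alpha.
  exists M => // Q1 Q2 b1 b2.
  have [h1 _ _] := b1; have [h2 _ _] := b2.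
  have := HM Q1 Q2 (J' Q1) (J' Q2) h1 h2 (interior_adm_adm B12 d_lt (good _ b1))
    (interior_adm_adm B12 d_lt (good _ b2)) (hJ' _ b1).1 (hJ' _ b2).1.
  by rewrite nrm1.unlock.
- have gap0 : 0 <= volterra_gap (I := idx N K) B1 B2 C (sup_radius B1 B2 r) by exact: volterra_gap_ge0.
  exists (2 + 2 * volterra_gap (I := idx N K) B1 B2 C (sup_radius B1 B2 r)); first by lra.
  move=> beta p q lambda alpha _ dpq pA qA lam _ Q1 Q2 c1 c2.
  have l0 : 0 < lambda by lra.
  have st := HC p q (And3 dpq pA qA); have [cF cK cc [bc est Je]] := st.
  have cQ : forall Q : idx N K -> R -> R, adms B1 B2 r d p q Q -> forall i, continuous (Q i) by move=> ? [].
  have bQ : forall Q : idx N K -> R -> R, adms B1 B2 r d p q Q -> forall i z, `|Q i z| <= sup_radius B1 B2 r by move=> ? [].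
  have good (Q : idx N K -> R -> R) : closureH10 B1 B2 (ball_Rqd B1 B2 beta r q d) Q -> interior_adm B1 B2 r d p q Q.
    exact: closure_interior_adm.
  have g1 := good _ c1; have g2 := good _ c2.
  have [g [hg fg]] := frechet_at B12 r_gt0 d_lt alpha beta C0 l0 st g1.
  have [h1 _ _] := g1; have [h2 _ _] := g2.
  exists g => //.
  have := is_grad_convex B12 C0 rad l0 cQ bQ cF cK cc bc est (Je beta lambda alpha) lam h1 h2
    (interior_adm_adm B12 d_lt g1) (interior_adm_adm B12 d_lt g2) hg.
  by rewrite nrm1.unlock dot1.unlock.
Qed.
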